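(* Let $m\in\mathbb{N}$, let $\Theta\in(H^\infty)^{m\times m}$ be a rigid matrix, and suppose the associated $S$-coinvariant subspace $K_\Theta\subset(H^2)^m$ is nonzero. Then $$\vartheta_+(S_\Theta)\ \ge\ \sup_{x\in\mathcal{M}(H^\infty)}\big(\dim\operatorname{Ker}\Theta(x)\big).$$
   Context: $\mathbb{D}$ is the open unit disk, $\mathbb{T}$ the unit circle, $H^2,H^\infty$ the usual scalar Hardy spaces of $\mathbb{D}$. A matrix $\Theta\in(H^\infty)^{m\times m}$ is rigid if for almost every $e^{it}\in\mathbb{T}$ the non-tangential limit $\Theta(e^{it})$ is a partial isometry on $\mathbb{C}^m$, with the same initial space for almost every $e^{it}$ (the zero matrix is allowed). $K_\Theta:=(H^2)^m\ominus\Theta(H^2)^m$, $P_{K_\Theta}$ is the orthogonal projection of $(H^2)^m$ onto $K_\Theta$, $S$ is multiplication by $z$ on $(H^2)^m$, and $S_\Theta:=P_{K_\Theta}S|_{K_\Theta}:K_\Theta\to K_\Theta$. For a bounded operator $T$ on a separable Hilbert space $\mathcal{H}$, the unilateral frame number $\vartheta_+(T)$ is the minimum $k\in\mathbb{N}\cup\{\infty\}$ such that there is a frame for $\mathcal{H}$ formed by the union of $k$ orbits, i.e. a frame of the form $\{T^ng_j:n\ge0,\ j\in J\}$ with $g_j\in\mathcal{H}$ and $\#J=k$ ($J$ countable). (A countable indexed family $\{x_i\}$ in $\mathcal{H}$ is a frame if there are $A,B>0$ with $A\|h\|^2\le\sum_i|\langle h,x_i\rangle|^2\le B\|h\|^2$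 for all $h\in\mathcal{H}$.) $\mathcal{M}(H^\infty)$ is the maximal ideal space of $H^\infty$, i.e. the set of nonzero continuous multiplicative linear functionals $H^\infty\to\mathbb{C}$ with the weak$^*$ topology; $\mathbb{D}$ is contained in it via point evaluations. For $x\in\mathcal{M}(H^\infty)$ and $\Theta=(\theta_{ij})$, $\Theta(x):=(x(\theta_{ij}))\in\mathbb{C}^{m\times m}$ (entrywise Gelfand transform). *)

(* Defs.v *)
From HB Require Import structures.
From mathcomp Require Import all_boot all_order all_algebra.
From mathcomp Require Import all_classical all_reals all_analysis.
From mathcomp Require Export complex.

Set Implicit Arguments.
Unset Strict Implicit.
Unset Printing Implicit Defensive.

Import Order.TTheory GRing.Theory Num.Theory.
Import numFieldNormedType.Exports.

Local Open Scope classical_set_scope.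
Local Open Scope ring_scope.

(* The modulus on R[i] takes its values in R[i]; normc is the R-valued one. *)
Notation normc := Normc.normc.

Section Frames.
Variables (R : realType) (V : Type) (ip : V -> V -> R[i]) (H : set V).

(* H is a Hilbert space sitting in the carrier V, with inner product ip; ip is
   only meaningful on H. *)
Definition sqnorm (h : V) : R := complex.Re (ip h h).

Definition is_frame (I : choiceType) (D : set I) (x : I -> V) : Prop :=
  (forall i, D i -> H (x i)) /\
  exists A B : R, [/\ 0 < A, 0 < B &
    forall h, H h ->
      ((A * sqnorm h)%:E <= \esum_(i in D) ((normc (ip h (x i))) ^+ 2)%:E)%E /\
      (\esum_(i in D) ((normc (ip h (x i))) ^+ 2)%:E <= (B * sqnorm h)%:E)%E].

(* Every countable index set is equipotent to a subset J of nat; counting J is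
   its cardinality, +oo when J is infinite. The cardinalities lie in
   nat U {+oo}, so the infimum is a minimum (and +oo if there is no frame of
   orbits at all). *)
Definition frame_number (T : V -> V) : \bar R :=
  ereal_inf [set @counting nat R J | J in
    [set J : set nat | exists g : nat -> V,
       (forall j, J j -> H (g j)) /\
       is_frame ([set: nat] `*` J) (fun p => iter p.1 T (g p.2))]].

End Frames.

Section Disk.
Variable R : realType.

Definition disk : Type := {z : R[i] | normc z < 1}.

(* An element of (H^2)^m is a column over the ring disk -> R[i] (pointwise
   operations), so that Theta *m f is the pointwise product z |-> Theta(z) f(z).
   Functions live on the subtype disk, hence are equal iff they agree there. *)

Definition power_series_on_disk (f : disk -> R[i]) (a : nat -> R[i]) : Prop :=
  forall z : disk,
    (series (fun n => a n * (val z) ^+ n) : nat -> R[i]^o) @ \oo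
      --> (f z : R[i]^o).

Definition square_summable (a : nat -> R[i]) : Prop :=
  cvgn (series (fun n => (normc (a n)) ^+ 2 : R)).

Definition H2 : set (disk -> R[i]) :=
  [set f | exists a, power_series_on_disk f a /\ square_summable a].

(* Analytic on the disk means: sum of a power series there. *)
Definition Hinf : set (disk -> R[i]) :=
  [set f | (exists a, power_series_on_disk f a) /\
           (exists M : R, forall z, normc (f z) <= M)].

Definition supnorm (f : disk -> R[i]) : R :=
  sup [set normc (f z) | z in [set: disk]].

Definition taylor_coef (f : disk -> R[i]) : nat -> R[i] :=
  xget (fun=> 0) [set a | power_series_on_disk f a].

Definition ip_H2 (f g : disk -> R[i]) : R[i] :=
  limn (series (fun n => taylor_coef f n * (taylor_coef g n)^*)
          : nat -> R[i]^o).

Definition H2vec (m : nat) : set 'cV[disk -> R[i]]_m :=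
  [set f | forall i, H2 (f i ord0)].

Definition ip_H2vec (m : nat) (f g : 'cV[disk -> R[i]]_m) : R[i] :=
  \sum_(i < m) ip_H2 (f i ord0) (g i ord0).

Definition Hinf_mx (m : nat) (Theta : 'M[disk -> R[i]]_m) : Prop :=
  forall i j, Hinf (Theta i j).

(* The non-tangential limit at zeta is the limit in every Stolz region
   |z - zeta| < alpha (1 - |z|). *)
Definition nt_lim (f : disk -> R[i]) (zeta w : R[i]) : Prop :=
  forall alpha e : R, 0 < e -> exists2 d : R, 0 < d &
    forall z : disk, normc (val z - zeta) < alpha * (1 - normc (val z)) ->
      normc (val z - zeta) < d -> normc (f z - w) < e.

Definition dotc (m : nat) (u v : 'cV[R[i]]_m) : R[i] :=
  \sum_(i < m) u i ord0 * (v i ord0)^*.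

Definition initial_space (m : nat) (A : 'M[R[i]]_m) : set 'cV[R[i]]_m :=
  [set v | forall u, A *m u = 0 -> dotc v u = 0].

Definition partial_isometry (m : nat) (A : 'M[R[i]]_m) : Prop :=
  forall v, initial_space A v -> dotc (A *m v) (A *m v) = dotc v v.

Definition expi (t : R) : R[i] := (cos t +i* sin t)%C.

Definition rigid (m : nat) (Theta : 'M[disk -> R[i]]_m) : Prop :=
  Hinf_mx Theta /\
  exists E : set 'cV[R[i]]_m,
    {ae (@lebesgue_measure R), forall t : R, t \in `[0, 2 * pi] ->
      exists A : 'M[R[i]]_m,
        [/\ forall i j, nt_lim (Theta i j) (expi t) (A i j),
            partial_isometry A & initial_space A = E]}.

Definition K_space (m : nat) (Theta : 'M[disk -> R[i]]_m) :
    set 'cV[disk -> R[i]]_m :=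
  [set f | H2vec f /\ forall g, H2vec g -> ip_H2vec f (Theta *m g) = 0].

(* P f is the element of K such that f - P f is orthogonal to K. *)
Definition orth_proj (m : nat) (K : set 'cV[disk -> R[i]]_m)
    (f : 'cV[disk -> R[i]]_m) : 'cV[disk -> R[i]]_m :=
  xget 0 [set g | K g /\ forall h, K h -> ip_H2vec (f - g) h = 0].

Definition mulz (m : nat) (f : 'cV[disk -> R[i]]_m) : 'cV[disk -> R[i]]_m :=
  (fun z : disk => val z) *: f.

Definition S_op (m : nat) (Theta : 'M[disk -> R[i]]_m)
    (f : 'cV[disk -> R[i]]_m) : 'cV[disk -> R[i]]_m :=
  orth_proj (K_space Theta) (mulz f).

(* A functional on Hinf is represented by a map on all functions, of which only
   the values on Hinf matter. *)
Definition max_ideal_space : set ((disk -> R[i]) -> R[i]) :=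
  [set x |
    [/\ forall f g, Hinf f -> Hinf g -> x (f + g) = x f + x g,
        forall (c : R[i]) f, Hinf f -> x (cst c * f) = c * x f,
        forall f g, Hinf f -> Hinf g -> x (f * g) = x f * x g,
        exists2 f, Hinf f & x f != 0 &
        forall f, Hinf f -> forall e : R, 0 < e -> exists2 d : R, 0 < d &
          forall g, Hinf g -> supnorm (g - f) < d -> normc (x g - x f) < e]].

(* kermx is the kernel for the action on row vectors, hence the transpose. *)
Definition dim_ker (m : nat) (A : 'M[R[i]]_m) : nat := \rank (kermx A^T).

End Disk.

(* Main.v *)
Require Import Defs.
From mathcomp Require Import all_boot all_order all_algebra.
From mathcomp Require Import all_classical all_reals all_analysis.
From mathcomp Require Import measurable_realfun.
From mathcomp Require Import ring lra zify.
Set Implicit Arguments.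
Unset Strict Implicit.
Unset Printing Implicit Defensive.
Import Order.TTheory GRing.Theory Num.Theory.
Import numFieldNormedType.Exports.
Local Open Scope classical_set_scope.
Local Open Scope ring_scope.

(** Idea.  Let [k] orbits of [S_Theta] form a frame of [K_Theta].  Then
    [h |-> (<S*^l h, g_j>)_(l,j)] is a bounded operator [D] from [K_Theta] to
    [(H^2)^k], bounded below and commuting with the backward shift [S*], so by
    commutant lifting it is the restriction of an adjoint Toeplitz operator
    [T_Phi^*] with [Phi] bounded.  Rigidity makes [T_Theta] a partial isometry
    with [K_Theta = Ker T_Theta^*], so [T_Phi^*] and [T_Theta^*] are jointly
    bounded below on the polynomials.  The inverse of the pair commutes with
    [S*], and a second lifting yields bounded [A], [B] with
    [Phi A + Theta B = 1].  Applying a character [x] gives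
    [m <= k + rank (Theta x)].

    Commutant lifting is proved for graphs: if [G] is an [S*]-invariant linear
    set of pairs [(h, y)] with [|y|^2 <= c |h|^2], a vector [v] with [S* v] in
    the domain can be added to the domain.  Only the coefficient of index [0]
    of its image is free; it must be dominated by the positive form
    [c |h|^2 - |S* y|^2], and such an extension exists by projecting [v]
    onto the domain for this form.  Zorn's lemma then puts all polynomials
    in the domain. *)

(** * Complex numbers and series *)

(** The joint lower bound is where graphs pay off. For a polynomial [p], the vector
    [a = p - T_Theta T_Theta^* p] lies in [K_Theta] but is in general not a polynomial, so the
    finite formula for [T_Phi^*] does not apply to it. Still, [(a, D a)] and [(p, T_Phi^* p)] belong
    to one graph, and the bound of that graph on their difference controls [D a] by [T_Phi^* p] and
    [T_Theta^* p]; the lower frame bound then controls [a], hence [p].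

    Operators are handled through Taylor coefficients. A lifted symbol is bounded by testing on
    truncations of [sum_N z^N e_i], whose coefficients form an eigenvector of [S*]. Boundary values
    enter only to show that [Theta] acts on polynomials isometrically after a constant projection
    [Q], the one onto the common initial space; polarization and density then give the partial
    isometry.

    The matrices produced by lifting are the coefficients of adjoints. Conjugating the coefficient
    identity reverses the products, which is how [Phi] and [Theta] end up on the left of the final
    equation, where a rank can be read off. *)

Section ComplexNumbers.
Variable R : realType.
Local Notation C := R[i].
Implicit Types (z w : C).

Lemma normr_normc z : `|z| = (normc z)%:C%C.
Proof. by []. Qed.

Lemma cReM z w : complex.Re (z * w) =
  complex.Re z * complex.Re w - complex.Im z * complex.Im w.
Proof. by case: z; case: w. Qed.

Lemma cImM z w : complex.Im (z * w) =
  complex.Re z * complex.Im w + complex.Im z * complex.Re w.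
Proof. by case: z => a b; case: w => c d /=; rewrite addrC. Qed.

Lemma cReD z w : complex.Re (z + w) = complex.Re z + complex.Re w.
Proof. by case: z; case: w. Qed.

Lemma cImD z w : complex.Im (z + w) = complex.Im z + complex.Im w.
Proof. by case: z; case: w. Qed.

Lemma cReN z : complex.Re (- z) = - complex.Re z.
Proof. by case: z. Qed.

Lemma cImN z : complex.Im (- z) = - complex.Im z.
Proof. by case: z. Qed.

Lemma cReJ z : complex.Re z^* = complex.Re z.
Proof. by case: z. Qed.

Lemma cImJ z : complex.Im z^* = - complex.Im z.
Proof. by case: z. Qed.

Definition ReImE := (cReM, cImM, cReD, cImD, cReN, cImN, cReJ, cImJ).

Lemma complex_eqP z w :
  complex.Re z = complex.Re w -> complex.Im z = complex.Im w -> z = w.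
Proof. by case: z w => a b [c d] /= -> ->. Qed.

Lemma cjD z w : (z + w)^* = z^* + w^*.
Proof. by apply: complex_eqP; rewrite !ReImE //; ring. Qed.

Lemma cjM z w : (z * w)^* = z^* * w^*.
Proof. by apply: complex_eqP; rewrite !ReImE; ring. Qed.

Lemma cjN z : (- z)^* = - z^*.
Proof. by apply: complex_eqP; rewrite !ReImE. Qed.

Lemma cjK z : z^*^* = z.
Proof. by apply: complex_eqP; rewrite !ReImE ?opprK. Qed.

Lemma cj_real (x : R) : (x%:C%C)^* = x%:C%C.
Proof. by apply: complex_eqP; rewrite !ReImE //= oppr0. Qed.

Lemma cj0 : (0 : C)^* = 0.
Proof. exact: cj_real. Qed.

Lemma cj1 : (1 : C)^* = 1.
Proof. exact: cj_real. Qed.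

Lemma cj_sum (I : Type) (r : seq I) (P : pred I) (F : I -> C) :
  (\sum_(i <- r | P i) F i)^* = \sum_(i <- r | P i) (F i)^*.
Proof. by elim/big_ind2: _ => [|a b c d <- <-|//]; rewrite ?cj0 ?cjD. Qed.

Lemma cnorm_ge0 z : 0 <= normc z.
Proof. by case: z => a b; rewrite sqrtr_ge0. Qed.

Lemma sqr_normcE z : normc z ^+ 2 = complex.Re z ^+ 2 + complex.Im z ^+ 2.
Proof. by case: z => a b /=; rewrite sqr_sqrtr // addr_ge0 ?sqr_ge0. Qed.

Lemma mulcJ z : z * z^* = (normc z ^+ 2)%:C%C.
Proof.
by rewrite sqr_normcE; apply: complex_eqP; rewrite !ReImE /=; ring.
Qed.

Lemma Re_le_normc z : `|complex.Re z| <= normc z.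
Proof.
by rewrite -(ler_pXn2r (n := 2)) ?nnegrE ?cnorm_ge0 // sqr_normcE real_normK
  ?num_real // lerDl sqr_ge0.
Qed.

Lemma Im_le_normc z : `|complex.Im z| <= normc z.
Proof.
by rewrite -(ler_pXn2r (n := 2)) ?nnegrE ?cnorm_ge0 // sqr_normcE real_normK
  ?num_real // lerDr sqr_ge0.
Qed.

Lemma normc_le_ReIm z : normc z <= `|complex.Re z| + `|complex.Im z|.
Proof.
rewrite -(ler_pXn2r (n := 2)) ?nnegrE ?cnorm_ge0 ?addr_ge0 // sqr_normcE.
rewrite -(real_normK (x := complex.Re z)) ?num_real //.
rewrite -(real_normK (x := complex.Im z)) ?num_real //.
have := normr_ge0 (complex.Re z); have := normr_ge0 (complex.Im z); nra.
Qed.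

Lemma normcJ z : normc z^* = normc z.
Proof. by case: z => a b /=; rewrite sqrrN. Qed.

Lemma normc_real (x : R) : normc x%:C%C = `|x|.
Proof. by rewrite /= expr0n /= addr0 sqrtr_sqr. Qed.

Lemma normcX z n : normc (z ^+ n) = normc z ^+ n.
Proof.
elim: n => [|n IH]; first by rewrite !expr0 Normc.normc1.
by rewrite !exprS Normc.normcM IH.
Qed.

Lemma normcB z w : normc (z - w) = normc (w - z).
Proof. by rewrite -normcN opprB. Qed.

Lemma normc_eq0 z : (normc z == 0) = (z == 0).
Proof.
by apply/eqP/eqP => [/Normc.eq0_normc //|->]; rewrite Normc.normc0.
Qed.

Lemma le_normc_sum (I : Type) (r : seq I) (P : pred I) (F : I -> C) :
  normc (\sum_(i <- r | P i) F i) <= \sum_(i <- r | P i) normc (F i).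
Proof.
elim/big_ind2: _ => //; first by rewrite Normc.normc0.
move=> a b c d ab cd; apply: le_trans (le_normcD _ _) _; exact: lerD.
Qed.

Lemma cRe_sum (I : Type) (r : seq I) (P : pred I) (F : I -> C) :
  complex.Re (\sum_(i <- r | P i) F i) = \sum_(i <- r | P i) complex.Re (F i).
Proof. by elim/big_ind2: _ => // a b c d <- <-; rewrite cReD. Qed.

Lemma cIm_sum (I : Type) (r : seq I) (P : pred I) (F : I -> C) :
  complex.Im (\sum_(i <- r | P i) F i) = \sum_(i <- r | P i) complex.Im (F i).
Proof. by elim/big_ind2: _ => // a b c d <- <-; rewrite cImD. Qed.

Lemma Re_series (a : nat -> C) n :
  complex.Re (series a n) = series (@complex.Re R \o a) n.
Proof. exact: cRe_sum. Qed.

Lemma Im_series (a : nat -> C) n :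
  complex.Im (series a n) = series (@complex.Im R \o a) n.
Proof. exact: cIm_sum. Qed.

Lemma cvgC_normcP (u : nat -> C) (l : C) :
  (u : nat -> C^o) @ \oo --> (l : C^o) <->
  forall e : R, 0 < e -> \forall n \near \oo, normc (l - u n) < e.
Proof.
split=> [/cvgrPdist_lt h e e0|h]; last first.
  apply/cvgrPdist_lt => e e0.
  have [er ee] : exists er : R, e = er%:C%C.
    by apply/complex_realP; exact: gtr0_real.
  move: e0; rewrite ee ltcR => e0; near=> n.
  rewrite normr_normc ltcR; near: n; exact: h.
have e0' : 0 < e%:C%C :> C by rewrite ltcR.
by near=> n; rewrite -ltcR -normr_normc; near: n; exact: (h _ e0').
Unshelve. all: by end_near. Qed.

Lemma cvgC_seqP (u : nat -> C) (l : C) :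
  (u : nat -> C^o) @ \oo --> (l : C^o) <->
  forall e : R, 0 < e -> exists N, forall n, (N <= n)%N -> normc (l - u n) < e.
Proof.
rewrite cvgC_normcP; split=> h e e0.
  by have [N _ hN] := h e e0; exists N.
by have [N hN] := h e e0; exists N.
Qed.

Lemma cvgR_seqP (u : nat -> R) (l : R) : u @ \oo --> l <->
  forall e : R, 0 < e -> exists N, forall n, (N <= n)%N -> `|l - u n| < e.
Proof.
split=> [/cvgrPdist_lt|] h; last apply/cvgrPdist_lt => e e0.
  by move=> e e0; have [N _ hN] := h e e0; exists N.
by have [N hN] := h e e0; exists N.
Qed.

Lemma cvgC_ReIm (u : nat -> C) (l : C) :
  (u : nat -> C^o) @ \oo --> (l : C^o) <->
  (@complex.Re R \o u @ \oo --> complex.Re l) /\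
  (@complex.Im R \o u @ \oo --> complex.Im l).
Proof.
rewrite cvgC_normcP; split=> [h|[/cvgrPdist_lt h1 /cvgrPdist_lt h2] e e0].
  split; apply/cvgrPdist_lt => e e0; near=> n => /=.
    rewrite -cReN -cReD; apply: le_lt_trans (Re_le_normc _) _.
    by near: n; apply: h.
  rewrite -cImN -cImD; apply: le_lt_trans (Im_le_normc _) _.
  by near: n; apply: h.
have e2 : 0 < e / 2 by rewrite divr_gt0.
near=> n; apply: le_lt_trans (normc_le_ReIm _) _.
rewrite [e]splitr !ReImE; apply: ltrD; near: n; [exact: h1|exact: h2].
Unshelve. all: by end_near. Qed.

Lemma cvgC_unique (u : nat -> C) (l l' : C) :
  (u : nat -> C^o) @ \oo --> (l : C^o) ->
  (u : nat -> C^o) @ \oo --> (l' : C^o) -> l = l'.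
Proof.
move=> /cvgC_ReIm[h1 h2] /cvgC_ReIm[h3 h4].
by apply: complex_eqP; [apply: cvg_unique h1 h3|apply: cvg_unique h2 h4].
Qed.

Lemma limC_eq (u : nat -> C) (l : C) :
  (u : nat -> C^o) @ \oo --> (l : C^o) -> limn (u : nat -> C^o) = l.
Proof. by move/cvg_lim; apply. Qed.

End ComplexNumbers.

Section RealSeries.
Variable R : realType.
Implicit Types (a b : nat -> R).

Definition rsum a : R := limn (series a).

Lemma rsum_cvg a : cvgn (series a) -> series a @ \oo --> rsum a.
Proof. by []. Qed.

Lemma summable_ub a (M : R) : (forall n, 0 <= a n) ->
  (forall n, series a n <= M) -> cvgn (series a).
Proof.
move=> a0 aM; apply: nondecreasing_is_cvgn.
  by apply: nondecreasing_series => n _ _; exact: a0.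
by exists M => _ [n _ <-]; exact: aM.
Qed.

Lemma rsum_le_ub a (M : R) : cvgn (series a) ->
  (forall n, series a n <= M) -> rsum a <= M.
Proof. by move=> ca aM; apply: limr_le => //; near=> n; exact: aM.
Unshelve. all: by end_near. Qed.

Lemma series_le_rsum a n : (forall n, 0 <= a n) -> cvgn (series a) ->
  series a n <= rsum a.
Proof.
move=> a0 ca; apply: nondecreasing_cvgn_le => //.
by apply: nondecreasing_series => k _ _; exact: a0.
Qed.

Lemma rsum_ge0 a : (forall n, 0 <= a n) -> cvgn (series a) -> 0 <= rsum a.
Proof.
by move=> a0 ca; apply: le_trans (series_le_rsum 0 a0 ca); rewrite /series /= big_geq.
Qed.

Lemma term_le_rsum a n : (forall n, 0 <= a n) -> cvgn (series a) ->
  a n <= rsum a.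
Proof.
move=> a0 ca; apply: le_trans (series_le_rsum n.+1 a0 ca).
by rewrite seriesSr lerDr /series /= sumr_ge0.
Qed.

Lemma rsum_le a b : (forall n, a n <= b n) -> cvgn (series a) ->
  cvgn (series b) -> rsum a <= rsum b.
Proof. by move=> ab ca cb; exact: lim_series_le. Qed.

Lemma series_shift a n : series (a \o succn) n = series a n.+1 - a 0%N.
Proof.
by rewrite /series /= [in RHS]big_nat_recl //= addrC addKr.
Qed.

Lemma cvg_series_shift a (l : R) : series a @ \oo --> l ->
  series (a \o succn) @ \oo --> l - a 0%N.
Proof.
move=> ca; rewrite (_ : series _ = fun n => series a n.+1 - a 0%N); last first.
  by apply/funext => n; exact: series_shift.
by apply: cvgB; [rewrite cvg_shiftS|exact: cvg_cst].
Qed.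

Lemma cvg_series_unshift a (l : R) : series (a \o succn) @ \oo --> l ->
  series a @ \oo --> l + a 0%N.
Proof.
move=> ca; rewrite -cvg_shiftS.
rewrite (_ : (fun n => _) = fun n => series (a \o succn) n + a 0%N).
  by apply: cvgD => //; exact: cvg_cst.
by apply/funext => n; rewrite series_shift subrK.
Qed.

End RealSeries.

Section ComplexSeries.
Variable R : realType.
Local Notation C := R[i].
Implicit Types (a b : nat -> C).

Definition asum a := cvgn (series (fun n => normc (a n))).

Definition cser a (s : C) := (series a : nat -> C^o) @ \oo --> (s : C^o).

Definition csum a : C := limn (series a : nat -> C^o).

Lemma cser_ReIm a s : cser a s <->
  (series (@complex.Re R \o a) @ \oo --> complex.Re s) /\
  (series (@complex.Im R \o a) @ \oo --> complex.Im s).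
Proof.
rewrite /cser cvgC_ReIm.
have -> : @complex.Re R \o series a = series (@complex.Re R \o a).
  by apply/funext => n /=; exact: Re_series.
have -> // : @complex.Im R \o series a = series (@complex.Im R \o a).
by apply/funext => n /=; exact: Im_series.
Qed.

Lemma cser_csum a s : cser a s -> csum a = s.
Proof. exact: limC_eq. Qed.

Lemma cser_unique a s t : cser a s -> cser a t -> s = t.
Proof. exact: cvgC_unique. Qed.

Lemma asum_cser a : asum a -> cser a (csum a).
Proof.
move=> ha.
have hr : cvgn (series (@complex.Re R \o a)).
  apply: normed_cvg; apply: series_le_cvg ha => n //=; first exact: cnorm_ge0.
  exact: Re_le_normc.
have hi : cvgn (series (@complex.Im R \o a)).
  apply: normed_cvg; apply: series_le_cvg ha => n //=; first exact: cnorm_ge0.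
  exact: Im_le_normc.
have h : cser a (rsum (@complex.Re R \o a) +i* rsum (@complex.Im R \o a))%C.
  by apply/cser_ReIm; split.
by rewrite (cser_csum h).
Qed.

Lemma cser_ext a b s : a =1 b -> cser a s -> cser b s.
Proof. by move=> /funext ->. Qed.

Lemma cserD a b s t : cser a s -> cser b t -> cser (a + b) (s + t).
Proof.
move=> /cser_ReIm[h1 h2] /cser_ReIm[h3 h4]; apply/cser_ReIm; split.
  rewrite cReD (_ : _ \o _ = (@complex.Re R \o a) + (@complex.Re R \o b)); last first.
    by apply/funext => n; exact: cReD.
  by rewrite seriesD; exact: cvgD.
rewrite cImD (_ : _ \o _ = (@complex.Im R \o a) + (@complex.Im R \o b)); last first.
  by apply/funext => n; exact: cImD.
by rewrite seriesD; exact: cvgD.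
Qed.

Lemma cserZ a s (c : C) : cser a s -> cser (fun n => c * a n) (c * s).
Proof.
move=> /cser_ReIm[h1 h2]; apply/cser_ReIm; split.
  rewrite cReM (_ : _ \o _ = (complex.Re c *: (@complex.Re R \o a)) -
    (complex.Im c *: (@complex.Im R \o a))); last first.
    by apply/funext => n /=; rewrite cReM.
  by rewrite seriesD seriesN !seriesZ; apply: cvgB; exact: cvgZr.
rewrite cImM (_ : _ \o _ = (complex.Re c *: (@complex.Im R \o a)) +
  (complex.Im c *: (@complex.Re R \o a))); last first.
  by apply/funext => n /=; rewrite cImM.
by rewrite seriesD !seriesZ; apply: cvgD; exact: cvgZr.
Qed.

Lemma cserJ a s : cser a s -> cser (fun n => (a n)^*) s^*.
Proof.
move=> /cser_ReIm[h1 h2]; apply/cser_ReIm; split.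
  rewrite cReJ (_ : _ \o _ = @complex.Re R \o a) //.
  by apply/funext => n /=; rewrite cReJ.
rewrite cImJ (_ : _ \o _ = - (@complex.Im R \o a)); last first.
  by apply/funext => n /=; rewrite cImJ.
by rewrite seriesN; exact: cvgN.
Qed.

Lemma cser0 : cser (fun=> 0) 0.
Proof.
rewrite /cser (_ : series _ = fun=> 0); first exact: cvg_cst.
by apply/funext => n; rewrite /series /= big1.
Qed.

Lemma cser_sum (I : Type) (r : seq I) (P : pred I) (F : I -> nat -> C)
    (s : I -> C) : (forall i, P i -> cser (F i) (s i)) ->
  cser (fun n => \sum_(i <- r | P i) F i n) (\sum_(i <- r | P i) s i).
Proof.
move=> h; elim: r => [|i r IH].
  rewrite big_nil; apply: cser_ext cser0 => n; by rewrite big_nil.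
rewrite big_cons; case: ifP => Pi; last first.
  by apply: cser_ext IH => n; rewrite big_cons Pi.
by apply: cser_ext (cserD (h _ Pi) IH) => n /=; rewrite big_cons Pi.
Qed.

Lemma cser_shift a s : cser a s -> cser (a \o succn) (s - a 0%N).
Proof.
move=> /cser_ReIm[h1 h2]; apply/cser_ReIm; rewrite !ReImE; split.
  exact: (cvg_series_shift h1).
exact: (cvg_series_shift h2).
Qed.

Lemma cser_unshift a s : cser (a \o succn) s -> cser a (s + a 0%N).
Proof.
move=> /cser_ReIm[h1 h2]; apply/cser_ReIm; rewrite !ReImE; split.
  exact: (cvg_series_unshift h1).
exact: (cvg_series_unshift h2).
Qed.

Lemma cser_fin a N : (forall n, (N <= n)%N -> a n = 0) ->
  cser a (\sum_(n < N) a n).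
Proof.
move=> aN; apply/cvgC_normcP => e e0; near=> n.
have Nn : (N <= n)%N by near: n; exists N.
rewrite /series /= (@big_cat_nat _ _ _ N) //= big_mkord opprD addNKr.
rewrite big_nat big1 ?oppr0 ?Normc.normc0 //.
by move=> i /andP[Ni _]; exact: aN.
Unshelve. all: by end_near. Qed.

Lemma normc_csum_le a : asum a -> normc (csum a) <= rsum (fun n => normc (a n)).
Proof.
move=> ha; apply/ler_addgt0Pr => e e0.
have /cvgC_normcP/(_ _ e0) [N _ /(_ N (leqnn N))] := asum_cser ha.
move=> h; rewrite -[csum a](subrK (series a N)) addrC.
apply: le_trans (le_normcD _ _) _; apply: lerD (ltW h).
apply: le_trans (le_normc_sum _ _ _) _.
by apply: series_le_rsum => // n; exact: cnorm_ge0.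
Qed.

Lemma asum_le a (b : nat -> R) : (forall n, normc (a n) <= b n) ->
  cvgn (series b) -> asum a.
Proof.
move=> ab; apply: series_le_cvg => // n; first exact: cnorm_ge0.
exact: le_trans (cnorm_ge0 _) (ab n).
Qed.

End ComplexSeries.

Arguments cserZ {R a s} c _.

(** * Power series on the disk *)

Section CauchyProduct.
Variable R : realType.
Local Notation C := R[i].
Implicit Types (a b : nat -> C).

Definition cauchy_prod a b : nat -> C :=
  fun n => \sum_(i < n.+1) a i * b (n - i)%N.

(** Grouping by the index of [a] leaves a partial sum of [b] of complementary length, the form in
    which convergence of [b] can be used. *)
Lemma series_conv a b N :
  series (cauchy_prod a b) N = \sum_(i < N) a i * series b (N - i)%N.
Proof.
elim: N => [|N IH]; first by rewrite /series /= big_geq // big_ord0.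
have b1 : series b 1 = b 0%N by rewrite /series /= big_nat1.
rewrite seriesSr IH big_ord_recr /= subSn // subnn b1 /cauchy_prod big_ord_recr /= subnn addrA.
congr (_ + _); rewrite -big_split /=; apply: eq_bigr => i _.
by rewrite subSn ?(ltnW (ltn_ord i)) // seriesSr mulrDr.
Qed.

(** The sum is split at an index [K2] past which [u] has a small tail. Below [K2] the argument
    [N - i] exceeds [K1], so [v] is small there; above it, [v] is at most [M] against that tail. *)
Lemma tail_weighted_cvg0 (u v : nat -> R) (M : R) :
  (forall n, 0 <= u n) -> cvgn (series u) -> (forall n, 0 <= v n <= M) ->
  v @ \oo --> 0 ->
  (fun N => \sum_(i < N) u i * v (N - i)%N) @ \oo --> 0.
Proof.
move=> u0 cu vM v0; apply/cvgR_seqP => e e0.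
have U0 : 0 <= rsum u by exact: rsum_ge0.
have M0 : 0 <= M by have /andP[h1 h2] := vM 0%N; exact: le_trans h1 h2.
(* Adding 1 keeps the denominators positive even if [rsum u] or [M] vanishes. *)
have e1 : 0 < e / (2 * (rsum u + 1)) by rewrite divr_gt0 // mulr_gt0 // ltr_wpDl.
have e2 : 0 < e / (2 * (M + 1)) by rewrite divr_gt0 // mulr_gt0 // ltr_wpDl.
have /cvgR_seqP/(_ _ e1)[K1 hK1] := v0.
have /cvgR_seqP/(_ _ e2)[K2 /(_ K2 (leqnn _)) hK2] := rsum_cvg cu.
exists (K1 + K2)%N => N NK.
rewrite sub0r normrN ger0_norm; last first.
  by apply: sumr_ge0 => i _; rewrite mulr_ge0 //; case/andP: (vM (N - i)%N).
rewrite -(big_mkord xpredT (fun i => u i * v (N - i)%N)).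
have K2N : (K2 <= N)%N by rewrite (leq_trans _ NK) // leq_addl.
rewrite (@big_cat_nat _ _ _ K2) //=.
have h1 : \sum_(0 <= i < K2) u i * v (N - i)%N <=
    rsum u * (e / (2 * (rsum u + 1))).
  apply: (@le_trans _ _ (\sum_(0 <= i < K2) u i * (e / (2 * (rsum u + 1))))).
    rewrite big_nat [leRHS]big_nat; apply: ler_sum => i /andP[_ iK2].
    apply: ler_wpM2l => //; apply: ltW.
    have := hK1 (N - i)%N; rewrite sub0r normrN ger0_norm.
      by apply; rewrite /=; lia.
    by case/andP: (vM (N - i)%N).
  rewrite -mulr_suml ler_wpM2r ?(ltW e1) //.
  by apply: series_le_rsum.
have h2 : \sum_(K2 <= i < N) u i * v (N - i)%N <= (e / (2 * (M + 1))) * M.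
  apply: (@le_trans _ _ (\sum_(K2 <= i < N) u i * M)).
    apply: ler_sum => i _; apply: ler_wpM2l => //.
    by case/andP: (vM (N - i)%N).
  rewrite -mulr_suml ler_wpM2r //.
  have := series_le_rsum N u0 cu; rewrite {1}/series /= (@big_cat_nat _ _ _ K2) //=.
  rewrite addrC -lerBrDr => /le_trans; apply; apply: ltW.
  apply: le_lt_trans hK2; exact: ler_norm.
apply: le_lt_trans (lerD h1 h2) _.
have -> : e = e / 2 + e / 2 by rewrite -splitr.
apply: ltrD.
  rewrite invfM !mulrA ltr_pdivrMr ?ltr_wpDl //; nra.
rewrite mulrC invfM !mulrA ltr_pdivrMr ?ltr_wpDl //; nra.
Qed.

(** Mertens' argument: the error is the tail of [a] times [csum b], plus the tails of [b] weighted
    by [a], to which [tail_weighted_cvg0] applies. *)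
Lemma cser_conv a b : asum a -> asum b ->
  cser (cauchy_prod a b) (csum a * csum b).
Proof.
move=> ha hb.
have ca := asum_cser ha; have cb := asum_cser hb.
pose v n := normc (csum b - series b n).
have v0 : v @ \oo --> 0.
  apply/cvgR_seqP => e e0.
  move/cvgC_seqP: cb => /(_ e e0) [K hK]; exists K => n /hK h.
  by rewrite sub0r normrN ger0_norm // cnorm_ge0.
have [M hM] : exists M, forall n, 0 <= v n <= M.
  exists (normc (csum b) + rsum (fun n => normc (b n))) => n.
  rewrite cnorm_ge0 /=; apply: le_trans (le_normcD _ _) _.
  rewrite lerD2l normcN; apply: le_trans (le_normc_sum _ _ _) _.
  by apply: (series_le_rsum n _ hb) => k; exact: cnorm_ge0.
have := tail_weighted_cvg0 (fun n => cnorm_ge0 (a n)) ha hM v0.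
move=> /cvgR_seqP h; apply/cvgC_seqP => e e0.
have B0 : 0 < normc (csum b) + 1 by rewrite ltr_wpDl ?cnorm_ge0.
have e2 : 0 < e / 2 by rewrite divr_gt0.
have e3 : 0 < e / 2 / (normc (csum b) + 1) by rewrite divr_gt0.
have [K1 h1] := h _ e2.
have /cvgC_seqP/(_ _ e3)[K2 h2] := ca.
exists (K1 + K2)%N => N NK.
have N1 : (K1 <= N)%N by lia.
have N2 : (K2 <= N)%N by lia.
rewrite series_conv.
have -> : csum a * csum b - \sum_(i < N) a i * series b (N - i)%N =
   (csum a - series a N) * csum b + \sum_(i < N) a i * (csum b - series b (N - i)%N).
  under [in RHS]eq_bigr do rewrite mulrBr.
  by rewrite sumrB /= -mulr_suml mulrBl /series /= big_mkord; ring.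
apply: le_lt_trans (le_normcD _ _) _; rewrite [e]splitr; apply: ltr_leD.
  rewrite Normc.normcM.
  apply: (@le_lt_trans _ _ (normc (csum a - series a N) * (normc (csum b) + 1))).
    by rewrite ler_wpM2l ?cnorm_ge0 // lerDl.
  by rewrite -ltr_pdivlMr //; exact: h2.
apply: le_trans (le_normc_sum _ _ _) _; apply: ltW.
have := h1 N N1; rewrite sub0r normrN ger0_norm; last first.
  by apply: sumr_ge0 => i _; rewrite mulr_ge0 // cnorm_ge0.
by under eq_bigr do rewrite -Normc.normcM.
Qed.

End CauchyProduct.

Section PowerSeries.
Variable R : realType.
Local Notation C := R[i].
Implicit Types (a b : nat -> C) (f g : disk R -> C).

Definition DiskPoint (z : C) (z1 : normc z < 1) : disk R :=
  exist (fun z => normc z < 1) z z1.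

Lemma disk_lt1 (z : disk R) : normc (val z) < 1.
Proof. by case: z. Qed.

Definition radius_ge1 a := forall r : R, 0 <= r < 1 ->
  cvgn (series (fun n => normc (a n) * r ^+ n)).

Lemma cser_term_bounded a s : cser a s -> exists M, forall n, normc (a n) <= M.
Proof.
move=> /cser_ReIm[h1 h2].
have b1 : exists M : R, forall n, `|complex.Re (a n)| <= M.
  have /cvg_series_cvg_0 h : cvgn (series (@complex.Re R \o a)) by apply/cvg_ex; eexists; exact: h1.
  have /cvg_has_ub[M hM] : cvgn (@complex.Re R \o a) by apply/cvg_ex; eexists; exact: h.
  by exists M => n; apply: hM; exists n.
have b2 : exists M : R, forall n, `|complex.Im (a n)| <= M.
  have /cvg_series_cvg_0 h : cvgn (series (@complex.Im R \o a)) by apply/cvg_ex; eexists; exact: h2.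
  have /cvg_has_ub[M hM] : cvgn (@complex.Im R \o a) by apply/cvg_ex; eexists; exact: h.
  by exists M => n; apply: hM; exists n.
have [[M1 h3] [M2 h4]] := (b1, b2).
by exists (M1 + M2) => n; apply: le_trans (normc_le_ReIm _) _; exact: lerD.
Qed.

(** Abel's lemma: boundedness of the terms at some [s] strictly between [r] and 1 dominates the
    series at [r] by a geometric one of ratio [r / s]. *)
Lemma radius_ge1_bounded a :
  (forall r : R, 0 <= r < 1 -> exists M, forall n, normc (a n) * r ^+ n <= M) ->
  radius_ge1 a.
Proof.
move=> h r /andP[r0 r1].
have [s [rs s1 s0]] : exists s : R, [/\ r < s, s < 1 & 0 < s].
  by exists ((r + 1) / 2); split; lra.
have [|M hM] := h s; first by apply/andP; split; [exact: ltW|].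
apply: (@series_le_cvg _ _ (geometric M (r / s))).
- by move=> n; rewrite mulr_ge0 ?cnorm_ge0 ?exprn_ge0.
- move=> n; rewrite /geometric /= mulr_ge0 ?exprn_ge0 ?divr_ge0 ?(ltW s0) //.
  by apply: le_trans (hM 0%N); rewrite mulr_ge0 ?cnorm_ge0 ?exprn_ge0 ?(ltW s0).
- move=> n; rewrite /geometric /= expr_div_n [leRHS]mulrCA [leLHS]mulrC ler_wpM2l ?exprn_ge0 //.
  by rewrite ler_pdivlMr ?exprn_gt0.
- apply: is_cvg_geometric_series.
  rewrite ger0_norm; last by rewrite divr_ge0 // ltW.
  by rewrite ltr_pdivrMr // mul1r.
Qed.

Lemma bounded_radius_ge1 a (M : R) : (forall n, normc (a n) <= M) -> radius_ge1 a.
Proof.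
move=> aM; apply: radius_ge1_bounded => r /andP[r0 r1]; exists M => n.
apply: le_trans (aM n); rewrite ler_piMr ?cnorm_ge0 // exprn_ile1 //.
exact: ltW.
Qed.

Lemma radius_ge1_asum a z : radius_ge1 a -> normc z < 1 ->
  asum (fun n => a n * z ^+ n).
Proof.
move=> ha z1; rewrite /asum; under eq_fun do rewrite Normc.normcM normcX.
by apply: ha; rewrite cnorm_ge0.
Qed.

Lemma power_series_radius f a : power_series_on_disk f a -> radius_ge1 a.
Proof.
move=> fa; apply: radius_ge1_bounded => r /andP[r0 r1].
have zr : normc (r%:C%C) < 1 by rewrite normc_real ger0_norm.
have [M hM] := cser_term_bounded (fa (DiskPoint zr)).
exists M => n; apply: le_trans (hM n) => /=.
by rewrite Normc.normcM normcX normc_real ger0_norm.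
Qed.

Definition peval a : disk R -> C := fun z => csum (fun n => a n * val z ^+ n).

Lemma peval_power_series a : radius_ge1 a -> power_series_on_disk (peval a) a.
Proof. by move=> ha z; apply: asum_cser; apply: radius_ge1_asum => //; exact: disk_lt1. Qed.

Arguments peval_power_series {a} _ z.

Lemma power_series_peval f a : power_series_on_disk f a -> f = peval a.
Proof. by move=> fa; apply/funext => z; rewrite /peval (cser_csum (fa z)). Qed.

Lemma power_seriesD f g a b : power_series_on_disk f a ->
  power_series_on_disk g b -> power_series_on_disk (f + g) (a + b).
Proof.
move=> fa gb z; apply: cser_ext (cserD (fa z) (gb z)) => n.
by rewrite !fctE mulrDl.
Qed.

Lemma power_seriesZ f a (c : C) : power_series_on_disk f a ->
  power_series_on_disk (fun z => c * f z) (fun n => c * a n).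
Proof.
by move=> fa z; apply: cser_ext (cserZ c (fa z)) => n; rewrite mulrA.
Qed.

Lemma power_series0 : power_series_on_disk 0 (fun=> 0 : C).
Proof. by move=> z; apply: cser_ext (@cser0 R) => n; rewrite mul0r. Qed.

Lemma power_series_sum (I : Type) (r : seq I) (F : I -> disk R -> C)
    (A : I -> nat -> C) : (forall i, power_series_on_disk (F i) (A i)) ->
  power_series_on_disk (fun z => \sum_(i <- r) F i z) (fun n => \sum_(i <- r) A i n).
Proof.
move=> h z.
apply: cser_ext (cser_sum (P := xpredT) (r := r) (fun i _ => h i z)) => n /=.
by rewrite mulr_suml.
Qed.

Lemma power_series_mono (N : nat) (c : C) :
  power_series_on_disk (fun z => c * val z ^+ N) (fun n => if n == N then c else 0).
Proof.
move=> z; have := @cser_fin _ (fun n => (if n == N then c else 0) * val z ^+ n) N.+1.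
rewrite big_ord_recr /= eqxx big1 ?add0r.
  by apply=> n; case: eqP => [->|]; rewrite ?ltnn // mul0r.
by move=> i _; rewrite ltn_eqF // mul0r.
Qed.

Lemma conv_exp a b (z : C) n :
  cauchy_prod (fun n => a n * z ^+ n) (fun n => b n * z ^+ n) n = cauchy_prod a b n * z ^+ n.
Proof.
rewrite /cauchy_prod mulr_suml; apply: eq_bigr => i _.
by rewrite mulrACA -exprD subnKC // -ltnS.
Qed.

Lemma power_seriesM f g a b : power_series_on_disk f a ->
  power_series_on_disk g b -> power_series_on_disk (f * g) (cauchy_prod a b).
Proof.
move=> fa gb z.
have ha := radius_ge1_asum (power_series_radius fa) (disk_lt1 z).
have hb := radius_ge1_asum (power_series_radius gb) (disk_lt1 z).
apply: cser_ext (_ : cser _ (f z * g z)); first exact: conv_exp.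
rewrite (power_series_peval fa) (power_series_peval gb).
exact: cser_conv.
Qed.

(** The origin is excluded from the hypothesis so that the lemma still applies after division by [z]
    in [peval_eq0]. At a small real [t > 0], the constant term is minus the rest of the series,
    which is at most [t * M]. *)
Lemma coef0_eq0 a : radius_ge1 a ->
  (forall z : disk R, val z != 0 -> peval a z = 0) -> a 0%N = 0.
Proof.
move=> ha a0; apply/eqP; rewrite -normc_eq0 eq_le cnorm_ge0 andbT.
pose M := rsum (fun n => normc (a n.+1) * (2^-1) ^+ n).
have h2 : cvgn (series (fun n => normc (a n.+1) * (2^-1) ^+ n)).
  have h : cvgn (series (fun n => normc (a n) * 2^-1 ^+ n)) by apply: ha; lra.
  have /cvgP := cvg_series_shift (rsum_cvg h).
  rewrite (_ : _ \o _ = 2^-1 *: (fun n => normc (a n.+1) * 2^-1 ^+ n)); last first.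
    by apply/funext => n /=; rewrite exprS mulrCA.
  by move/(@is_cvg_seriesZ _ _ 2); rewrite scalerA mulfV // scale1r.
have M0 : 0 <= M by apply: rsum_ge0 => // n; rewrite mulr_ge0 ?cnorm_ge0 ?exprn_ge0.
apply/ler_addgt0Pr => e e0; rewrite add0r.
(* [t <= 1/2] allows comparison with the series defining [M], and [t <= e / (M + 1)] makes [t * M]
   at most [e]. *)
pose t := Num.min (2^-1) (e / (M + 1)).
have eM : 0 < e / (M + 1) by rewrite divr_gt0 // ltr_wpDl.
have t0 : 0 < t by rewrite lt_min eM andbT invr_gt0.
have t2 : t <= 2^-1 by rewrite ge_min lexx.
have tM : t <= e / (M + 1) by rewrite ge_min lexx orbT.
have t1 : normc (t%:C%C) < 1 by rewrite normc_real ger0_norm ?(ltW t0) //; lra.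
have tn0 : t%:C%C != 0 :> C by rewrite (inj_eq (@complexI _)) gt_eqF.
have := a0 (DiskPoint t1) tn0.
have /cser_shift := peval_power_series ha (DiskPoint t1) => h3 h4. 
move: h3; rewrite h4 sub0r expr0 mulr1 => h3.
have h5 : asum ((fun n => a n * t%:C%C ^+ n) \o succn).
  apply: (@asum_le _ _ (fun n => t * (normc (a n.+1) * 2^-1 ^+ n))).
    move=> n /=; rewrite Normc.normcM normcX normc_real ger0_norm ?(ltW t0) //.
    rewrite exprS mulrCA ler_wpM2l ?(ltW t0) // ler_wpM2l ?cnorm_ge0 //.
    by rewrite lerXn2r // nnegrE ?(ltW t0).
  exact: is_cvg_seriesZ.
have h6 := normc_csum_le h5.
rewrite (cser_csum h3) normcN in h6; apply: le_trans h6 _.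
apply: (@le_trans _ _ (t * M)).
  have -> : t * M = rsum (t *: (fun n => normc (a n.+1) * 2^-1 ^+ n)).
    by rewrite /rsum lim_seriesZ.
  apply: rsum_le => //; last first.
    exact: is_cvg_seriesZ.
  move=> n /=; rewrite Normc.normcM normcX normc_real ger0_norm ?(ltW t0) //.
  rewrite exprS mulrCA ler_wpM2l ?(ltW t0) // ler_wpM2l ?cnorm_ge0 //.
  by rewrite lerXn2r // nnegrE ?(ltW t0).
apply: (@le_trans _ _ (e / (M + 1) * M)); first exact: ler_wpM2r.
rewrite -mulrA ger_pMr // mulrC ler_pdivrMr ?ltr_wpDl //; lra.
Qed.

Lemma radius_ge1_shift a : radius_ge1 a -> radius_ge1 (a \o succn).
Proof.
move=> ha; apply: radius_ge1_bounded => r /andP[r0 r1].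
have [s [rs s1 s0]] : exists s : R, [/\ r <= s, s < 1 & 0 < s].
  by exists ((r + 1) / 2); split; lra.
have s01 : 0 <= s < 1 by rewrite ltW.
exists (rsum (fun n => normc (a n) * s ^+ n) / s) => n /=.
apply: (@le_trans _ _ (normc (a n.+1) * s ^+ n)).
  by rewrite ler_wpM2l ?cnorm_ge0 // lerXn2r // nnegrE // ltW.
rewrite ler_pdivlMr // -mulrA -exprSr.
apply: (term_le_rsum n.+1 _ (ha s s01)) => k.
by rewrite mulr_ge0 ?cnorm_ge0 ?exprn_ge0 // ltW.
Qed.

(** Once the constant term is known to vanish, dividing by [z] off the origin gives the shifted
    series the same property. *)
Lemma peval_eq0 a : radius_ge1 a ->
  (forall z : disk R, val z != 0 -> peval a z = 0) -> forall n, a n = 0.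
Proof.
move=> + + n; elim: n a => [|n IH] a ha a0; first exact: coef0_eq0.
apply: (IH (a \o succn)); first exact: radius_ge1_shift.
move=> z z0; have h := coef0_eq0 ha a0.
have /cser_shift := peval_power_series ha z.
rewrite (a0 z z0) h mul0r subr0.
rewrite (_ : _ \o _ = fun n => val z * ((a \o succn) n * val z ^+ n)); last first.
  by apply/funext => k /=; rewrite exprS mulrCA.
move=> h3; have /(_ z) h4 := peval_power_series (radius_ge1_shift ha).
have /eqP := cser_unique (cserZ (val z) h4) h3.
by rewrite mulf_eq0 (negPf z0) => /eqP.
Qed.

Lemma power_series_unique f a b : power_series_on_disk f a ->
  power_series_on_disk f b -> a = b.
Proof.
move=> fa fb; apply/funext => n; apply/eqP; rewrite -subr_eq0; apply/eqP.
have h : power_series_on_disk (fun=> 0) (fun n => a n - b n).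
  move=> z; have := cserD (fa z) (cserZ (-1) (fb z)); rewrite mulN1r subrr.
  by apply: cser_ext => k; rewrite !fctE mulN1r mulrBl.
apply: (peval_eq0 (power_series_radius h)) => z _.
by rewrite -(power_series_peval h).
Qed.

Lemma taylor_coefE f a : power_series_on_disk f a -> taylor_coef f = a.
Proof.
move=> fa; rewrite /taylor_coef; case: xgetP => [b -> /power_series_unique|].
  by move=> /(_ _ fa).
by move=> /(_ a).
Qed.

End PowerSeries.

Arguments peval_power_series {R a} _ z.

(** * Square summable sequences of vectors *)

Section FiniteVectors.
Variables (R : realType) (m : nat).
Local Notation C := R[i].
Implicit Types (u v w : 'cV[C]_m).

Definition sqv u : R := \sum_i normc (u i ord0) ^+ 2.

Lemma sqv_ge0 u : 0 <= sqv u.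
Proof. by apply: sumr_ge0 => i _; rewrite sqr_ge0. Qed.

Lemma sqv0 : sqv 0 = 0.
Proof. by rewrite /sqv big1 // => i _; rewrite mxE Normc.normc0 expr0n. Qed.

Lemma sqv_eq0 u : sqv u = 0 -> u = 0.
Proof.
move=> /eqP; rewrite psumr_eq0; last by move=> i _; rewrite sqr_ge0.
move=> /allP h; apply/colP => i; rewrite mxE; apply/eqP.
by rewrite -normc_eq0 -sqrf_eq0; apply: h; rewrite mem_index_enum.
Qed.

Lemma sqvZ (c : C) u : sqv (c *: u) = normc c ^+ 2 * sqv u.
Proof.
by rewrite /sqv mulr_sumr; apply: eq_bigr => i _; rewrite mxE Normc.normcM exprMn.
Qed.

Lemma sqvN u : sqv (- u) = sqv u.
Proof. by apply: eq_bigr => i _; rewrite mxE normcN. Qed.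

Lemma coord_le_sqv u i : normc (u i ord0) ^+ 2 <= sqv u.
Proof.
by rewrite /sqv (bigD1 i) //= lerDl sumr_ge0 // => j _; rewrite sqr_ge0.
Qed.

Lemma dotc_self u : dotc u u = (sqv u)%:C%C.
Proof. by rewrite /sqv rmorph_sum; apply: eq_bigr => i _; exact: mulcJ. Qed.

Lemma dotcDl u v w : dotc (u + v) w = dotc u w + dotc v w.
Proof.
by rewrite /dotc -big_split; apply: eq_bigr => i _; rewrite mxE mulrDl.
Qed.

Lemma dotcZl c u v : dotc (c *: u) v = c * dotc u v.
Proof. by rewrite /dotc mulr_sumr; apply: eq_bigr => i _; rewrite mxE mulrA. Qed.

Lemma dotc_conj u v : (dotc u v)^* = dotc v u.
Proof.
rewrite /dotc cj_sum; apply: eq_bigr => i _; by rewrite cjM cjK mulrC.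
Qed.

Lemma dotcDr u v w : dotc w (u + v) = dotc w u + dotc w v.
Proof. by rewrite -dotc_conj dotcDl cjD !dotc_conj. Qed.

Lemma dotcZr c u v : dotc u (c *: v) = c^* * dotc u v.
Proof. by rewrite -dotc_conj dotcZl cjM dotc_conj. Qed.

Lemma dotc0l u : dotc 0 u = 0.
Proof. by rewrite -(scale0r 0) dotcZl mul0r. Qed.

Lemma dotc0r u : dotc u 0 = 0.
Proof. by rewrite -dotc_conj dotc0l cj0. Qed.

Lemma sqvD u v : sqv (u + v) = sqv u + sqv v + 2 * complex.Re (dotc u v).
Proof.
apply: (@complexI R); rewrite -dotc_self !(dotcDl, dotcDr) !dotc_self.
rewrite -(dotc_conj u v) -!addrA ![in RHS]rmorphD /=; congr (_ + _).
rewrite !addrA addrC; congr (_ + _).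
by apply: complex_eqP; rewrite !ReImE; rewrite /=; ring.
Qed.

Lemma sqvD_le u v : sqv (u + v) <= 2 * sqv u + 2 * sqv v.
Proof.
have h := sqvD u v; have := sqvD u (- v).
have -> : dotc u (- v) = - dotc u v.
  by rewrite -scaleN1r dotcZr cjN cj1 mulN1r.
rewrite sqvN cReN => h'; have := sqv_ge0 (u - v); lra.
Qed.

Lemma normc_dotc_le u v : normc (dotc u v) <= sqv u + sqv v.
Proof.
apply: le_trans (le_normc_sum _ _ _) _; rewrite /sqv -big_split /=.
apply: ler_sum => i _; rewrite Normc.normcM normcJ.
have := cnorm_ge0 (u i ord0); have := cnorm_ge0 (v i ord0); nra.
Qed.

Lemma dotc_delta u i : dotc u (delta_mx i ord0) = u i ord0.
Proof.
rewrite /dotc (bigD1 i) //= mxE !eqxx cj1 mulr1 big1 ?addr0 // => j ji.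
by rewrite mxE (negPf ji) cj0 mulr0.
Qed.

Lemma sqv_delta i : sqv (delta_mx i ord0) = 1.
Proof.
by apply: (@complexI R); rewrite -dotc_self dotc_delta mxE !eqxx.
Qed.

End FiniteVectors.

Section SquareSummable.
Variables (R : realType) (m : nat).
Local Notation C := R[i].
Local Notation seqv := (nat -> 'cV[C]_m).
Implicit Types (f g h : seqv).

Definition l2 f := cvgn (series (fun n => sqv (f n))).

Definition N2 f : R := rsum (fun n => sqv (f n)).

Definition ips f g : C := csum (fun n => dotc (f n) (g n)).

Lemma l2D f g : l2 f -> l2 g -> l2 (f + g).
Proof.
move=> lf lg.
apply: (@series_le_cvg _ _ (2 *: (fun n => sqv (f n)) + 2 *: (fun n => sqv (g n)))).
- by move=> n; exact: sqv_ge0.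
- by move=> n; rewrite !fctE addr_ge0 ?mulr_ge0 ?sqv_ge0.
- by move=> n; rewrite !fctE; exact: sqvD_le.
- by apply: is_cvg_seriesD; apply: is_cvg_seriesZ.
Qed.

Lemma l2Z c f : l2 f -> l2 (c *: f).
Proof.
move=> lf; rewrite /l2 (_ : (fun n => _) = (normc c ^+ 2) *: (fun n => sqv (f n))).
  exact: is_cvg_seriesZ.
by apply/funext => n; rewrite fctE sqvZ.
Qed.

Arguments l2Z c {f} _.

Lemma l2N f : l2 f -> l2 (- f).
Proof. by move=> /(l2Z (-1)); rewrite scaleN1r. Qed.

Lemma l2B f g : l2 f -> l2 g -> l2 (f - g).
Proof. by move=> lf /l2N; exact: l2D. Qed.

Lemma l2_fin f N : (forall n, (N <= n)%N -> f n = 0) -> l2 f.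
Proof.
move=> fN; apply: (@summable_ub _ _ (\sum_(i < N) sqv (f i))).
  by move=> n; exact: sqv_ge0.
move=> n; rewrite /series /= -(big_mkord xpredT (fun i => sqv (f i))).
have [nN|Nn] := leqP n N.
  rewrite [leRHS](@big_cat_nat _ _ _ n) //= lerDl.
  by apply: sumr_ge0 => i _; exact: sqv_ge0.
rewrite (@big_cat_nat _ _ _ N) //= ?(ltnW Nn) // [X in _ + X]big_nat [X in _ + X]big1 ?addr0 //.
by move=> i /andP[Ni _]; rewrite fN // sqv0.
Qed.

Lemma l20 : l2 0.
Proof. by apply: (@l2_fin _ 0%N). Qed.

Lemma N2_ge0 f : l2 f -> 0 <= N2 f.
Proof. by apply: rsum_ge0 => n; exact: sqv_ge0. Qed.

Lemma sqv_le_N2 f n : l2 f -> sqv (f n) <= N2 f.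
Proof.
by move=> lf; apply: (term_le_rsum n _ lf) => k; exact: sqv_ge0.
Qed.

Lemma N2_eq0 f : l2 f -> N2 f <= 0 -> f = 0.
Proof.
move=> lf f0; apply/funext => n; apply: sqv_eq0; apply/le_anti.
by rewrite sqv_ge0 andbT; apply: le_trans f0; exact: sqv_le_N2.
Qed.

Lemma N2_le_ub f (M : R) : (forall n, \sum_(i < n) sqv (f i) <= M) ->
  l2 f /\ N2 f <= M.
Proof.
move=> fM.
have fM' n : series (fun n => sqv (f n)) n <= M by rewrite /series /= big_mkord.
have lf : l2 f by apply: summable_ub fM' => n; exact: sqv_ge0.
by split => //; exact: rsum_le_ub.
Qed.

Lemma partial_le_N2 f n : l2 f -> \sum_(i < n) sqv (f i) <= N2 f.
Proof.
move=> lf; rewrite -(big_mkord xpredT (fun i => sqv (f i))).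
by apply: (series_le_rsum n _ lf) => k; exact: sqv_ge0.
Qed.

Lemma asum_dotc f g : l2 f -> l2 g -> asum (fun n => dotc (f n) (g n)).
Proof.
move=> lf lg; apply: asum_le (is_cvg_seriesD lf lg) => n.
exact: normc_dotc_le.
Qed.

Lemma ips_cser f g : l2 f -> l2 g -> cser (fun n => dotc (f n) (g n)) (ips f g).
Proof. by move=> lf lg; exact: asum_cser (asum_dotc lf lg). Qed.

Lemma ipsDl f g h : l2 f -> l2 g -> l2 h -> ips (f + g) h = ips f h + ips g h.
Proof.
move=> lf lg lh; apply: cser_csum.
apply: cser_ext (cserD (ips_cser lf lh) (ips_cser lg lh)) => n.
by rewrite !fctE dotcDl.
Qed.

Lemma ipsZl c f h : l2 f -> l2 h -> ips (c *: f) h = c * ips f h.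
Proof.
move=> lf lh; apply: cser_csum.
by apply: cser_ext (cserZ c (ips_cser lf lh)) => n; rewrite !fctE dotcZl.
Qed.

Lemma ips_conj f h : l2 f -> l2 h -> (ips f h)^* = ips h f.
Proof.
move=> lf lh; apply/esym; apply: cser_csum.
by apply: cser_ext (cserJ (ips_cser lf lh)) => n; rewrite dotc_conj.
Qed.

Lemma ipsDr f g h : l2 f -> l2 g -> l2 h -> ips h (f + g) = ips h f + ips h g.
Proof.
move=> lf lg lh; rewrite -ips_conj ?ipsDl ?cjD ?ips_conj //.
exact: l2D.
Qed.

Lemma ipsZr c f h : l2 f -> l2 h -> ips h (c *: f) = c^* * ips h f.
Proof.
by move=> lf lh; rewrite -ips_conj ?ipsZl ?cjM ?ips_conj //; exact: l2Z.
Qed.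

Lemma ipsNl f h : l2 f -> l2 h -> ips (- f) h = - ips f h.
Proof. by move=> lf lh; rewrite -scaleN1r ipsZl // mulN1r. Qed.

Lemma ipsBl f g h : l2 f -> l2 g -> l2 h -> ips (f - g) h = ips f h - ips g h.
Proof. by move=> lf lg lh; rewrite ipsDl ?ipsNl //; exact: l2N. Qed.

Lemma ips0l f : ips 0 f = 0.
Proof.
apply: cser_csum; apply: cser_ext (@cser0 R) => n.
exact/esym/dotc0l.
Qed.

Lemma ips0r f : ips f 0 = 0.
Proof.
apply: cser_csum; apply: cser_ext (@cser0 R) => n.
exact/esym/dotc0r.
Qed.

Lemma ips_self f : l2 f -> ips f f = (N2 f)%:C%C.
Proof.
move=> lf; apply: cser_csum; apply/cser_ReIm; split => /=.
  rewrite (_ : _ \o _ = fun n => sqv (f n)); first exact: lf.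
  by apply/funext => n /=; rewrite dotc_self.
rewrite (_ : series _ = fun=> 0); first exact: cvg_cst.
apply/funext => n; rewrite /series /= big1 // => i _.
by rewrite dotc_self.
Qed.

Lemma N2D f g : l2 f -> l2 g ->
  N2 (f + g) = N2 f + N2 g + 2 * complex.Re (ips f g).
Proof.
move=> lf lg; apply: (@complexI R); rewrite -ips_self; last exact: l2D.
rewrite !(ipsDl, ipsDr) ?ips_self //; try exact: l2D.
rewrite -(ips_conj lf lg).
by apply: complex_eqP; rewrite !ReImE /=; ring.
Qed.

Lemma N2Z c f : l2 f -> N2 (c *: f) = normc c ^+ 2 * N2 f.
Proof.
move=> lf; rewrite /N2.
have -> : (fun n => sqv ((c *: f) n)) = (normc c ^+ 2) *: (fun n => sqv (f n)).
  by apply/funext => n; rewrite fctE sqvZ.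
by rewrite /rsum lim_seriesZ.
Qed.

Lemma N2N f : N2 (- f) = N2 f.
Proof. by rewrite /N2; congr rsum; apply/funext => n; rewrite fctE sqvN. Qed.

Lemma N2_0 : N2 0 = 0.
Proof.
apply: (@complexI R); rewrite -ips_self ?ips0l //; exact: l20.
Qed.

Lemma N2D_le f g : l2 f -> l2 g -> N2 (f + g) <= 2 * N2 f + 2 * N2 g.
Proof.
move=> lf lg; rewrite N2D //.
have := N2_ge0 (l2B lf lg); rewrite N2D ?N2N //; last exact: l2N.
rewrite -ips_conj ?ipsNl ?cjN ?ips_conj //; try exact: l2N.
rewrite cReN; lra.
Qed.

Lemma normc_ips_le f g : l2 f -> l2 g ->
  normc (ips f g) ^+ 2 <= N2 f * N2 g.
Proof.
move=> lf lg; have f0 := N2_ge0 lf; have := N2_ge0 lg.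
rewrite le_eqVlt => /orP[/eqP g0|g0].
  by rewrite (N2_eq0 lg) -?g0 // ips0r N2_0 mulr0 Normc.normc0 expr0n.
set s := ips f g.
(* With this coefficient, [f] plus the multiple of [g] is the component of [f] orthogonal to [g];
   its nonnegative norm is the inequality. *)
have lg' := l2Z (- (s * ((N2 g)^-1)%:C%C)) lg.
have := N2_ge0 (l2D lf lg').
rewrite N2D // N2Z // ipsZr // -/s normcN Normc.normcM normc_real.
rewrite (ger0_norm (x := (N2 g)^-1)) ?invr_ge0 ?(ltW g0) //.
have -> : (- (s * ((N2 g)^-1)%:C%C))^* * s = - (normc s ^+ 2 / N2 g)%:C%C.
  rewrite cjN cjM mulNr mulrAC (mulrC s^*) mulcJ.
  by rewrite cj_real -rmorphM.
rewrite cReN /= exprMn -mulrA (_ : (N2 g)^-1 ^+ 2 * N2 g = (N2 g)^-1); last first.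
  by rewrite expr2 -mulrA mulVf ?mulr1 // gt_eqF.
move=> h; rewrite -ler_pdivrMr //; lra.
Qed.

Definition bshift f : seqv := fun n => f n.+1.

Definition consv (u : 'cV[C]_m) f : seqv := fun n => if n is k.+1 then f k else u.

Lemma l2_bshift f : l2 f -> l2 (bshift f).
Proof. by move=> lf; apply/cvg_ex; eexists; apply: (cvg_series_shift lf). Qed.

Lemma N2_bshift f : l2 f -> N2 f = sqv (f 0%N) + N2 (bshift f).
Proof.
move=> lf; have := cvg_series_shift (rsum_cvg lf).
rewrite -/(N2 f) => /cvg_lim h; rewrite /N2 [X in _ + X](h) //.
by rewrite addrC subrK.
Qed.

Lemma l2_consv u f : l2 f -> l2 (consv u f).
Proof.
move=> lf; apply/cvg_ex; eexists.
exact: (@cvg_series_unshift _ (fun n => sqv (consv u f n)) _ (rsum_cvg lf)).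
Qed.

Lemma N2_bshift_le f : l2 f -> N2 (bshift f) <= N2 f.
Proof. by move=> lf; rewrite (N2_bshift lf) lerDr sqv_ge0. Qed.

Lemma ips_consv f u g : l2 f -> l2 g ->
  ips f (consv u g) = dotc (f 0%N) u + ips (bshift f) g.
Proof.
move=> lf lg; apply: cser_csum; rewrite addrC.
exact: (@cser_unshift _ (fun n => dotc (f n) (consv u g n))
  _ (ips_cser (l2_bshift lf) lg)).
Qed.

Definition monov N (u : 'cV[C]_m) : seqv := fun n => if n == N then u else 0.

Lemma l2_monov N u : l2 (monov N u).
Proof.
by apply: (@l2_fin _ N.+1) => n Nn; rewrite /monov gtn_eqF.
Qed.

Lemma ips_monov f N u : ips f (monov N u) = dotc (f N) u.
Proof.
apply: cser_csum.
have := @cser_fin _ (fun n => dotc (f n) (monov N u n)) N.+1.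
have e : monov N u N = u by rewrite /monov eqxx.
rewrite big_ord_recr /= e big1 ?add0r.
  by apply=> n Nn; rewrite /monov gtn_eqF // dotc0r.
by move=> i _; rewrite /monov ltn_eqF // dotc0r.
Qed.

Definition truncv N f : seqv := fun n => if (n < N)%N then f n else 0.

Lemma l2_truncv N f : l2 (truncv N f).
Proof.
by apply: (@l2_fin _ N) => n Nn; rewrite /truncv ltnNge Nn.
Qed.

Lemma N2_truncv_cvg f : l2 f -> forall e : R, 0 < e ->
  exists N, N2 (f - truncv N f) < e.
Proof.
move=> lf e e0.
have e2 : 0 < e / 2 by rewrite divr_gt0.
have /cvgR_seqP/(_ _ e2)[N /(_ N (leqnn N)) hN] := rsum_cvg lf.
exists N; have : N2 (f - truncv N f) <= e / 2; last by lra.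
apply: (N2_le_ub _).2 => n.
have := partial_le_N2 (N + n) lf.
rewrite big_split_ord /= => h.
have h1 : series (fun n => sqv (f n)) N = \sum_(i < N) sqv (f i).
  by rewrite /series /= big_mkord.
rewrite h1 -/(N2 f) in hN.
have h2 : N2 f - \sum_(i < N) sqv (f i) < e / 2 by apply: le_lt_trans hN; exact: ler_norm.
apply: (@le_trans _ _ (\sum_(i < n) sqv (f (N + i)%N))); last by lra.
have [nN|Nn] := leqP n N.
  rewrite big1; first by apply: sumr_ge0 => i _; exact: sqv_ge0.
  move=> i _; rewrite !fctE /truncv (leq_trans (ltn_ord i) nN) subrr sqv0 //.
rewrite -(big_mkord xpredT (fun i => sqv ((f - truncv N f) i))).
rewrite (@big_cat_nat _ _ _ N) ?(ltnW Nn) //= [X in X + _]big_nat big1 ?add0r; last first.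
  by move=> i /andP[_ iN]; rewrite !fctE /truncv iN subrr sqv0.
rewrite -(big_mkord xpredT (fun i => sqv (f (N + i)%N))).
rewrite -{1}[N]add0n big_addn.
apply: (@le_trans _ _ (\sum_(0 <= i < n - N) sqv (f (N + i)%N))).
  apply: ler_sum => i _; rewrite !fctE /truncv ltnNge leq_addl /= subr0 addnC //.
rewrite [leRHS](@big_cat_nat _ _ _ (n - N)) ?leq_subr //= lerDl.
by apply: sumr_ge0 => i _; exact: sqv_ge0.
Qed.

Lemma N2_fin f N : (forall n, (N <= n)%N -> f n = 0) ->
  N2 f = \sum_(n < N) sqv (f n).
Proof.
move=> fN; apply: (@complexI R); rewrite -ips_self; last exact: l2_fin fN.
rewrite rmorph_sum; apply: cser_csum.
have h : forall n, (N <= n)%N -> dotc (f n) (f n) = 0.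
  by move=> n Nn; rewrite fN // dotc0l.
rewrite (eq_bigr (fun n : 'I_N => dotc (f n) (f n))); first exact: (cser_fin h).
by move=> i _; rewrite dotc_self.
Qed.

Lemma ips_fin f g N : (forall n, (N <= n)%N -> g n = 0) ->
  ips f g = \sum_(n < N) dotc (f n) (g n).
Proof.
move=> gN; apply: cser_csum; apply: (@cser_fin _ (fun n => dotc (f n) (g n))).
by move=> n Nn; rewrite gN // dotc0r.
Qed.

End SquareSummable.

Arguments l2Z {R m} c {f} _.
Arguments l2_truncv {R m} N f.
Arguments l2_monov {R m} N u.

(** * Dominated extension *)

Section HilbertExtension.
Variable R : realType.
Local Notation C := R[i].

Lemma cauchy_cvgn (x : nat -> R) :
  (forall e : R, 0 < e -> exists N, forall k l, (N <= k)%N -> (N <= l)%N ->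
    `|x k - x l| < e) -> cvgn x.
Proof.
move=> h; apply/cauchy_cvgP; apply: cauchy_exP => e e0.
have [N hN] := h e e0; exists (x N); exists N => // k /= Nk.
exact: hN.
Qed.

Lemma cvg_sqv (n : nat) (f : nat -> 'cV[C]_n) (a u : 'cV[C]_n) :
  (forall i, (fun l => complex.Re (f l i ord0)) @ \oo --> complex.Re (a i ord0)) ->
  (forall i, (fun l => complex.Im (f l i ord0)) @ \oo --> complex.Im (a i ord0)) ->
  (fun l => sqv (f l - u)) @ \oo --> sqv (a - u).
Proof.
move=> hr hi; rewrite /sqv.
apply: cvg_big => [|i _]; first exact: add_continuous.
rewrite sqr_normcE; under eq_fun do rewrite sqr_normcE.
rewrite !mxE !ReImE; under eq_fun do rewrite !mxE !ReImE.
by apply: cvgD; rewrite expr2; apply: cvgM; apply: cvgB; [exact: hr|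
  exact: cvg_cst|exact: hr|exact: cvg_cst|exact: hi|exact: cvg_cst|
  exact: hi|exact: cvg_cst].
Qed.

Variables (U : lmodType C) (n : nat) (L : set U) (v : U) (q : U -> R).
Variables (B : U -> U -> R) (xi : U -> 'cV[C]_n).
Hypothesis L0 : L 0.
Hypothesis LP : forall c x y, L x -> L y -> L (c *: x + y).
(** The form [q] is assumed nonnegative and quadratic only on the span of [L] and [v]: in the
    application, its sign is known there and not on the whole space. [B] is the real part of its
    polarization. *)
Let W := [set x | exists h c, L h /\ x = h + c *: v].
Hypothesis q_ge0 : forall x, W x -> 0 <= q x.
Hypothesis q_quad : forall x y (t : R), W x -> W y ->
  q (x + t%:C%C *: y) = q x + 2 * t * B x y + t ^+ 2 * q y.
Hypothesis qZ : forall c x, W x -> q (c *: x) = normc c ^+ 2 * q x.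
Hypothesis xi_lin : forall c x y, xi (c *: x + y) = c *: xi x + xi y.
Hypothesis xi_le : forall x, L x -> sqv (xi x) <= q x.

Let WP c x y : W x -> W y -> W (c *: x + y).
Proof.
move=> [h [a [Lh ->]]] [k [b [Lk ->]]]; exists (c *: h + k), (c * a + b).
by split; [exact: LP|rewrite scalerDr scalerDl scalerA addrACA].
Qed.

Let LW x : L x -> W x.
Proof. by move=> Lx; exists x, 0; rewrite scale0r addr0. Qed.

Let Wv : W v.
Proof. by exists 0, 1; rewrite scale1r add0r. Qed.

Let LZ c x : L x -> L (c *: x).
Proof. by move=> Lx; rewrite -[_ *: _]addr0; exact: LP. Qed.

Let LB x y : L x -> L y -> L (x - y).
Proof. by move=> Lx Ly; rewrite addrC -scaleN1r; exact: LP. Qed.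

Let WB x y : W x -> W y -> W (x - y).
Proof. by move=> Wx Wy; rewrite addrC -scaleN1r; exact: WP. Qed.

Let parallelogram x y : W x -> W y -> q (x + y) + q (x - y) = 2 * q x + 2 * q y.
Proof.
move=> Wx Wy; have := q_quad 1 Wx Wy; have := q_quad (-1) Wx Wy.
rewrite rmorphN !rmorph1 scaleN1r scale1r => -> ->; ring.
Qed.

Let xiB x y : xi (x - y) = xi x - xi y.
Proof. by rewrite addrC -scaleN1r xi_lin scaleN1r addrC. Qed.

Let r0 := inf [set q (v - h) | h in L].

Let r0_le h : L h -> r0 <= q (v - h).
Proof.
move=> Lh; apply: ge_inf; last by exists h.
by exists 0 => _ [k Lk <-]; apply: q_ge0; apply: WB => //; exact: LW.
Qed.

Let r0_ge0 : 0 <= r0.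
Proof.
apply: lb_le_inf; first by exists (q (v - 0)), 0.
by move=> _ [k Lk <-]; apply: q_ge0; apply: WB => //; exact: LW.
Qed.

Let minimizing (e : R) : 0 < e -> exists h, L h /\ q (v - h) < r0 + e.
Proof.
move=> e0; have [|_ [h Lh <-] hlt] := @inf_adherent _ [set q (v - h) | h in L] e e0.
  split; first by exists (q (v - 0)), 0.
  by exists 0 => _ [k Lk <-]; apply: q_ge0; apply: WB => //; exact: LW.
by exists h.
Qed.

(** The midpoint of [h] and [k] is in [L], hence at [q]-distance at least [r0] from [v]; the
    parallelogram identity leaves at most [4 * (r0 + e) - 4 * r0]. *)
Let minimizing_close (e : R) h k : L h -> L k -> q (v - h) < r0 + e ->
  q (v - k) < r0 + e -> q (h - k) <= 4 * e.
Proof.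
move=> Lh Lk qh qk.
have Wh : W (v - h) by apply: WB => //; exact: LW.
have Wk : W (v - k) by apply: WB => //; exact: LW.
have := parallelogram Wk Wh.
have -> : v - k - (v - h) = h - k by rewrite opprB addrC addrA subrK.
have -> : v - k + (v - h) = (2%:R : C) *: (v - (2%:R^-1 : C) *: (h + k)).
  rewrite scalerBr scalerA mulfV ?pnatr_eq0 // scale1r scaler_nat mulr2n.
  by rewrite addrACA -opprD (addrC h).
have Lm : L (2%:R^-1 *: (h + k)) by apply: LZ; rewrite -[h]scale1r; exact: LP.
rewrite qZ; last by apply: WB => //; exact: LW.
have -> : normc (2%:R : C) ^+ 2 = 4.
  have -> : (2%:R : C) = (2%:R : R)%:C%C by rewrite rmorph_nat.
  by rewrite normc_real ger0_norm //; ring.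
have := r0_le Lm; lra.
Qed.

(** For an exact projection [h] of [v], Pythagoras would give [q (h - k) <= q (v - k)]. Here [h] is
    only [e]-minimizing: a step of size [s] along [h - k] gains at most [e], so the cross term is at
    least [- e / s - s * q (h - k)]. *)
Let minimizing_bound (e s M : R) h k : L h -> L k -> 0 < s ->
  q (v - h) < r0 + e -> q (h - k) <= M ->
  q (h - k) <= q (v - k) + e / s + s * M.
Proof.
move=> Lh Lk s0 qh qM.
have Wh : W (v - h) by apply: WB => //; exact: LW.
have Whk : W (h - k) by apply: LW; exact: LB.
have h1 := q_quad 1 Wh Whk.
have h2 := q_quad s Wh Whk.
have e1 : v - h + 1%:C%C *: (h - k) = v - k by rewrite rmorph1 scale1r addrA subrK.
have e2 : v - h + s%:C%C *: (h - k) = v - (h - s%:C%C *: (h - k)).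
  by rewrite opprB addrA addrAC.
rewrite e1 in h1; rewrite e2 in h2.
have := r0_le (_ : L (h - s%:C%C *: (h - k))).
move=> /(_ (LB Lh (LZ _ (LB Lh Lk)))); rewrite h2 => h3.
have h4 : - (e / s) - s * q (h - k) <= 2 * B (v - h) (h - k).
  rewrite -(ler_pM2l s0).
  have -> : s * (- (e / s) - s * q (h - k)) = - e - s ^+ 2 * q (h - k).
    by field; rewrite gt_eqF.
  lra.
have h5 : s * q (h - k) <= s * M by rewrite ler_pM2l.
have := r0_le Lh; have := r0_ge0; lra.
Qed.

(* The functional [xi], dominated by the semi-Hilbertian form [q] on [L], is
   evaluated along a sequence of [L] whose [q]-distance to [v] is minimizing. *)
Lemma dominated_extension : exists a : 'cV[C]_n, forall h c, L h ->
  sqv (xi h + c *: a) <= q (h + c *: v).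
Proof.
pose eps (l : nat) : R := l.+1%:R^-1.
have eps0 l : 0 < eps l by rewrite invr_gt0.
have eps_lt e : 0 < e -> exists N, forall l, (N <= l)%N -> eps l < e.
  move=> e0; have /cvgR_seqP/(_ _ e0)[N hN] := @cvg_harmonic R.
  exists N => l /hN; rewrite sub0r normrN ger0_norm //; exact: harmonic_ge0.
have [w hw] := choice (fun l => minimizing (eps0 l)).
have Lw l : L (w l) by case: (hw l).
have qw l : q (v - w l) < r0 + eps l by case: (hw l).
have close e : 0 < e -> exists N, forall k l, (N <= k)%N -> (N <= l)%N ->
    q (w k - w l) < e.
  move=> e0; have e8 : 0 < e / 8 by rewrite divr_gt0.
  have [N hN] := eps_lt _ e8; exists N => k l Nk Nl.
  have := @minimizing_close (e / 8) (w k) (w l) (Lw k) (Lw l).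
  move=> /(_ (lt_trans (qw k) _) (lt_trans (qw l) _)); rewrite !ltrD2l !hN //.
  by move=> /(_ isT isT); lra.
have coordC e i : 0 < e -> exists N, forall k l, (N <= k)%N -> (N <= l)%N ->
    normc (xi (w k) i ord0 - xi (w l) i ord0) < e.
  move=> e0; have e2 : 0 < e ^+ 2 by rewrite exprn_gt0.
  have [N hN] := close _ e2; exists N => k l Nk Nl.
  rewrite -(ltr_pXn2r (n := 2)) ?nnegrE ?cnorm_ge0 ?(ltW e0) //.
  apply: le_lt_trans (hN k l Nk Nl).
  apply: le_trans (xi_le (LB (Lw k) (Lw l))); rewrite xiB.
  by have := coord_le_sqv (xi (w k) - xi (w l)) i; rewrite !mxE.
have cRe i : cvgn (fun l => complex.Re (xi (w l) i ord0)).
  apply: cauchy_cvgn => e e0; have [N hN] := coordC e i e0.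
  exists N => k l Nk Nl; apply: le_lt_trans (hN k l Nk Nl).
  by rewrite -cReN -cReD; exact: Re_le_normc.
have cIm i : cvgn (fun l => complex.Im (xi (w l) i ord0)).
  apply: cauchy_cvgn => e e0; have [N hN] := coordC e i e0.
  exists N => k l Nk Nl; apply: le_lt_trans (hN k l Nk Nl).
  by rewrite -cImN -cImD; exact: Im_le_normc.
pose a : 'cV[C]_n := \col_i (limn (fun l => complex.Re (xi (w l) i ord0)) +i*
  limn (fun l => complex.Im (xi (w l) i ord0)))%C.
have main k : L k -> sqv (a - xi k) <= q (v - k).
  move=> Lk; apply/ler_addgt0Pr => e e0.
  have Wk : W (v - k) by apply: WB => //; exact: LW.
  (* The parallelogram identity with [eps l <= 1] bounds [q (w l - k)] by the first two terms; the
     last 1 makes [M] positive. Then [s] is chosen so that [s * M = e / 2], and [l] so that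
     [eps l / s <= e / 2]. *)
  pose M := 2 * q (v - k) + 2 * (r0 + 1) + 1.
  have M0 : 0 < M.
    by rewrite ltr_wpDl // addr_ge0 ?mulr_ge0 ?q_ge0 ?addr_ge0.
  pose s := e / 2 / M; have s0 : 0 < s by rewrite !divr_gt0.
  have es : 0 < e / 2 * s by rewrite mulr_gt0 ?divr_gt0.
  have [N hN] := eps_lt _ es.
  have cv : (fun l => sqv (xi (w l) - xi k)) @ \oo --> sqv (a - xi k).
    by apply: cvg_sqv => i; rewrite mxE; [exact: cRe|exact: cIm].
  rewrite -(cvg_lim (@Rhausdorff R) cv); apply: limr_le; first exact: cvgP cv.
  exists N => // l /= Nl; rewrite -xiB.
  apply: le_trans (xi_le (LB (Lw l) Lk)) _.
  have Wl : W (v - w l) by apply: WB => //; exact: LW.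
  have qM : q (w l - k) <= M.
    have := parallelogram Wk Wl.
    have -> : v - k - (v - w l) = w l - k by rewrite opprB addrC addrA subrK.
    have : 0 <= q (v - k + (v - w l)).
      by apply: q_ge0; rewrite -[v - k]scale1r; exact: WP.
    have := qw l; have : eps l <= 1 by rewrite invf_le1 // ler1n.
    rewrite /M; lra.
  apply: le_trans (minimizing_bound (Lw l) Lk s0 (qw l) qM) _.
  have -> : s * M = e / 2 by rewrite /s divfK // gt_eqF.
  have : eps l / s <= e / 2 by rewrite ler_pdivrMr // ltW // hN.
  lra.
exists a => h c Lh; have [->|c0] := eqVneq c 0.
  by rewrite !scale0r !addr0; exact: xi_le.
(* By homogeneity, the case of a general [c] is the distance estimate [main] at the point [- c^-1 h]
   of [L]. *)
have -> : h + c *: v = c *: (v - (- c^-1) *: h).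
  by rewrite scalerBr scalerA mulrN mulfV // scaleN1r opprK addrC.
have -> : xi h + c *: a = c *: (a - xi ((- c^-1) *: h)).
  have xi0 : xi 0 = 0 by have := xiB 0 0; rewrite !subrr.
  rewrite -[_ *: h]addr0 xi_lin xi0 addr0.
  by rewrite scalerBr scalerA mulrN mulfV // scaleN1r opprK addrC.
rewrite sqvZ qZ; last by apply: WB => //; apply: LW; exact: LZ.
by apply: ler_wpM2l; [rewrite sqr_ge0|apply: main; exact: LZ].
Qed.

End HilbertExtension.

(** * Commutant lifting *)

Section CommutantLifting.
Variables (R : realType) (m n : nat) (c : R).
Local Notation C := R[i].
Local Notation graph := (set ((nat -> 'cV[C]_m) * (nat -> 'cV[C]_n))).
Implicit Types G : graph.
Hypothesis c_ge0 : 0 <= c.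

(** A bounded operator with variable domain that commutes with the backward shift. As a set of pairs
    it is ordered by inclusion, and single-valuedness follows from the norm bound. *)
Definition shift_graph G := [/\ G 0,
  forall a x y, G x -> G y -> G (a *: x + y),
  forall x, G x -> [/\ l2 x.1, l2 x.2 & N2 x.2 <= c * N2 x.1] &
  forall x, G x -> G (bshift x.1, bshift x.2)].

Lemma shift_graph_single G h y y' : shift_graph G ->
  G (h, y) -> G (h, y') -> y = y'.
Proof.
move=> [_ GP Gb _] Gy Gy'; have := Gb _ (GP (-1) _ _ Gy Gy').
rewrite /= !scaleN1r addNr N2_0 mulr0 => -[_ l2y /(N2_eq0 l2y)] /eqP.
by rewrite addrC subr_eq0 => /eqP.
Qed.

Lemma shift_graph_sum G (I : Type) (r : seq I) (F : I -> _) : shift_graph G ->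
  (forall i, G (F i)) -> G (\sum_(i <- r) F i).
Proof.
move=> [G0 GP _ _] GF; elim: r => [|i r IH]; first by rewrite big_nil.
by rewrite big_cons -[F i]scale1r; exact: GP.
Qed.

Lemma shift_graph_step G v y : shift_graph G -> l2 v -> G (bshift v, y) ->
  exists a, shift_graph [set x | exists h b, G h /\ x = h + b *: (v, consv a y)].
Proof.
move=> [G0 GP Gb Gs] l2v Gvy.
have l2y : l2 y by case: (Gb _ Gvy).
(* The 0 is a placeholder for the coefficient sought: [q] looks at the second component only through
   [bshift], which erases it. *)
pose v0 : (nat -> 'cV[C]_m) * (nat -> 'cV[C]_n) := (v, consv 0 y).
pose q (x : (nat -> 'cV[C]_m) * (nat -> 'cV[C]_n)) := c * N2 x.1 - N2 (bshift x.2).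
pose B (x x' : (nat -> 'cV[C]_m) * (nat -> 'cV[C]_n)) :=
  c * complex.Re (ips x.1 x'.1) - complex.Re (ips (bshift x.2) (bshift x'.2)).
have l2W x : (exists h b, G h /\ x = h + b *: v0) -> l2 x.1 /\ l2 (bshift x.2).
  move=> [h [b [/Gb[l1 l2h _] ->]]]; split; first exact: l2D (l2Z _ _).
  by apply: l2_bshift; apply: l2D => //; apply: l2Z; exact: l2_consv.
have [|||||a ha] := @dominated_extension _ _ n G v0 q B (fun x => x.2 0%N) G0 GP.
- move=> x Wx; have [l1 l2x] := l2W x Wx; case: Wx => h [b [Gh xE]].
  (* Shifting sends [v0] to [(bshift v, y)], which is in [G]; so the bound of [G] holds for the
     shifted pair and yields [q x >= 0]. *)
  have Gx : G (bshift x.1, bshift x.2).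
    have := GP b _ _ Gvy (Gs _ Gh); congr G.
    by rewrite xE addrC; congr pair; apply/funext => -[|k].
  have [_ _ /= h1] := Gb _ Gx; rewrite subr_ge0; apply: le_trans h1 _.
  by apply: ler_wpM2l => //; exact: N2_bshift_le.
- move=> x x' t /l2W[l1 l2x] /l2W[l1' l2x']; rewrite /q /B /=.
  have -> : bshift (x.2 + t%:C%C *: x'.2) = bshift x.2 + t%:C%C *: bshift x'.2 by [].
  rewrite !N2D ?N2Z ?ipsZr //; try exact: l2Z.
  rewrite normc_real cj_real !cReM /= !mul0r !subr0 real_normK ?num_real //; ring.
- move=> b x /l2W[l1 l2x]; rewrite /q /=.
  by rewrite N2Z // (_ : bshift (b *: x.2) = b *: bshift x.2) // N2Z //; ring.
- by [].
- by move=> x /Gb[l1 l2x xle]; rewrite /q; have := N2_bshift l2x; lra.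
exists a; split.
- by exists 0, 0; rewrite scale0r addr0.
- move=> d x x' [h [b [Gh ->]]] [h' [b' [Gh' ->]]].
  exists (d *: h + h'), (d * b + b'); split; first exact: GP.
  by rewrite scalerDr scalerDl scalerA addrACA.
- move=> x [h [b [Gh ->]]]; have [l1 l2h _] := Gb _ Gh.
  have l2x : l2 (h.2 + b *: consv a y) by apply: l2D => //; apply: l2Z; exact: l2_consv.
  split=> //=; first by apply: l2D => //; exact: l2Z.
  rewrite (N2_bshift l2x); have := ha h b Gh; rewrite /q /=.
  have -> : bshift (h.2 + b *: consv 0 y) = bshift (h.2 + b *: consv a y).
    by apply/funext => l.
  by rewrite -lerBrDr.
- move=> x [h [b [Gh ->]]].
  (* The shift of any element of the extension already lies in [G], hence coefficient 0 on the new
     vector. *)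
  exists (b *: (bshift v, y) + (bshift h.1, bshift h.2)), 0; split.
    by apply: GP => //; exact: Gs.
  by rewrite scale0r addr0 addrC; congr pair; apply/funext => -[|k].
Qed.

Lemma shift_graph_max G : shift_graph G ->
  exists G', [/\ shift_graph G', G `<=` G' &
    forall N u, exists y, G' (monov N u, y)].
Proof.
move=> gG.
(* Zorn is run on the sets to be added to [G], so that the empty chain, whose union is empty, yields
   [G] itself. *)
have [F FP tot|A [gA Amax]] := @Zorn_bigcup _ (fun X => shift_graph (G `|` X)).
  pose S := G `|` \bigcup_(X in F) X.
  have chain x y : S x -> S y -> exists T, [/\ shift_graph T, T `<=` S, T x & T y].
    move=> [Gx|[X FX Xx]] [Gy|[Y FY Yy]].
    - by exists G; split => //; exact: subsetUl.
    - exists (G `|` Y); split; [exact: FP| |by left|by right].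
      by apply: setUS => t Yt; exists Y.
    - exists (G `|` X); split; [exact: FP| |by right|by left].
      by apply: setUS => t Yt; exists X.
    - case: (tot X Y FX FY) => XY.
        exists (G `|` Y); split; [exact: FP| |right; exact: XY|by right].
        by apply: setUS => t Yt; exists Y.
      exists (G `|` X); split; [exact: FP| |by right|right; exact: XY].
      by apply: setUS => t Yt; exists X.
  split.
  - by left; case: gG.
  - move=> a x y Sx Sy; have [T [[_ TP _ _] TS Tx Ty]] := chain x y Sx Sy.
    by apply: TS; exact: TP.
  - by move=> x Sx; have [T [[_ _ Tb _] TS Tx _]] := chain x x Sx Sx; exact: Tb.
  - move=> x Sx; have [T [[_ _ _ Ts] TS Tx _]] := chain x x Sx Sx.
    by apply: TS; exact: Ts.
set G' := G `|` A in gA.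
have step v y : l2 v -> G' (bshift v, y) -> exists z, G' (v, z).
  move=> l2v Gvy; have [a gH] := shift_graph_step gA l2v Gvy.
  move: gH; set H := [set _ | _] => gH.
  have GH : G' `<=` H by move=> x Gx; exists x, 0; rewrite scale0r addr0.
  have HG : G `|` H = H by apply/setUidPr => x Gx; apply: GH; left.
  have Hv : H (v, consv a y).
    by exists 0, 1; rewrite scale1r add0r; split => //; case: gA.
  exists (consv a y); apply: contrapT => nG.
  apply: (Amax H); last by rewrite HG.
  rewrite properEneq; split; last by move=> x Ax; apply: GH; right.
  by apply/eqP => AH; apply: nG; right; rewrite AH.
exists G'; split=> // [|N u]; first exact: subsetUl.
(* The backward shift of [z^(N+1) u] is [z^N u], and that of a constant is 0, so each monomial is
   one extension step beyond the previous one. *)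
elim: N => [|N [y IH]].
  apply: (step _ 0); first exact: l2_monov.
  by case: gA => G0 _ _ _; have -> : bshift (monov 0 u) = 0 by [].
by apply: (step _ y); first exact: l2_monov.
Qed.

(* The backward-shift-invariant extension of [G] to the polynomials is the
   coanalytic Toeplitz operator with coefficients [P]. *)
Definition coanalytic (P : nat -> 'M[C]_(n, m)) K (p : nat -> 'cV[C]_m) :
    nat -> 'cV[C]_n :=
  fun l => \sum_(N < K | (l <= N)%N) P (N - l)%N *m p N.

(** Let [Y N u] be the image of [z^N u]. Commutation with the shift gives
    [bshift (Y N.+1 u) = Y N u], so coefficient [l] of [Y N u] is coefficient 0 of [Y (N - l) u].
    These initial coefficients form the matrices [P]. *)
Lemma shift_graph_toeplitz G : shift_graph G ->
  exists G' P, [/\ shift_graph G', G `<=` G' &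
    forall K p, G' (truncv K p, coanalytic P K p)].
Proof.
move=> /shift_graph_max[G' [gG' GG' dom]].
have dom' N : exists Y, forall u, G' (monov N u, Y u).
  by have [Y hY] := choice (dom N); exists Y.
have [Y hY] := choice dom'.
have [G0 GP Gb Gs] := gG'.
have Ylin N a u w : Y N (a *: u + w) = a *: Y N u + Y N w.
  apply: (shift_graph_single gG' (hY N (a *: u + w))).
  rewrite (_ : monov N (a *: u + w) = a *: monov N u + monov N w).
    exact: GP (hY N u) (hY N w).
  apply/funext => k; rewrite !fctE /monov; case: eqP => // _.
  by rewrite scaler0 addr0.
have YS N u : bshift (Y N.+1 u) = Y N u.
  by apply: (shift_graph_single gG' _ (hY N u)); exact: (Gs _ (hY N.+1 u)).
have Y0 u : bshift (Y 0%N u) = 0.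
  by apply: (shift_graph_single gG' _ G0); exact: (Gs _ (hY 0%N u)).
pose P N : 'M[C]_(n, m) := \matrix_(k, i) Y N (delta_mx i ord0) 0%N k ord0.
have YP N u : Y N u 0%N = P N *m u.
  have Ysum (r : seq 'I_m) : Y N (\sum_(i <- r) u i ord0 *: delta_mx i ord0) =
      \sum_(i <- r) u i ord0 *: Y N (delta_mx i ord0).
    elim: r => [|i r IH]; last by rewrite !big_cons Ylin IH.
    rewrite !big_nil; have := Ylin N (-1) 0 0; rewrite scaler0 addr0.
    by rewrite scaleN1r addNr.
  rewrite [u in LHS]matrix_sum_delta exchange_big big_ord1 Ysum.
  apply/colP => k; rewrite !mxE fct_sumE summxE; apply: eq_bigr => i _.
  by rewrite !mxE mulrC.
have Yl N u l : Y N u l = if (l <= N)%N then P (N - l)%N *m u else 0.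
  elim: N l => [|N IH] [|l]; rewrite ?subn0 ?YP //.
    by rewrite -[LHS]/(bshift (Y 0%N u) l) Y0.
  by rewrite -[LHS]/(bshift (Y N.+1 u) l) YS IH.
exists G', P; split => // K p.
have := shift_graph_sum (index_enum 'I_K) gG' (fun i : 'I_K => hY i (p i)).
rewrite [X in G' X]surjective_pairing; congr (G' (_, _)).
  rewrite (raddf_sum (@fst _ _)).
  apply/funext => k; rewrite fct_sumE /truncv /monov /=; case: ltnP => kK.
    rewrite (bigD1 (Ordinal kK)) //= eqxx big1 ?addr0 // => i ik.
    by case: eqP => // kE; case/eqP: ik; apply/val_inj.
  by rewrite big1 // => i _; rewrite gtn_eqF // (leq_trans (ltn_ord i)).
rewrite (raddf_sum (@snd _ _)).
apply/funext => l; rewrite fct_sumE /coanalytic [RHS]big_mkcond.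
by apply: eq_bigr => i _ /=; rewrite Yl.
Qed.

End CommutantLifting.

(** * Symbols of bounded Toeplitz operators *)

Section ToeplitzSymbol.
Variables (R : realType) (m n : nat) (c : R).
Local Notation C := R[i].
Variable P : nat -> 'M[C]_(n, m).
Hypothesis c_ge0 : 0 <= c.
Hypothesis P_le : forall K p, N2 (coanalytic P K p) <= c * N2 (truncv K p).

Lemma coanalytic_ge K (p : nat -> 'cV[C]_m) l : (K <= l)%N ->
  coanalytic P K p l = 0.
Proof.
move=> Kl; rewrite /coanalytic big1 // => N lN.
by have := leq_trans (ltn_ord N) Kl; rewrite ltnNge lN.
Qed.

Lemma l2_coanalytic K (p : nat -> 'cV[C]_m) : l2 (coanalytic P K p).
Proof. by apply: (@l2_fin _ _ _ K) => l; exact: coanalytic_ge. Qed.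

Arguments l2_coanalytic : clear implicits.

(** The test vector is the unit monomial [z^j e_i], whose image has [P j e_i] as coefficient 0. *)
Lemma symbol_coef_bound j k i : normc (P j k i) ^+ 2 <= c.
Proof.
have e : coanalytic P j.+1 (monov j (delta_mx i ord0)) 0%N = P j *m delta_mx i ord0.
  rewrite /coanalytic big_mkcond (bigD1 ord_max) //= big1 ?addr0 ?subn0.
    by rewrite /monov eqxx.
  move=> N Nj; rewrite /monov; case: eqP => [Ej|_]; last by rewrite mulmx0.
  by case/eqP: Nj; apply: val_inj.
have h1 : truncv j.+1 (monov j (delta_mx i ord0 : 'cV[C]_m)) = monov j (delta_mx i ord0).
  apply/funext => l; rewrite /truncv /monov; case: (eqVneq l j) => [->|_].
    by rewrite ltnSn.
  by rewrite if_same.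
have := P_le j.+1 (monov j (delta_mx i ord0)); rewrite h1.
have -> : N2 (monov j (delta_mx i ord0 : 'cV[C]_m)) = 1.
  apply: (@complexI R); rewrite -ips_self; last exact: l2_monov.
  by rewrite ips_monov /monov eqxx dotc_self sqv_delta.
rewrite mulr1 => h; apply: (le_trans _ h).
apply: (le_trans _ (sqv_le_N2 0%N (l2_coanalytic _ _))).
rewrite e; apply: (le_trans _ (coord_le_sqv _ k)).
by rewrite -colE mxE.
Qed.

Lemma symbol_radius k i : radius_ge1 (fun j => P j k i).
Proof.
apply: (@bounded_radius_ge1 _ _ (c + 1)) => j.
have := symbol_coef_bound j k i; have := cnorm_ge0 (P j k i); nra.
Qed.

Arguments symbol_radius : clear implicits.

(** The sequence [z^N e_i] is an eigenvector of the backward shift with squared norm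
    [1 / (1 - |z|^2)]. On its truncation at [K], coefficient [l] of the image is [z^l] times a
    partial sum of the symbol of length [K - l]. *)
Lemma symbol_partial_bound k i (z : C) L K : (L <= K)%N -> normc z < 1 ->
  \sum_(l < L) (normc z ^+ 2) ^+ l *
    normc (series (fun j => P j k i * z ^+ j) (K - l)%N) ^+ 2 <=
  c * (1 - normc z ^+ 2)^-1.
Proof.
move=> LK z1; pose p N : 'cV[C]_m := z ^+ N *: delta_mx i ord0.
have x0 : 0 <= normc z ^+ 2 by rewrite sqr_ge0.
have x1 : normc z ^+ 2 < 1 by rewrite expr_lt1 // cnorm_ge0.
have h1 : N2 (truncv K p) <= (1 - normc z ^+ 2)^-1.
  apply: (N2_le_ub _).2 => M.
  apply: (@le_trans _ _ (\sum_(N < M) (normc z ^+ 2) ^+ N)).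
    apply: ler_sum => N _; rewrite /truncv; case: ifP => _; last by rewrite sqv0 exprn_ge0.
    by rewrite sqvZ sqv_delta mulr1 normcX -!exprM mulnC.
  have cg : series (geometric 1 (normc z ^+ 2)) @ \oo --> (1 - normc z ^+ 2)^-1.
    rewrite -[X in _ --> X]mul1r; apply: cvg_geometric_series.
    by rewrite ger0_norm.
  rewrite -(cvg_lim (@Rhausdorff R) cg).
  have := @series_le_rsum R (geometric 1 (normc z ^+ 2)) M.
  rewrite /series /= big_mkord; under [X in _ -> _ -> X <= _]eq_bigr do rewrite mul1r.
  apply; last exact: cvgP cg.
  by move=> N; rewrite /geometric /= mul1r exprn_ge0.
apply: (@le_trans _ _ (N2 (coanalytic P K p))); last first.
  by apply: le_trans (P_le _ _) _; exact: ler_wpM2l.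
apply: (le_trans _ (partial_le_N2 L (l2_coanalytic K p))).
apply: ler_sum => l _; apply: (le_trans _ (coord_le_sqv _ k)).
have -> : coanalytic P K p l k ord0 =
    z ^+ l * series (fun j => P j k i * z ^+ j) (K - l)%N.
  rewrite /coanalytic summxE /series /= mulr_sumr.
  rewrite -(big_mkord (fun N => (l <= N)%N) (fun N => (P (N - l)%N *m p N) k ord0)).
  have lK : (l <= K)%N by rewrite (leq_trans _ LK) // ltnW.
  rewrite (@big_cat_nat _ _ _ l) //= [X in X + _]big_nat_cond.
  rewrite [X in X + _]big_pred0 ?add0r; last first.
    by move=> N; lia.
  rewrite -{1}[nat_of_ord l]add0n big_addn big_mkcond /=.
  apply: eq_bigr => N _; rewrite leq_addl addnK /p -scalemxAr mxE -colE mxE.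
  by rewrite exprD; ring.
by rewrite Normc.normcM normcX [leRHS]exprMn -!exprM mulnC.
Qed.

(** In [symbol_partial_bound], [K] goes to infinity for fixed [L], then [L] does; the geometric sum
    produces [1 / (1 - |z|^2)] on the left too, and it cancels. *)
Lemma symbol_bound k i (z : disk R) :
  normc (peval (fun j => P j k i) z) ^+ 2 <= c.
Proof.
set s := peval _ z; have z1 := disk_lt1 z.
set x := normc (val z) ^+ 2.
have x0 : 0 <= x by rewrite sqr_ge0.
have x1 : x < 1 by rewrite expr_lt1 // cnorm_ge0.
have cs : (fun K => normc (series (fun j => P j k i * val z ^+ j) K) ^+ 2) @ \oo
    --> normc s ^+ 2.
  have /cvgC_ReIm[h1 h2] := peval_power_series (symbol_radius k i) z.
  rewrite sqr_normcE; under eq_fun do rewrite sqr_normcE.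
  by apply: cvgD; rewrite expr2; exact: cvgM.
have hL L : normc s ^+ 2 * \sum_(l < L) x ^+ l <= c * (1 - x)^-1.
  have cv : (fun K => \sum_(l < L) x ^+ l *
     normc (series (fun j => P j k i * val z ^+ j) (K - l)%N) ^+ 2) @ \oo -->
     \sum_(l < L) x ^+ l * normc s ^+ 2.
    apply: cvg_big => [|l _]; first exact: add_continuous.
    apply: cvgM; first exact: cvg_cst.
    by rewrite (@cvg_centern l R (fun K => normc (series (fun j => P j k i * val z ^+ j) K) ^+ 2)).
  rewrite mulr_sumr; under eq_bigr do rewrite mulrC.
  rewrite -(cvg_lim (@Rhausdorff R) cv); apply: limr_le; first exact: cvgP cv.
  by exists L => // K /= LK; exact: symbol_partial_bound.
have cg : series (geometric (normc s ^+ 2) x) @ \oo --> normc s ^+ 2 * (1 - x)^-1.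
  by apply: cvg_geometric_series; rewrite ger0_norm.
have : normc s ^+ 2 * (1 - x)^-1 <= c * (1 - x)^-1.
  rewrite -(cvg_lim (@Rhausdorff R) cg); apply: limr_le; first exact: cvgP cg.
  near=> L; rewrite /series /= big_mkord /geometric /= -mulr_sumr; exact: hL.
by rewrite ler_pM2r // invr_gt0; lra.
Unshelve. all: by end_near. Qed.

End ToeplitzSymbol.

Arguments l2_coanalytic {R m n} P K p.
Arguments symbol_radius {R m n c} P _ k i.

(** * Bounded analytic functions *)

Section BoundedAnalytic.
Variable R : realType.
Local Notation C := R[i].
Implicit Types f g : disk R -> C.

Lemma HinfD f g : Hinf f -> Hinf g -> Hinf (f + g).
Proof.
move=> [[a fa] [M fM]] [[b gb] [M' gM']]; split.
  by exists (a + b); exact: power_seriesD.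
by exists (M + M') => z; apply: le_trans (le_normcD _ _) _; exact: lerD.
Qed.

Lemma HinfM f g : Hinf f -> Hinf g -> Hinf (f * g).
Proof.
move=> [[a fa] [M fM]] [[b gb] [M' gM']]; split.
  by exists (cauchy_prod a b); exact: power_seriesM.
by exists (M * M') => z; rewrite Normc.normcM ler_pM ?cnorm_ge0.
Qed.

Lemma Hinf0 : Hinf (0 : disk R -> C).
Proof.
split; first by exists (fun=> 0); exact: power_series0.
by exists 0 => z; rewrite Normc.normc0.
Qed.

Lemma Hinf1 : Hinf (1 : disk R -> C).
Proof.
split; last by exists 1 => z; rewrite Normc.normc1.
exists (fun n => if n == 0%N then 1 else 0) => z.
by have := @power_series_mono R 0 1 z; rewrite expr0 mulr1.
Qed.

Lemma Hinf_sum (I : Type) (r : seq I) (F : I -> disk R -> C) :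
  (forall i, Hinf (F i)) -> Hinf (\sum_(i <- r) F i).
Proof.
move=> h; elim: r => [|i r IH]; first by rewrite big_nil; exact: Hinf0.
by rewrite big_cons; exact: HinfD.
Qed.

Lemma Hinf_peval (a : nat -> C) (M : R) : radius_ge1 a ->
  (forall z, normc (peval a z) <= M) -> Hinf (peval a).
Proof.
move=> ra aM; split; last by exists M.
by exists a => z; exact: (peval_power_series ra).
Qed.

Lemma disk_conj_lt1 (z : disk R) : normc (val z)^* < 1.
Proof. by rewrite normcJ; exact: disk_lt1. Qed.

Lemma peval_conj (a : nat -> C) : radius_ge1 a ->
  forall z, peval (fun j => (a j)^*) z = (peval a (DiskPoint (disk_conj_lt1 z)))^*.
Proof.
move=> ra z; apply: cser_csum.
have h : cser _ _ := peval_power_series ra (DiskPoint (disk_conj_lt1 z)).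
apply: cser_ext (cserJ h) => j; rewrite cjM; congr (_ * _).
elim: j => [|j IH]; first by rewrite !expr0 cj1.
by rewrite !exprS cjM IH cjK.
Qed.

Lemma radius_conj (a : nat -> C) : radius_ge1 a -> radius_ge1 (fun j => (a j)^*).
Proof.
by move=> ra r r1; under eq_fun do rewrite normcJ; exact: ra.
Qed.

(** Conjugating the coefficients replaces the function by the conjugate of its value at the
    conjugate point, so the supremum is preserved. The bound [c + 1] on the modulus comes from the
    bound [c] on its square. *)
Lemma Hinf_symbol (m n : nat) (c : R) (P : nat -> 'M[C]_(n, m)) k i : 0 <= c ->
  (forall K p, N2 (coanalytic P K p) <= c * N2 (truncv K p)) ->
  Hinf (peval (fun j => (P j k i)^*)).
Proof.
move=> c0 Pc; have ra := symbol_radius P Pc k i.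
apply: (@Hinf_peval _ (c + 1)); first exact: radius_conj.
move=> z; rewrite peval_conj // normcJ.
have := symbol_bound c0 Pc k i (DiskPoint (disk_conj_lt1 z)).
set y := peval _ _; have := cnorm_ge0 y; nra.
Qed.

End BoundedAnalytic.

(** * Partial isometries and Parseval's identity *)

Section PartialIsometries.
Variables (R : realType) (m : nat).
Local Notation C := R[i].
Implicit Types (A : 'M[C]_m) (u v w : 'cV[C]_m).

Definition adjmx A : 'M[C]_m := map_mx Num.conj A^T.

Lemma adjmxK A : adjmx (adjmx A) = A.
Proof. by apply/matrixP => i j; rewrite !mxE cjK. Qed.

Lemma adjmxM A B : adjmx (A *m B) = adjmx B *m adjmx A.
Proof.
apply/matrixP => i j; rewrite !mxE cj_sum; apply: eq_bigr => k _.
by rewrite !mxE cjM mulrC.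
Qed.

Lemma dotc_adjmx A u v : dotc (A *m u) v = dotc u (adjmx A *m v).
Proof.
rewrite /dotc; under eq_bigr do rewrite mxE mulr_suml.
rewrite exchange_big; apply: eq_bigr => j _; rewrite mxE cj_sum mulr_sumr.
by apply: eq_bigr => i _; rewrite !mxE cjM cjK; ring.
Qed.

Lemma mx_ext (A B : 'M[C]_m) : (forall w : 'cV[C]_m, A *m w = B *m w) -> A = B.
Proof.
by move=> AB; apply/matrixP => i j; have := AB (delta_mx j ord0);
  rewrite -!colE => /colP/(_ i); rewrite !mxE.
Qed.

Lemma Re_dotc_self v : complex.Re (dotc v v) = sqv v.
Proof. by rewrite dotc_self. Qed.

(* [adjmx A] maps into the initial space of [A], where [A] is isometric;
   this forces [adjmx A] to be a partial isometry with [A^* A A^* = A^*]. *)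
Lemma partial_isometry_adj A : partial_isometry A ->
  adjmx A *m A *m adjmx A = adjmx A.
Proof.
move=> Ai.
have iso w : sqv (A *m (adjmx A *m w)) = sqv (adjmx A *m w).
  apply: (@complexI R); rewrite -!dotc_self; apply: Ai => u Au.
  by rewrite dotc_adjmx adjmxK Au dotc0r.
have ReAA w : complex.Re (dotc (A *m (adjmx A *m w)) w) = sqv (adjmx A *m w).
  by rewrite dotc_adjmx dotc_self.
have contr w : sqv (adjmx A *m w) <= sqv w.
  have := sqv_ge0 (A *m (adjmx A *m w) + (-1) *: w).
  rewrite sqvD dotcZr cjN cj1 mulN1r cReN ReAA iso sqvZ normcN Normc.normc1; lra.
apply: mx_ext => w; rewrite -!mulmxA; set y := adjmx A *m w.
(* [|A^* A y - y|^2 = |A^* A y|^2 + |y|^2 - 2 |A y|^2], where [|A y| = |y|] by [iso] and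
   [|A^* A y| <= |A y|] by [contr]; so it is at most 0. *)
apply/eqP; rewrite -subr_eq0; apply/eqP; apply: sqv_eq0; apply/le_anti.
rewrite sqv_ge0 andbT -scaleN1r.
rewrite sqvD dotcZr cjN cj1 mulN1r cReN sqvZ normcN Normc.normc1.
have := contr (A *m y); rewrite iso -/y.
by rewrite dotc_adjmx adjmxK dotc_self iso -/y /=; lra.
Qed.

Definition initproj A := adjmx A *m A.

Lemma initproj_adj A : adjmx (initproj A) = initproj A.
Proof. by rewrite /initproj adjmxM adjmxK. Qed.

Lemma initproj_idem A : partial_isometry A ->
  initproj A *m initproj A = initproj A.
Proof.
by move=> Ai; rewrite /initproj -{2}(partial_isometry_adj Ai) !mulmxA
  !partial_isometry_adj.
Qed.

Lemma initial_spaceE A v : partial_isometry A ->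
  initial_space A v <-> initproj A *m v = v.
Proof.
move=> Ai; have QQ := initproj_idem Ai.
have AQ : A *m initproj A = A.
  by rewrite -[in RHS](adjmxK A) -(partial_isometry_adj Ai) !adjmxM !adjmxK /initproj !mulmxA.
split=> [Ev|<- u Au]; last first.
  by rewrite dotc_adjmx initproj_adj /initproj -mulmxA Au mulmx0 dotc0r.
apply/esym/eqP; rewrite -subr_eq0; apply/eqP; apply: sqv_eq0.
have Au : A *m (v - initproj A *m v) = 0.
  by rewrite mulmxBr mulmxA AQ subrr.
rewrite -Re_dotc_self {1}(_ : v - initproj A *m v = v + (-1) *: (initproj A *m v)); last first.
  by rewrite scaleN1r.
rewrite dotcDl dotcZl Ev // dotc_adjmx initproj_adj mulmxBr mulmxA QQ subrr dotc0r.
by rewrite mulr0 addr0.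
Qed.

(** Each of the two self-adjoint idempotents fixes the range of the other, and taking adjoints
    identifies them. This makes [A^* A] the same matrix at almost every boundary point. *)
Lemma initproj_unique A B : partial_isometry A -> partial_isometry B ->
  initial_space A = initial_space B -> initproj A = initproj B.
Proof.
move=> Ai Bi AB.
have h X Y : partial_isometry X -> partial_isometry Y ->
    initial_space X = initial_space Y -> initproj X *m initproj Y = initproj Y.
  move=> Xi Yi XY; apply: mx_ext => w; rewrite -mulmxA.
  apply/(initial_spaceE _ Xi); rewrite XY; apply/(initial_spaceE _ Yi).
  by rewrite mulmxA initproj_idem.
rewrite -[LHS]initproj_adj -(h B A Bi Ai (esym AB)) adjmxM !initproj_adj.
exact: h.
Qed.

Lemma sqv_initproj A u : partial_isometry A -> sqv (A *m u) = sqv (initproj A *m u).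
Proof.
move=> Ai; apply: (@complexI R); rewrite -!dotc_self !dotc_adjmx initproj_adj.
by rewrite [in RHS]mulmxA initproj_idem // /initproj mulmxA.
Qed.

End PartialIsometries.

Section Parseval.
Variable R : realType.
Local Notation C := R[i].
Local Notation mu := (@lebesgue_measure R).
Local Notation I := (`[0, 2 * pi]%classic : set R).

Lemma integrable_continuous (f : R -> R) : continuous f ->
  mu.-integrable I (EFin \o f).
Proof.
move=> cf; apply: continuous_compact_integrable; first exact: segment_compact.
by apply: continuous_subspaceT.
Qed.

Lemma pi2_gt0 : 0 < 2 * pi :> R.
Proof. by rewrite mulr_gt0 // pi_gt0. Qed.

Lemma Rintegral_derive (f F : R -> R) : continuous f ->
  (forall t : R, is_derive t (1 : R) F (f t)) ->
  \int[mu]_(t in I) f t = F (2 * pi) - F 0.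
Proof.
move=> cf dF; have cF : continuous F.
  by move=> t; apply/differentiable_continuous/derivable1_diffP; case: (dF t).
rewrite /Rintegral (@continuous_FTC2 _ f F) //.
- exact: pi2_gt0.
- exact: continuous_subspaceT.
- split; first by move=> t _; case: (dF t).
    by apply: cvg_at_right_filter; exact: cF.
  by apply: cvg_at_left_filter; exact: cF.
- by move=> t _; rewrite derive1E; apply: (@derive_val _ _ _ _ _ _ _ (dF t)).
Qed.

Lemma cos_period (k : nat) : cos (k%:R * (2 * pi)) = 1 :> R.
Proof.
have h := periodicn (@cosD2pi R) k 0.
rewrite add0r cos0 in h; rewrite -[RHS]h; congr cos.
by rewrite -[pi *+ 2 *+ k]mulr_natl -[pi *+ 2]mulr_natl.
Qed.

Lemma sin_period (k : nat) : sin (k%:R * (2 * pi)) = 0 :> R.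
Proof.
have h := periodicn (@sinD2pi R) k 0.
rewrite add0r sin0 in h; rewrite -[RHS]h; congr sin.
by rewrite -[pi *+ 2 *+ k]mulr_natl -[pi *+ 2]mulr_natl.
Qed.

Lemma continuous_cosM (k : R) : continuous (fun t : R => cos (k * t)).
Proof.
move=> t; apply: (@continuous_comp _ _ _ (fun t => k * t) cos).
  exact: mulrl_continuous.
exact: continuous_cos.
Qed.

Lemma continuous_sinM (k : R) : continuous (fun t : R => sin (k * t)).
Proof.
move=> t; apply: (@continuous_comp _ _ _ (fun t => k * t) sin).
  exact: mulrl_continuous.
exact: continuous_sin.
Qed.

Lemma Rintegral_cosM (k : nat) : (0 < k)%N ->
  \int[mu]_(t in I) cos (k%:R * t) = 0.
Proof.
move=> k0; have kn0 : k%:R != 0 :> R by rewrite pnatr_eq0 -lt0n.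
have dF (t : R) : is_derive t (1 : R) (fun t => k%:R^-1 * sin (k%:R * t)) (cos (k%:R * t)).
  by apply: is_derive_eq; rewrite /GRing.scale /=; field.
rewrite (Rintegral_derive (@continuous_cosM k%:R) dF).
by rewrite sin_period !mulr0 sin0 mulr0 subrr.
Qed.

Lemma Rintegral_sinM (k : nat) : (0 < k)%N ->
  \int[mu]_(t in I) sin (k%:R * t) = 0.
Proof.
move=> k0; have kn0 : k%:R != 0 :> R by rewrite pnatr_eq0 -lt0n.
have dF (t : R) : is_derive t (1 : R) (fun t => - k%:R^-1 * cos (k%:R * t)) (sin (k%:R * t)).
  by apply: is_derive_eq; rewrite /GRing.scale /=; field.
rewrite (Rintegral_derive (@continuous_sinM k%:R) dF).
by rewrite cos_period !mulr0 cos0 subrr.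
Qed.

Lemma expiX (t : R) n : expi t ^+ n = expi (n%:R * t).
Proof.
elim: n => [|n IH]; first by rewrite expr0 mul0r /expi cos0 sin0.
rewrite exprS IH -natr1 mulrDl mul1r; apply: complex_eqP.
  by rewrite cReM /= cosD; ring.
by rewrite cImM /= sinD; ring.
Qed.

Lemma normc_expi (t : R) : normc (expi t) = 1.
Proof. by rewrite /= cos2Dsin2 sqrtr1. Qed.

Definition trigpoly (b : nat -> C) N (t : R) : C := \sum_(n < N) b n * expi t ^+ n.

Lemma continuous_Re_trigpoly b N : continuous (fun t => complex.Re (trigpoly b N t)).
Proof.
rewrite (_ : (fun t => _) = fun t => \sum_(n < N) (complex.Re (b n) * cos (n%:R * t)
  - complex.Im (b n) * sin (n%:R * t))); last first.
  by apply/funext => t; rewrite /trigpoly cRe_sum; apply: eq_bigr => n _; rewrite cReM expiX.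
move=> t; apply: cvg_big => [|n _]; first exact: add_continuous.
apply: cvgB; apply: cvgM; try exact: cvg_cst; [exact: continuous_cosM|exact: continuous_sinM].
Qed.

Lemma continuous_Im_trigpoly b N : continuous (fun t => complex.Im (trigpoly b N t)).
Proof.
rewrite (_ : (fun t => _) = fun t => \sum_(n < N) (complex.Re (b n) * sin (n%:R * t)
  + complex.Im (b n) * cos (n%:R * t))); last first.
  by apply/funext => t; rewrite /trigpoly cIm_sum; apply: eq_bigr => n _; rewrite cImM expiX.
move=> t; apply: cvg_big => [|n _]; first exact: add_continuous.
apply: cvgD; apply: cvgM; try exact: cvg_cst; [exact: continuous_sinM|exact: continuous_cosM].
Qed.

Lemma continuous_normc_trigpoly b N :
  continuous (fun t => normc (trigpoly b N t) ^+ 2).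
Proof.
under eq_fun do rewrite sqr_normcE !expr2.
move=> t; apply: cvgD; apply: cvgM; try exact: continuous_Re_trigpoly;
  exact: continuous_Im_trigpoly.
Qed.

(** Only frequencies below [N] occur in the first factor, so every product has a positive frequency
    [N - K] and integrates to 0. Continuity is carried along to supply integrability in the
    induction. *)
Lemma Rintegral_trigpoly_orth b (c : C) N K : (K <= N)%N ->
  let f t := complex.Re (trigpoly b K t * (c * expi t ^+ N)^*) in
  continuous f /\ \int[mu]_(t in I) f t = 0.
Proof.
elim: K => [|K IH] KN /=.
  have -> : (fun t => complex.Re (trigpoly b 0 t * (c * expi t ^+ N)^*)) = fun=> 0.
    by apply/funext => t; rewrite /trigpoly big_ord0 mul0r.
  by split; [exact: cst_continuous|rewrite Rintegral_cst // mul0r].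
have [cf If] := IH (ltnW KN).
pose d := b K * c^*.
have -> : (fun t => complex.Re (trigpoly b K.+1 t * (c * expi t ^+ N)^*)) =
   fun t => complex.Re (trigpoly b K t * (c * expi t ^+ N)^*) +
     (complex.Re d * cos ((N - K)%N%:R * t) + complex.Im d * sin ((N - K)%N%:R * t)).
  apply/funext => t; rewrite {1}/trigpoly big_ord_recr /= mulrDl cReD; congr (_ + _).
  rewrite cjM !expiX natrB ?(ltnW KN) // mulrBl cosB sinB /d.
  by rewrite !ReImE /=; ring.
have c1 : continuous (fun t : R => complex.Re d * cos ((N - K)%N%:R * t)).
  by move=> t; apply: cvgM; [exact: cvg_cst|exact: continuous_cosM].
have c2 : continuous (fun t : R => complex.Im d * sin ((N - K)%N%:R * t)).
  by move=> t; apply: cvgM; [exact: cvg_cst|exact: continuous_sinM].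
have c12 : continuous (fun t : R => complex.Re d * cos ((N - K)%N%:R * t) +
    complex.Im d * sin ((N - K)%N%:R * t)).
  by move=> t; apply: cvgD; [exact: c1|exact: c2].
split; first by move=> t; apply: cvgD; [exact: cf|exact: c12].
have mI : measurable I by exact: measurable_itv.
rewrite RintegralD //; try exact: integrable_continuous.
rewrite If add0r RintegralD //; try exact: integrable_continuous.
rewrite !RintegralZl //; try (apply: integrable_continuous;
  first [exact: continuous_cosM|exact: continuous_sinM]).
by rewrite Rintegral_cosM ?Rintegral_sinM ?subn_gt0 // !mulr0 addr0.
Qed.

Lemma parseval_trigpoly b N :
  \int[mu]_(t in I) (normc (trigpoly b N t) ^+ 2) =
  2 * pi * \sum_(n < N) normc (b n) ^+ 2.
Proof.
have mI : measurable I by exact: measurable_itv.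
elim: N => [|N IH].
  have -> : (fun t => normc (trigpoly b 0 t) ^+ 2) = fun=> 0.
    by apply/funext => t; rewrite /trigpoly big_ord0 Normc.normc0 expr0n.
  by rewrite Rintegral_cst // mul0r big_ord0 mulr0.
have [cX IX] := Rintegral_trigpoly_orth b (b N) (leqnn N).
have -> : (fun t => normc (trigpoly b N.+1 t) ^+ 2) = fun t =>
   normc (trigpoly b N t) ^+ 2 + (normc (b N) ^+ 2 +
     2 * complex.Re (trigpoly b N t * (b N * expi t ^+ N)^*)).
  apply/funext => t; have h : normc (b N) = normc (b N * expi t ^+ N).
    by rewrite Normc.normcM normcX normc_expi expr1n mulr1.
  rewrite h {1}/trigpoly big_ord_recr /= -/(trigpoly b N t).
  by rewrite !sqr_normcE !ReImE; ring.
have c2 : continuous (fun t : R => 2 * complex.Re (trigpoly b N t * (b N * expi t ^+ N)^*)).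
  by move=> t; apply: cvgM; [exact: cvg_cst|exact: cX].
have c1 : continuous (fun t : R => normc (b N) ^+ 2) by exact: cst_continuous.
rewrite RintegralD //; try exact: integrable_continuous; first last.
- by apply: integrable_continuous => t; apply: cvgD; [exact: c1|exact: c2].
- by apply: integrable_continuous; exact: continuous_normc_trigpoly.
rewrite IH RintegralD //; try exact: integrable_continuous.
rewrite Rintegral_cst // RintegralZl //; last by apply: integrable_continuous; exact: cX.
rewrite IX mulr0 addr0 big_ord_recr /= [RHS]mulrDr; congr (_ + _).
rewrite lebesgue_measure_itv /= lte_fin pi2_gt0 /= subr0; ring.
Qed.

Lemma dominated_Rintegral (f_ : nat -> R -> R) (f : R -> R) (M : R) :
  (forall n, @measurable_fun _ _ (measurableTypeR R) _ I (EFin \o f_ n)) ->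
  @measurable_fun _ _ (measurableTypeR R) _ I (EFin \o f) ->
  (forall n t, I t -> `|f_ n t| <= M) ->
  {ae mu, forall t, I t -> f_ ^~ t @ \oo --> f t} ->
  (fun n => \int[mu]_(t in I) f_ n t) @ \oo --> \int[mu]_(t in I) f t.
Proof.
move=> mf_ mf fM cf.
have mI : measurable I by exact: measurable_itv.
have iM : mu.-integrable I (EFin \o fun=> M).
  by apply: integrable_continuous; exact: cst_continuous.
have [] := @dominated_convergence _ _ _ mu I mI (fun n => EFin \o f_ n) (EFin \o f)
  (EFin \o fun=> M).
- exact: mf_.
- exact: mf.
- move: cf; apply: filterS; first exact: (ae_filter_ringOfSetsType mu).
  by move=> t h It; apply/cvg_EFin; [exact: nearW|exact: h].
- exact: iM.
- by apply: aeW => t n It; rewrite /= lee_fin; exact: fM.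
move=> If _ h; apply: fine_cvg.
rewrite fineK; first exact: h.
exact: integrable_fin_num.
Qed.

End Parseval.

(** * Boundary values *)

Section RadialLimits.
Variable R : realType.
Local Notation C := R[i].
Local Notation mu := (@lebesgue_measure R).
Local Notation I := (`[0, 2 * pi]%classic : set R).

Lemma cvgCD (u v : nat -> C) (a b : C) :
  (u : nat -> C^o) @ \oo --> (a : C^o) -> (v : nat -> C^o) @ \oo --> (b : C^o) ->
  ((fun n => u n + v n) : nat -> C^o) @ \oo --> (a + b : C^o).
Proof.
move=> /cvgC_ReIm[u1 u2] /cvgC_ReIm[v1 v2]; apply/cvgC_ReIm.
rewrite !ReImE; split.
  rewrite (_ : _ \o _ = fun n => complex.Re (u n) + complex.Re (v n)).
    exact: cvgD.
  by apply/funext => n /=; rewrite ReImE.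
rewrite (_ : _ \o _ = fun n => complex.Im (u n) + complex.Im (v n)).
  exact: cvgD.
by apply/funext => n /=; rewrite ReImE.
Qed.

Lemma cvgCM (u v : nat -> C) (a b : C) :
  (u : nat -> C^o) @ \oo --> (a : C^o) -> (v : nat -> C^o) @ \oo --> (b : C^o) ->
  ((fun n => u n * v n) : nat -> C^o) @ \oo --> (a * b : C^o).
Proof.
move=> /cvgC_ReIm[u1 u2] /cvgC_ReIm[v1 v2]; apply/cvgC_ReIm.
rewrite !ReImE; split.
  rewrite (_ : _ \o _ = fun n => complex.Re (u n) * complex.Re (v n) -
    complex.Im (u n) * complex.Im (v n)).
    by apply: cvgB; exact: cvgM.
  by apply/funext => n /=; rewrite ReImE.
rewrite (_ : _ \o _ = fun n => complex.Re (u n) * complex.Im (v n) +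
  complex.Im (u n) * complex.Re (v n)).
  by apply: cvgD; exact: cvgM.
by apply/funext => n /=; rewrite ReImE.
Qed.

Lemma cvgC_cst (a : C) : ((fun=> a) : nat -> C^o) @ \oo --> (a : C^o).
Proof. exact: cvg_cst. Qed.

Lemma cvgC_sum (J : Type) (r : seq J) (u : J -> nat -> C) (a : J -> C) :
  (forall j, (u j : nat -> C^o) @ \oo --> (a j : C^o)) ->
  ((fun n => \sum_(j <- r) u j n) : nat -> C^o) @ \oo --> (\sum_(j <- r) a j : C^o).
Proof.
move=> h; elim: r => [|j r IH].
  rewrite big_nil (_ : (fun n => _) = fun=> 0); first exact: cvgC_cst.
  by apply/funext => n; rewrite big_nil.
rewrite big_cons (_ : (fun n => _) = fun n => u j n + \sum_(j' <- r) u j' n).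
  exact: (cvgCD (h j) IH).
by apply/funext => n; rewrite big_cons.
Qed.

Lemma cvgC_exp (u : nat -> C) (a : C) k :
  (u : nat -> C^o) @ \oo --> (a : C^o) ->
  ((fun n => u n ^+ k) : nat -> C^o) @ \oo --> (a ^+ k : C^o).
Proof.
move=> h; elim: k => [|k IH].
  by rewrite expr0; under eq_fun do rewrite expr0; exact: cvgC_cst.
by rewrite exprS; under eq_fun do rewrite exprS; exact: (cvgCM h IH).
Qed.

Lemma cvg_sqv0 (n : nat) (f : nat -> 'cV[C]_n) (a : 'cV[C]_n) :
  (forall i, ((fun l => f l i ord0) : nat -> C^o) @ \oo --> (a i ord0 : C^o)) ->
  (fun l => sqv (f l)) @ \oo --> sqv a.
Proof.
move=> h; rewrite -[a]subr0; under eq_fun do rewrite -[f _]subr0.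
by apply: cvg_sqv => i; have /cvgC_ReIm[h1 h2] := h i.
Qed.

(** Parseval's identity on the circle of radius [r]. The partial sums are trigonometric polynomials
    uniformly bounded by the sum of [|a n| r^n], so dominated convergence applies, and measurability
    is inherited from the pointwise limit. *)
Lemma parseval_radius (a : nat -> C) (r : R) (F : R -> C) : radius_ge1 a ->
  0 <= r < 1 ->
  (forall t, cser (fun n => a n * (r%:C%C * expi t) ^+ n) (F t)) ->
  @measurable_fun _ _ (measurableTypeR R) _ I (EFin \o (fun t => normc (F t) ^+ 2)) /\
  series (fun n => normc (a n) ^+ 2 * (r ^+ 2) ^+ n) @ \oo -->
    (2 * pi)^-1 * \int[mu]_(t in I) (normc (F t) ^+ 2).
Proof.
move=> ra r01 cF; have /andP[r0 r1] := r01.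
pose b n := a n * r%:C%C ^+ n.
have nb n : normc (b n) = normc (a n) * r ^+ n.
  by rewrite /b Normc.normcM normcX normc_real ger0_norm.
have sb : cvgn (series (fun n => normc (b n))).
  by under eq_fun do rewrite nb; exact: ra.
have trigE N t : trigpoly b N t = series (fun n => a n * (r%:C%C * expi t) ^+ n) N.
  rewrite /series /= big_mkord; apply: eq_bigr => n _.
  by rewrite /b exprMn mulrA.
have cN t : (fun N => normc (trigpoly b N t) ^+ 2) @ \oo --> normc (F t) ^+ 2.
  rewrite sqr_normcE; under eq_fun do rewrite sqr_normcE trigE.
  have /cvgC_ReIm[h1 h2] := cF t.
  by apply: cvgD; rewrite expr2; exact: cvgM.
have mN N : @measurable_fun _ _ (measurableTypeR R) _ I
    (EFin \o (fun t => normc (trigpoly b N t) ^+ 2)).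
  apply: (@measurable_int _ _ _ mu); apply: integrable_continuous.
  exact: continuous_normc_trigpoly.
have mF : @measurable_fun _ _ (measurableTypeR R) _ I
    (EFin \o (fun t => normc (F t) ^+ 2)).
  apply: (@emeasurable_fun_cvg _ (measurableTypeR R) R I
    (fun N => EFin \o (fun t => normc (trigpoly b N t) ^+ 2)) _ mN) => t It.
  by apply/cvg_EFin; [exact: nearW|exact: cN].
split=> //.
have := @dominated_Rintegral R (fun N t => normc (trigpoly b N t) ^+ 2)
  (fun t => normc (F t) ^+ 2) (rsum (fun n => normc (b n)) ^+ 2) mN mF.
have h1 N t : I t -> `|normc (trigpoly b N t) ^+ 2| <= rsum (fun n => normc (b n)) ^+ 2.
  move=> It; rewrite ger0_norm ?sqr_ge0 // lerXn2r ?nnegrE ?cnorm_ge0 //.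
    by apply: rsum_ge0 => // n; exact: cnorm_ge0.
  rewrite /trigpoly; apply: le_trans (le_normc_sum _ _ _) _.
  under eq_bigr do rewrite Normc.normcM normcX normc_expi expr1n mulr1.
  rewrite -(big_mkord xpredT (fun n => normc (b n))).
  by apply: (series_le_rsum N _ sb) => n; exact: cnorm_ge0.
move=> /(_ h1) h.
have {}h : (fun n => \int[mu]_(t in I) (normc (trigpoly b n t) ^+ 2)) @ \oo -->
   \int[mu]_(t in I) (normc (F t) ^+ 2).
  by apply: h; apply: aeW => t It; exact: cN.
rewrite (_ : series _ = fun N => (2 * pi)^-1 *
   \int[mu]_(t in I) (normc (trigpoly b N t) ^+ 2)).
  by apply: cvgM => //; exact: cvg_cst.
apply/funext => N; rewrite parseval_trigpoly mulrA mulVf ?mul1r; last first.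
  by rewrite gt_eqF // pi2_gt0.
rewrite /series /= big_mkord; apply: eq_bigr => n _.
by rewrite nb [RHS]exprMn -!exprM mulnC.
Qed.

(** The converse of Abel's theorem for nonnegative terms: a fixed partial sum is the limit of
    partial sums at [r k], hence at most [S]; and each [s k] is at most the full sum. *)
Lemma abel_nonneg (c : nat -> R) (r s : nat -> R) (S : R) :
  (forall n, 0 <= c n) -> (forall k, 0 <= r k <= 1) -> r @ \oo --> (1 : R) ->
  (forall k, series (fun n => c n * r k ^+ n) @ \oo --> s k) ->
  s @ \oo --> S -> series c @ \oo --> S.
Proof.
move=> c0 r01 r1 cs cS.
have t0 k n : 0 <= c n * r k ^+ n.
  by rewrite mulr_ge0 // exprn_ge0 //; case/andP: (r01 k).
have partial N : series c N <= S.
  have h : (fun k => \sum_(0 <= n < N) c n * r k ^+ n) @ \oo --> series c N.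
    rewrite /series /= (_ : \sum_(0 <= n < N) c n = \sum_(0 <= n < N) c n * 1 ^+ n).
      apply: cvg_big => [|n _]; first exact: add_continuous.
      apply: cvgM; first exact: cvg_cst.
      elim: n => [|n IH]; first by under eq_fun do rewrite expr0; exact: cvg_cst.
      by under eq_fun do rewrite exprS; rewrite exprS; exact: cvgM.
    by apply: eq_bigr => n _; rewrite expr1n mulr1.
  apply: (ler_cvg_to h cS); near=> k.
  have := @series_le_rsum _ (fun n => c n * r k ^+ n) N (t0 k).
  by rewrite /rsum (cvg_lim (@Rhausdorff R) (cs k)); apply; exact: cs.
have cc : cvgn (series c) by exact: summable_ub partial.
have h1 : rsum c <= S by exact: rsum_le_ub.
have h2 : S <= rsum c.
  rewrite -(cvg_lim (@Rhausdorff R) cS); apply: limr_le; first exact: cvgP cS.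
  near=> k; rewrite -(cvg_lim (@Rhausdorff R) (cs k)).
  apply: (@rsum_le _ (fun n => c n * r k ^+ n)) => //; last exact: cvgP (cs k).
  by move=> n; rewrite ler_piMr // exprn_ile1 //; case/andP: (r01 k).
by rewrite (_ : S = rsum c) //; apply/le_anti; rewrite h1 h2.
Unshelve. all: by end_near. Qed.

Definition rad (k : nat) : R := 1 - k.+2%:R^-1.

Lemma rad_ge0 k : 0 <= rad k.
Proof. by rewrite subr_ge0 invf_le1 // ler1n. Qed.

Lemma rad_lt1 k : rad k < 1.
Proof. by rewrite ltrBlDr ltrDl invr_gt0. Qed.

Lemma rad_cvg1 : rad @ \oo --> (1 : R).
Proof.
rewrite -[X in _ --> X]subr0; apply: cvgB; first exact: cvg_cst.
have := @cvg_harmonic R; rewrite -[X in X -> _]cvg_shiftS.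
exact.
Qed.

Lemma radial_lt1 k t : normc ((rad k)%:C%C * expi t) < 1.
Proof.
by rewrite Normc.normcM normc_expi mulr1 normc_real ger0_norm ?rad_ge0 ?rad_lt1.
Qed.

Definition radial k t : disk R := DiskPoint (radial_lt1 k t).

Lemma radial_cvg t : ((fun k => val (radial k t)) : nat -> C^o) @ \oo --> (expi t : C^o).
Proof.
have -> : (fun k => val (radial k t)) = fun k => (rad k)%:C%C * expi t by [].
rewrite -[X in _ --> (X : C^o)]mul1r; apply: cvgCM; last exact: cvgC_cst.
by apply/cvgC_ReIm; split; [exact: rad_cvg1|exact: cvg_cst].
Qed.

Arguments radial_cvg : clear implicits.

Lemma nt_lim_radial (f : disk R -> C) t w : nt_lim f (expi t) w ->
  ((fun k => f (radial k t)) : nat -> C^o) @ \oo --> (w : C^o).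
Proof.
move=> fw; apply/cvgC_seqP => e e0.
(* On a radius [|z - zeta| = 1 - |z|], so the Stolz region of aperture 2 contains it. *)
have [d d0 hd] := fw 2 e e0.
have /cvgC_seqP/(_ d d0)[N hN] := radial_cvg t.
exists N => k Nk; rewrite normcB; apply: hd; last by rewrite normcB; exact: hN.
have -> : val (radial k t) - expi t = (rad k - 1)%:C%C * expi t.
  by rewrite rmorphB rmorph1 mulrBl mul1r.
rewrite Normc.normcM normc_expi mulr1 normc_real.
have -> : normc (val (radial k t)) = rad k.
  have -> : val (radial k t) = (rad k)%:C%C * expi t by [].
  by rewrite Normc.normcM normc_expi mulr1 normc_real ger0_norm ?rad_ge0.
rewrite ler0_norm; have := rad_lt1 k; lra.
Qed.

Variable m : nat.

(** Means of [|F|^2] over circles of radius [rad k] are Abel sums of [sqv (f n)]. As [F] is bounded,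
    they converge to the mean of the boundary norms, which is that of the trigonometric polynomial;
    Parseval evaluates it. *)
Lemma boundary_norm (f g : nat -> 'cV[C]_m) (F : 'I_m -> disk R -> C) N :
  (forall i, power_series_on_disk (F i) (fun n => f n i ord0)) ->
  (forall i, Hinf (F i)) ->
  {ae mu, forall t, I t ->
    exists2 G : 'cV[C]_m,
      forall i, ((fun k => F i (radial k t)) : nat -> C^o) @ \oo --> (G i ord0 : C^o) &
      sqv G = sqv (\col_i trigpoly (fun n => g n i ord0) N t)} ->
  l2 f /\ N2 f = \sum_(n < N) sqv (g n).
Proof.
move=> fF FH FG.
have mI : measurable I by exact: measurable_itv.
pose phi k t := \sum_i normc (F i (radial k t)) ^+ 2.
pose psi t := \sum_i normc (trigpoly (fun n => g n i ord0) N t) ^+ 2.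
have cpsi : continuous psi.
  move=> t; apply: cvg_big => [|i _]; first exact: add_continuous.
  exact: continuous_normc_trigpoly.
have rad01 k : 0 <= rad k < 1 by rewrite rad_ge0 rad_lt1.
have par k i := parseval_radius (power_series_radius (fF i)) (rad01 k)
  (fun t => fF i (radial k t)).
have [M FM] : exists M : R, forall i z, normc (F i z) <= M.
  have /choice[B hB] : forall i, exists B, forall z, normc (F i z) <= B.
    by move=> i; case: (FH i).
  exists (\sum_i `|B i|) => i z; apply: le_trans (hB i z) _.
  apply: le_trans (ler_norm _) _; rewrite (bigD1 i) //= lerDl.
  by apply: sumr_ge0.
have phi_le k t : `|phi k t| <= M ^+ 2 *+ m.
  rewrite ger0_norm; last by apply: sumr_ge0 => i _; rewrite sqr_ge0.
  apply: (@le_trans _ _ (\sum_(i < m) M ^+ 2)); last by rewrite sumr_const card_ord.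
  apply: ler_sum => i _; rewrite lerXn2r ?nnegrE ?cnorm_ge0 //.
  exact: le_trans (cnorm_ge0 _) (FM i (radial k t)).
have mphi k : @measurable_fun _ _ (measurableTypeR R) _ I (EFin \o phi k).
  rewrite (_ : EFin \o phi k = fun t => \sum_(i <- index_enum 'I_m)
    (normc (F i (radial k t)) ^+ 2)%:E)%E.
    by apply: emeasurable_sum => i; exact: (par k i).1.
  by apply/funext => t /=; rewrite sumEFin.
have iF k i : mu.-integrable I (EFin \o (fun t => normc (F i (radial k t)) ^+ 2)).
  apply: (@le_integrable _ _ _ mu _ mI _ (EFin \o fun=> M ^+ 2)).
  - exact: (par k i).1.
  - move=> t It; rewrite /= lee_fin !ger0_norm ?sqr_ge0 // lerXn2r ?nnegrE ?cnorm_ge0 //.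
    exact: le_trans (cnorm_ge0 _) (FM i (radial k t)).
  - by apply: integrable_continuous; exact: cst_continuous.
have Rsum (J : Type) (r : seq J) (h : J -> R -> R) :
    (forall j, mu.-integrable I (EFin \o h j)) ->
    mu.-integrable I (EFin \o (fun t => \sum_(j <- r) h j t)) /\
    \int[mu]_(t in I) (\sum_(j <- r) h j t) = \sum_(j <- r) \int[mu]_(t in I) h j t.
  move=> ih; elim: r => [|j r [IH1 IH2]].
    have -> : (fun t => \sum_(j <- [::]) h j t) = fun=> 0.
      by apply/funext => t; rewrite big_nil.
    split; first by apply: integrable_continuous; exact: cst_continuous.
    by rewrite big_nil Rintegral_cst // mul0r.
  have -> : (fun t => \sum_(j0 <- (j :: r)) h j0 t) =
      fun t => h j t + \sum_(j <- r) h j t.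
    by apply/funext => t; rewrite big_cons.
  split; last by rewrite RintegralD // IH2 big_cons.
  have -> : EFin \o (fun t => h j t + \sum_(j <- r) h j t) =
     ((EFin \o h j) \+ (EFin \o (fun t => (\sum_(j <- r) h j t)%R)))%E by [].
  exact: integrableD.
have cint : (fun k => \int[mu]_(t in I) phi k t) @ \oo --> \int[mu]_(t in I) psi t.
  apply: (@dominated_Rintegral R phi psi (M ^+ 2 *+ m)) => //.
    by apply: (@measurable_int _ _ _ mu); exact: integrable_continuous.
  move: FG; apply: filterS; first exact: (ae_filter_ringOfSetsType mu).
  move=> t h It; have [G FG sG] := h It.
  have -> : psi t = sqv G.
    by rewrite sG; apply: eq_bigr => i _; rewrite mxE.
  have -> : phi ^~ t = fun k => sqv (\col_i F i (radial k t)).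
    by apply/funext => k; apply: eq_bigr => i _; rewrite mxE.
  by apply: cvg_sqv0 => i; under eq_fun do rewrite mxE; exact: FG.
have psiE : \int[mu]_(t in I) psi t = 2 * pi * \sum_(n < N) sqv (g n).
  rewrite /psi (Rsum _ _ _ _).2; last first.
    by move=> i; apply: integrable_continuous; exact: continuous_normc_trigpoly.
  under eq_bigr do rewrite parseval_trigpoly.
  by rewrite -mulr_sumr exchange_big.
have S_cvg : series (fun n => sqv (f n)) @ \oo --> \sum_(n < N) sqv (g n).
  apply: (@abel_nonneg _ (fun k => rad k ^+ 2)
    (fun k => (2 * pi)^-1 * \int[mu]_(t in I) phi k t)).
  - by move=> n; exact: sqv_ge0.
  - move=> k; rewrite sqr_ge0 /= expr_le1 ?rad_ge0 //.
    exact: ltW (rad_lt1 k).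
  - rewrite -[X in _ --> X](expr1n R 2) expr2; under eq_fun do rewrite expr2.
    by apply: cvgM; exact: rad_cvg1.
  - move=> k; rewrite /phi (Rsum _ _ _ (iF k)).2 mulr_sumr.
    rewrite (_ : series _ = fun K => \sum_i
      series (fun n => normc (f n i ord0) ^+ 2 * (rad k ^+ 2) ^+ n) K).
      apply: cvg_big => [|i _]; first exact: add_continuous.
      exact: (par k i).2.
    apply/funext => K; rewrite /series /= exchange_big; apply: eq_bigr => n _.
    by rewrite /sqv mulr_suml.
  - have -> : \sum_(n < N) sqv (g n) = (2 * pi)^-1 * \int[mu]_(t in I) psi t.
      by rewrite psiE mulrA mulVf ?mul1r // gt_eqF // pi2_gt0.
    by apply: cvgM => //; exact: cvg_cst.
split; first exact: cvgP S_cvg.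
exact: (cvg_lim (@Rhausdorff R) S_cvg).
Qed.

End RadialLimits.

Arguments radial_cvg {R} t.

(** * Partially isometric analytic Toeplitz operators *)

Section PartiallyIsometricToeplitz.
Variables (R : realType) (m : nat).
Local Notation C := R[i].
Local Notation seqv := (nat -> 'cV[C]_m).
Variable Th : nat -> 'M[C]_m.

(** The analytic Toeplitz operator [T_Theta] on coefficient sequences. *)
Definition mconv (f : seqv) : seqv := fun n => \sum_(i < n.+1) Th i *m f (n - i)%N.

Lemma mconvP a f g : mconv (a *: f + g) = a *: mconv f + mconv g.
Proof.
apply/funext => n; rewrite !fctE /mconv scaler_sumr -big_split /=.
by apply: eq_bigr => i _; rewrite mulmxDr scalemxAr.
Qed.

Lemma mconv0 : mconv 0 = 0.
Proof. by apply/funext => n; rewrite /mconv big1 // => i _; rewrite mulmx0. Qed.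

Lemma mconvD f g : mconv (f + g) = mconv f + mconv g.
Proof. by have := mconvP 1 f g; rewrite !scale1r. Qed.

Lemma mconv_cons f : mconv (consv 0 f) = consv 0 (mconv f).
Proof.
apply/funext => -[|n]; first by rewrite /mconv big_ord1 mulmx0.
rewrite /mconv big_ord_recr /= subnn mulmx0 addr0.
by apply: eq_bigr => i _; rewrite subSn // -ltnS.
Qed.

Lemma consv_monov l (u : 'cV[C]_m) : consv 0 (monov l u) = monov l.+1 u.
Proof. by apply/funext => -[|n]. Qed.

Lemma mconv_monov l (u : 'cV[C]_m) n :
  mconv (monov l u) n = if (l <= n)%N then Th (n - l)%N *m u else 0.
Proof.
rewrite /mconv; case: leqP => ln; last first.
  rewrite big1 // => i _; rewrite /monov ltn_eqF ?mulmx0 //.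
  exact: leq_ltn_trans (leq_subr _ _) ln.
have h : (n - l < n.+1)%N by rewrite ltnS leq_subr.
rewrite (bigD1 (Ordinal h)) //= /monov subKn // eqxx big1 ?addr0 // => i ih.
case: eqP => [e|_]; last by rewrite mulmx0.
case/eqP: ih; apply: val_inj => /=; have := ltn_ord i; lia.
Qed.

Lemma mconv_truncv f N n : (n < N)%N -> mconv (truncv N f) n = mconv f n.
Proof.
move=> nN; apply: eq_bigr => i _; rewrite /truncv.
by rewrite (leq_ltn_trans (leq_subr _ _) nN).
Qed.

Lemma monov_trunc l (u : 'cV[C]_m) : truncv l.+1 (monov l u) = monov l u.
Proof.
apply/funext => n; rewrite /truncv /monov; case: (eqVneq n l) => [->|_].
  by rewrite ltnSn.
by rewrite if_same.
Qed.

(** [Q] stands for the projection onto the common initial space of the boundary values, and [Th_iso]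
    is the content of rigidity on polynomials. *)
Variable Q : 'M[C]_m.
Hypothesis QQ : Q *m Q = Q.
Hypothesis Qadj : adjmx Q = Q.
Hypothesis Th_iso : forall N p, l2 (mconv (truncv N p)) /\
  N2 (mconv (truncv N p)) = \sum_(n < N) sqv (Q *m p n).

Lemma sqv_proj_le (u : 'cV[C]_m) : sqv (Q *m u) <= sqv u.
Proof.
have := sqv_ge0 (u + (-1) *: (Q *m u)).
rewrite sqvD dotcZr cjN cj1 mulN1r cReN sqvZ normcN Normc.normc1.
have -> : dotc u (Q *m u) = (sqv (Q *m u))%:C%C.
  by rewrite -dotc_self dotc_adjmx Qadj mulmxA QQ.
rewrite /=; lra.
Qed.

Definition Qs (f : seqv) : seqv := fun n => Q *m f n.

Lemma l2_Qs f : l2 f -> l2 (Qs f).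
Proof.
move=> lf; apply: series_le_cvg lf => n; [exact: sqv_ge0|exact: sqv_ge0|].
exact: sqv_proj_le.
Qed.

Lemma N2_Qs_le f : l2 f -> N2 (Qs f) <= N2 f.
Proof.
move=> lf; apply: rsum_le => //; [by move=> n; exact: sqv_proj_le|exact: l2_Qs].
Qed.

(** Coefficients of [mconv f] below [N] depend only on those of [f] below [N], so each partial sum
    is bounded by means of the truncation. *)
Lemma mconv_le f : l2 f -> l2 (mconv f) /\ N2 (mconv f) <= N2 (Qs f).
Proof.
move=> lf; apply: N2_le_ub => N.
have [l1 h1] := Th_iso N f.
apply: (@le_trans _ _ (\sum_(i < N) sqv (mconv (truncv N f) i))).
  by apply: ler_sum => i _; rewrite mconv_truncv.
apply: le_trans (partial_le_N2 N l1) _; rewrite h1.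
exact: (partial_le_N2 N (l2_Qs lf)).
Qed.

Lemma l2_mconv f : l2 f -> l2 (mconv f).
Proof. by case/mconv_le. Qed.

Lemma N2_mconv_le f : l2 f -> N2 (mconv f) <= N2 f.
Proof. by move=> lf; apply: le_trans (N2_Qs_le lf); case: (mconv_le lf). Qed.

Lemma QsP a f g : Qs (a *: f + g) = a *: Qs f + Qs g.
Proof. by apply/funext => n; rewrite !fctE /Qs mulmxDr scalemxAr. Qed.

Lemma N2_Qs_truncv N f : N2 (Qs (truncv N f)) = \sum_(n < N) sqv (Q *m f n).
Proof.
rewrite (@N2_fin _ _ _ N).
  by apply: eq_bigr => n _; rewrite /Qs /truncv ltn_ord.
by move=> n Nn; rewrite /Qs /truncv ltnNge Nn mulmx0.
Qed.

(* The form [N2 (Qs f) - N2 (mconv f)] is positive and vanishes on polynomials,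
   hence so does its polarization as soon as one argument is a polynomial. *)
Lemma mconv_polar f N p : l2 f ->
  ips (mconv f) (mconv (truncv N p)) = ips (Qs f) (Qs (truncv N p)).
Proof.
move=> lf; set g := truncv N p.
have lg : l2 g by exact: l2_truncv.
have lTf := l2_mconv lf; have lTg := l2_mconv lg.
have lQf := l2_Qs lf; have lQg := l2_Qs lg.
have gE : N2 (mconv g) = N2 (Qs g) by rewrite (Th_iso N p).2 N2_Qs_truncv.
set z := ips (Qs g) (Qs f) - ips (mconv g) (mconv f).
have h (s : R) : 0 <= N2 (Qs f) - N2 (mconv f) - 2 * s * normc z ^+ 2.
  (* Adding [t g] to [f] changes the difference of the two forms linearly in [s], the terms in
     [|t|^2] cancelling by [gE]; a large [s] would violate positivity unless [z = 0]. *)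
  pose t := - (s%:C%C * z^*).
  have := (mconv_le (l2D (l2Z t lg) lf)).2.
  rewrite mconvP QsP !N2D ?N2Z ?ipsZl ?gE //; try exact: l2Z.
  have tz : complex.Re (t * z) = - s * normc z ^+ 2.
    by rewrite /t sqr_normcE !ReImE /=; ring.
  have : complex.Re (t * z) = complex.Re (t * ips (Qs g) (Qs f)) -
      complex.Re (t * ips (mconv g) (mconv f)).
    by rewrite /z mulrBr cReD cReN.
  by rewrite tz; lra.
have z0 : z = 0.
  apply/eqP; rewrite -normc_eq0 -sqrf_eq0; apply: contraT => nz.
  have z2 : 0 < normc z ^+ 2 by rewrite lt_def nz sqr_ge0.
  have := h ((N2 (Qs f) - N2 (mconv f) + 1) / normc z ^+ 2).
  rewrite -mulrA -mulrA mulVf // mulr1.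
  have := h 0; lra.
move/eqP: z0; rewrite subr_eq0 => /eqP/(congr1 Num.conj).
by rewrite !ips_conj.
Qed.

(* The adjoint of [mconv]. *)
Definition Tst (f : seqv) : seqv :=
  fun l => \col_i ips f (mconv (monov l (delta_mx i ord0))).

Lemma ips_mconv_monov f l (u : 'cV[C]_m) : l2 f ->
  ips f (mconv (monov l u)) = dotc (Tst f l) u.
Proof.
move=> lf; rewrite [u in LHS]matrix_sum_delta exchange_big big_ord1.
have -> : mconv (monov l (\sum_i u i ord0 *: delta_mx i ord0)) =
    \sum_i u i ord0 *: mconv (monov l (delta_mx i ord0)).
  elim: (index_enum _) => [|i r IH].
    rewrite !big_nil (_ : monov l 0 = 0) ?mconv0 //.
    by apply/funext => n; rewrite /monov if_same.
  rewrite !big_cons -IH -mconvP; congr mconv; apply/funext => n.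
  by rewrite !fctE /monov; case: eqP => // _; rewrite scaler0 addr0.
have h (r : seq 'I_m) : l2 (\sum_(i <- r) u i ord0 *: mconv (monov l (delta_mx i ord0))) /\
   ips f (\sum_(i <- r) u i ord0 *: mconv (monov l (delta_mx i ord0))) =
   \sum_(i <- r) (u i ord0)^* * ips f (mconv (monov l (delta_mx i ord0))).
  have lm i : l2 (mconv (monov l (delta_mx i ord0))) by apply: l2_mconv; exact: l2_monov.
  elim: r => [|i r [IH1 IH2]]; first by rewrite !big_nil ips0r; split => //; exact: l20.
  rewrite !big_cons; have lZ := l2Z (u i ord0) (lm i).
  by split; [exact: l2D|rewrite ipsDr // ipsZr // IH2].
rewrite (h _).2 /dotc; apply: eq_bigr => i _; rewrite mxE; exact: mulrC.
Qed.

Lemma ips_mconv_truncv f N p : l2 f ->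
  ips f (mconv (truncv N p)) = \sum_(n < N) dotc (Tst f n) (p n).
Proof.
move=> lf; elim: N => [|N IH].
  rewrite big_ord0 (_ : truncv 0 p = 0) ?mconv0 ?ips0r //.
have -> : truncv N.+1 p = truncv N p + monov N (p N).
  apply/funext => n; rewrite !fctE /truncv /monov ltnS leq_eqVlt.
  by case: (ltngtP n N) => [||->]; rewrite ?addr0 ?add0r.
rewrite mconvD ipsDr //; first by rewrite IH ips_mconv_monov // big_ord_recr.
  by apply: l2_mconv; exact: l2_truncv.
by apply: l2_mconv; exact: l2_monov.
Qed.

(** Pairing [f] with the image of the truncation of [Tst f] gives the partial sum [X], and
    Cauchy-Schwarz gives [X^2 <= N2 f * X]. *)
Lemma Tst_le f : l2 f -> l2 (Tst f) /\ N2 (Tst f) <= N2 f.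
Proof.
move=> lf; apply: N2_le_ub => N; set X := \sum_(i < N) _.
have X0 : 0 <= X by apply: sumr_ge0 => i _; exact: sqv_ge0.
have lT := l2_mconv (l2_truncv N (Tst f)).
have := normc_ips_le lf lT; rewrite ips_mconv_truncv //.
have -> : \sum_(n < N) dotc (Tst f n) (Tst f n) = X%:C%C.
  by rewrite rmorph_sum; apply: eq_bigr => i _; rewrite dotc_self.
rewrite normc_real ger0_norm // => h.
have h2 : N2 (mconv (truncv N (Tst f))) <= X.
  rewrite (Th_iso N _).2; apply: ler_sum => i _; exact: sqv_proj_le.
have := N2_ge0 lf; move: X0; rewrite le_eqVlt => /orP[/eqP <- //|X0] f0.
rewrite -(ler_pM2r X0) -expr2; apply: le_trans h _; exact: ler_wpM2l.
Qed.

Lemma l2_Tst f : l2 f -> l2 (Tst f).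
Proof. by case/Tst_le. Qed.

Lemma TstP a f g : l2 f -> l2 g -> Tst (a *: f + g) = a *: Tst f + Tst g.
Proof.
move=> lf lg; apply/funext => l; apply/colP => i; rewrite !fctE !mxE.
have lm := l2_mconv (@l2_monov _ _ l (delta_mx i ord0)).
by rewrite ipsDl ?ipsZl //; exact: l2Z.
Qed.

Lemma Tst_bshift f : l2 f -> Tst (bshift f) = bshift (Tst f).
Proof.
move=> lf; apply/funext => l; apply/colP => i; rewrite /bshift [LHS]mxE [RHS]mxE.
rewrite -consv_monov mconv_cons ips_consv ?dotc0r ?add0r //.
by apply: l2_mconv; exact: l2_monov.
Qed.

Lemma Tst_ker_orth a b : l2 a -> l2 b -> Tst a = 0 -> ips a (mconv b) = 0.
Proof.
move=> la lb a0; apply/eqP; rewrite -normc_eq0 -sqrf_eq0 eq_le sqr_ge0 andbT.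
apply/ler_addgt0Pr => e e0; rewrite add0r.
have e1 : 0 < e / (N2 a + 1) by rewrite divr_gt0 // ltr_wpDl // N2_ge0.
have [N hN] := N2_truncv_cvg lb e1.
have lt := l2_truncv N b; have lr := l2B lb lt.
have -> : ips a (mconv b) = ips a (mconv (b - truncv N b)).
  have e0' : ips a (mconv (truncv N b)) = 0.
    by rewrite ips_mconv_truncv // big1 // => n _; rewrite a0; exact: dotc0l.
  rewrite -[b in LHS](subrK (truncv N b)) (mconvD (b - truncv N b)) ipsDr ?e0' ?addr0 //;
    exact: l2_mconv.
apply: le_trans (normc_ips_le la (l2_mconv lr)) _.
apply: (@le_trans _ _ (N2 a * (e / (N2 a + 1)))).
  apply: ler_wpM2l; first exact: N2_ge0.
  by apply: le_trans (N2_mconv_le lr) _; exact: ltW.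
have := N2_ge0 la => a1.
by rewrite mulrA ler_pdivrMr ?ltr_wpDl //; nra.
Qed.

(* [mconv] is a partial isometry: the projection onto its range is
   [mconv \o Tst], and [Tst] vanishes on the complement. *)
Lemma Tst_mconv_Tst f : l2 f -> Tst (mconv (Tst f)) = Tst f.
Proof.
move=> lf; have lT := l2_Tst lf.
apply/funext => l; apply/colP => i; rewrite [LHS]mxE.
rewrite -[monov l _]monov_trunc mconv_polar // monov_trunc.
have -> : Qs (monov l (delta_mx i ord0)) = monov l (Q *m delta_mx i ord0).
  by apply/funext => n; rewrite /Qs /monov; case: eqP; rewrite ?mulmx0.
rewrite ips_monov /Qs dotc_adjmx Qadj mulmxA QQ -ips_mconv_monov //.
rewrite [in RHS]mxE; apply/eqP; rewrite -subr_eq0; apply/eqP.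
have lm u : l2 (mconv (monov l u)) by apply: l2_mconv; exact: l2_monov.
set d := delta_mx i ord0.
(* [d - Q d] is killed by [Q], so [Th_iso] makes [mconv] vanish on the corresponding monomial and
   [Q d] may be replaced by [d]. *)
have -> : monov l (Q *m d) = (-1) *: monov l (d - Q *m d) + monov l d.
  apply/funext => n; rewrite !fctE /monov; case: eqP; rewrite ?scaler0 ?addr0 //.
  by move=> _; rewrite scaleN1r opprB subrK.
have -> : mconv ((-1) *: monov l (d - Q *m d) + monov l d) = mconv (monov l d).
  rewrite mconvP (_ : mconv (monov l (d - Q *m d)) = 0) ?scaler0 ?add0r //.
  apply: N2_eq0 => //; rewrite -monov_trunc (Th_iso _ _).2 big1 // => n _.
  rewrite /monov; case: eqP; rewrite ?mulmx0 ?sqv0 // => _.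
  by rewrite mulmxBr mulmxA QQ subrr sqv0.
by rewrite subrr.
Qed.

Lemma Tst_truncv N p :
  Tst (truncv N p) = coanalytic (fun j => adjmx (Th j)) N p.
Proof.
apply/funext => l; apply/colP => i; rewrite mxE.
have lm := l2_mconv (@l2_monov _ _ l (delta_mx i ord0)).
rewrite -ips_conj //; last exact: l2_truncv.
rewrite (@ips_fin _ _ _ _ N); last by move=> n Nn; rewrite /truncv ltnNge Nn.
rewrite cj_sum /coanalytic summxE [RHS]big_mkcond; apply: eq_bigr => n _.
rewrite dotc_conj /truncv ltn_ord mconv_monov; case: leqP => ln; last exact: dotc0r.
by rewrite -{1}(adjmxK (Th _)) -dotc_adjmx dotc_delta.
Qed.

End PartiallyIsometricToeplitz.

(** * Taylor coefficients *)

Lemma mulr_le_sqrD (R : realType) (x y : R) : x * y <= x ^+ 2 + y ^+ 2.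
Proof. have := sqr_ge0 (x - y); nra. Qed.

Section HardyCoefficients.
Variables (R : realType) (m : nat).
Local Notation C := R[i].
Local Notation seqv := (nat -> 'cV[C]_m).
Local Notation hvec := 'cV[disk R -> C]_m.
Implicit Types (F G : hvec) (a : seqv).

Definition vcoef F : seqv := fun n => \col_i taylor_coef (F i ord0) n.

Lemma vcoef_coord F n i : vcoef F n i ord0 = taylor_coef (F i ord0) n.
Proof. by rewrite mxE. Qed.

Definition veval a : hvec := \col_i peval (fun n => a n i ord0).

Lemma l2_coords a : l2 a <-> forall i, square_summable (fun n => a n i ord0).
Proof.
split=> [la i|h].
  apply: series_le_cvg la => n; [exact: sqr_ge0|exact: sqv_ge0|exact: coord_le_sqv].
rewrite /l2 /sqv; elim: (index_enum _) => [|i r IH].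
  rewrite (_ : series _ = fun=> 0); first exact: is_cvg_cst.
  by apply/funext => n; rewrite /series /= big1 // => k _; rewrite big_nil.
by under eq_fun do rewrite big_cons; exact: (is_cvg_seriesD (h i) IH).
Qed.

Lemma square_summable_radius (b : nat -> C) : square_summable b -> radius_ge1 b.
Proof.
move=> sb; apply: (@bounded_radius_ge1 _ _ (rsum (fun n => normc (b n) ^+ 2) + 1)).
move=> n; have h : normc (b n) ^+ 2 <= rsum (fun n => normc (b n) ^+ 2).
  by apply: (term_le_rsum n _ sb) => k; exact: sqr_ge0.
have := cnorm_ge0 (b n); nra.
Qed.

Lemma H2vec_coef F : H2vec F -> l2 (vcoef F) /\
  forall i, power_series_on_disk (F i ord0) (fun n => vcoef F n i ord0).
Proof.
move=> HF.
have E i b : power_series_on_disk (F i ord0) b -> (fun n => vcoef F n i ord0) = b.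
  by move=> Fb; apply/funext => n; rewrite vcoef_coord (taylor_coefE Fb).
split=> [|i].
  by apply/l2_coords => i; have [b [Fb sb]] := HF i; rewrite (E _ _ Fb).
by have [b [Fb sb]] := HF i; rewrite (E _ _ Fb).
Qed.

Lemma vcoefE F a : (forall i, power_series_on_disk (F i ord0) (fun n => a n i ord0)) ->
  vcoef F = a.
Proof.
move=> h; apply/funext => n; apply/colP => i; rewrite vcoef_coord.
by rewrite (taylor_coefE (h i)).
Qed.

Lemma H2vecE F a : (forall i, power_series_on_disk (F i ord0) (fun n => a n i ord0)) ->
  l2 a -> H2vec F.
Proof. by move=> h /l2_coords la i; exists (fun n => a n i ord0). Qed.

Lemma veval_power_series a i : l2 a ->
  power_series_on_disk (veval a i ord0) (fun n => a n i ord0).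
Proof.
move=> /l2_coords la; rewrite mxE; apply: peval_power_series.
exact: square_summable_radius.
Qed.

Lemma H2vec_veval a : l2 a -> H2vec (veval a).
Proof. by move=> la; apply: (H2vecE _ la) => i; exact: veval_power_series. Qed.

Lemma vevalK a : l2 a -> vcoef (veval a) = a.
Proof. by move=> la; apply: vcoefE => i; exact: veval_power_series. Qed.

Lemma ip_H2vecE F G : H2vec F -> H2vec G -> ip_H2vec F G = ips (vcoef F) (vcoef G).
Proof.
move=> /H2vec_coef[lF _] /H2vec_coef[lG _]; apply/esym; apply: cser_csum.
rewrite /dotc /ip_H2vec; apply: cser_sum => i _.
pose u n := taylor_coef (F i ord0) n * (taylor_coef (G i ord0) n)^*.
have hu : asum u.
  apply: (@asum_le _ _ (fun n => sqv (vcoef F n) + sqv (vcoef G n))); last first.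
    exact: (is_cvg_seriesD lF lG).
  move=> n; rewrite Normc.normcM normcJ.
  apply: le_trans (mulr_le_sqrD _ _) _; rewrite -!vcoef_coord.
  by apply: lerD; exact: coord_le_sqv.
apply: cser_ext (asum_cser hu) => n.
by rewrite /u -!vcoef_coord.
Qed.

Lemma vcoefB F G : H2vec F -> H2vec G ->
  H2vec (F - G) /\ vcoef (F - G) = vcoef F - vcoef G.
Proof.
move=> /H2vec_coef[lF hF] /H2vec_coef[lG hG].
have h i : power_series_on_disk ((F - G) i ord0)
    (fun n => (vcoef F - vcoef G) n i ord0).
  have -> : (F - G) i ord0 = F i ord0 + (fun z => -1 * G i ord0 z).
    by rewrite !mxE; apply/funext => z; rewrite !fctE mulN1r.
  have -> : (fun n => (vcoef F - vcoef G) n i ord0) =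
      (fun n => vcoef F n i ord0) + (fun n => -1 * vcoef G n i ord0).
    by apply/funext => n; rewrite !fctE mulN1r [LHS]mxE [X in _ + X = _]mxE.
  by apply: power_seriesD; [exact: hF|exact: power_seriesZ].
by split; [apply: (H2vecE h); exact: l2B|exact: vcoefE].
Qed.

Lemma vcoef_mulz F : H2vec F ->
  H2vec (mulz F) /\ vcoef (mulz F) = consv 0 (vcoef F).
Proof.
move=> /H2vec_coef[lF hF].
have h i : power_series_on_disk (mulz F i ord0)
    (fun n => (consv 0 (vcoef F) : seqv) n i ord0).
  move=> z; have := cserZ (val z) (hF i z).
  have -> : mulz F i ord0 z = val z * F i ord0 z by rewrite /mulz mxE.
  move=> hz.
  have := @cser_unshift _ (fun n => (consv 0 (vcoef F) : seqv) n i ord0 * val z ^+ n)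
    (val z * F i ord0 z).
  rewrite /= mxE mul0r addr0; apply.
  by apply: cser_ext hz => n /=; rewrite exprS mulrCA.
by split; [apply: (H2vecE h); exact: l2_consv|exact: vcoefE].
Qed.

Variable Theta : 'M[disk R -> C]_m.
Hypothesis Theta_Hinf : Hinf_mx Theta.

Definition mcoef n : 'M[C]_m := \matrix_(i, j) taylor_coef (Theta i j) n.

Lemma mcoef_power_series i j :
  power_series_on_disk (Theta i j) (fun n => mcoef n i j).
Proof.
have [[b hb] _] := Theta_Hinf i j.
rewrite (_ : (fun n => _) = b) //; apply/funext => n.
by rewrite mxE (taylor_coefE hb).
Qed.

Lemma mulmx_power_series F a :
  (forall i, power_series_on_disk (F i ord0) (fun n => a n i ord0)) ->
  forall i, power_series_on_disk ((Theta *m F) i ord0) (fun n => mconv mcoef a n i ord0).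
Proof.
move=> h i; rewrite mxE.
have -> : (fun n => mconv mcoef a n i ord0) = fun n => \sum_j
    cauchy_prod (fun n => mcoef n i j) (fun n => a n j ord0) n.
  apply/funext => n; rewrite /mconv summxE /cauchy_prod exchange_big.
  by apply: eq_bigr => k _; rewrite mxE.
have -> : \sum_j Theta i j * F j ord0 = fun z => \sum_j (Theta i j * F j ord0) z.
  by apply/funext => z; rewrite fct_sumE.
apply: (@power_series_sum _ _ _ (fun j => Theta i j * F j ord0)) => j.
apply: power_seriesM; [exact: mcoef_power_series|exact: h].
Qed.

Lemma Hinf_polynomial N (p : nat -> C) : Hinf (peval (fun n => if (n < N)%N then p n else 0)).
Proof.
have E z : peval (fun n => if (n < N)%N then p n else 0) z = \sum_(n < N) p n * val z ^+ n.
  apply: cser_csum.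
  have := @cser_fin _ (fun n => (if (n < N)%N then p n else 0) * val z ^+ n) N.
  rewrite (eq_bigr (fun n : 'I_N => p n * val z ^+ n)).
    by apply=> n Nn; rewrite ltnNge Nn mul0r.
  by move=> n _; rewrite ltn_ord.
apply: (@Hinf_peval _ _ (\sum_(n < N) normc (p n))).
  apply: (@bounded_radius_ge1 _ _ (\sum_(n < N) normc (p n))) => n.
  case: ifP => [nN|_]; last first.
    by rewrite Normc.normc0; apply: sumr_ge0 => i _; exact: cnorm_ge0.
  rewrite (bigD1 (Ordinal nN)) //= lerDl; apply: sumr_ge0 => i _; exact: cnorm_ge0.
move=> z; rewrite E; apply: le_trans (le_normc_sum _ _ _) _; apply: ler_sum => n _.
rewrite Normc.normcM normcX ler_piMr ?cnorm_ge0 // exprn_ile1 ?cnorm_ge0 //.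
by rewrite ltW // disk_lt1.
Qed.

Hypothesis Theta_rigid : rigid Theta.
Local Notation mu := (@lebesgue_measure R).

(** [Q] is read off at a single good boundary point and is the same almost everywhere by
    [initproj_unique]. The boundary norm of [Theta p] is then that of [Q p], again a trigonometric
    polynomial, and [boundary_norm] applies. *)
Lemma rigid_isometry : exists Q : 'M[C]_m, [/\ Q *m Q = Q, adjmx Q = Q &
  forall N p, l2 (mconv mcoef (truncv N p)) /\
    N2 (mconv mcoef (truncv N p)) = \sum_(n < N) sqv (Q *m p n)].
Proof.
have [_ [E aeE]] := Theta_rigid.
have [t0 [t0I [A0 [_ A0i A0E]]]] : exists t0, t0 \in `[0, 2 * pi] /\ exists A : 'M[C]_m,
   [/\ forall i j, nt_lim (Theta i j) (expi t0) (A i j),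
            partial_isometry A & initial_space A = E].
  (* Without a good point, the null set would contain the whole interval, which has measure
     [2 * pi]. *)
  apply: contrapT => no; have [N [mN N0 subN]] := aeE.
  have : (mu `[0%R, (2 * pi)%R]%classic <= mu N)%E.
    apply: le_measure; rewrite ?inE //.
    by move=> t It; apply: subN => /= h; apply: no; exists t; split; [exact: It|exact: (h It)].
  rewrite N0 lebesgue_measure_itv /= lte_fin pi2_gt0 /= lee_fin subr0.
  by rewrite leNgt pi2_gt0.
exists (initproj A0); split; [exact: initproj_idem|exact: initproj_adj|].
move=> N p; set q := truncv N p.
have lq : l2 q by exact: l2_truncv.
pose P := veval q.
have qE j : (fun n => q n j ord0) = fun n => if (n < N)%N then p n j ord0 else 0.
  by apply/funext => n; rewrite /q /truncv; case: ifP; rewrite ?mxE.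
have PE j z : P j ord0 z = \sum_(n < N) p n j ord0 * val z ^+ n.
  rewrite mxE qE; apply: cser_csum.
  have := @cser_fin _ (fun n => (if (n < N)%N then p n j ord0 else 0) * val z ^+ n) N.
  rewrite (eq_bigr (fun n : 'I_N => p n j ord0 * val z ^+ n)).
    by apply=> n Nn; rewrite ltnNge Nn mul0r.
  by move=> n _; rewrite ltn_ord.
have := @boundary_norm R m (mconv mcoef q) (fun n => initproj A0 *m p n)
  (fun i => (Theta *m P) i ord0) N.
apply.
- by apply: mulmx_power_series => i; exact: veval_power_series.
- move=> i; rewrite mxE; apply: Hinf_sum => j; apply: HinfM; first exact: Theta_Hinf.
  by rewrite mxE qE; exact: Hinf_polynomial.
- move: aeE; apply: filterS; first exact: (ae_filter_ringOfSetsType mu).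
  move=> t h It; have [A [Ant Ai AE]] := h It.
  pose b : 'cV[C]_m := \col_j trigpoly (fun n => p n j ord0) N t.
  exists (A *m b).
    move=> i; have -> : (A *m b) i ord0 = \sum_j A i j * b j ord0 by rewrite mxE.
    rewrite /=; have -> : (fun k => (Theta *m P) i ord0 (radial k t)) =
        fun k => \sum_j Theta i j (radial k t) * P j ord0 (radial k t).
      by apply/funext => k; rewrite mxE fct_sumE.
    apply: cvgC_sum => j; apply: cvgCM; first exact: nt_lim_radial.
    under eq_fun do rewrite PE; rewrite mxE.
    apply: cvgC_sum => n; apply: cvgCM; first exact: cvgC_cst.
    by apply: cvgC_exp; exact: radial_cvg.
  rewrite sqv_initproj // (initproj_unique Ai A0i); last by rewrite AE A0E.
  move: (initproj A0) => Q0.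
  congr sqv; apply/colP => i; rewrite !mxE /trigpoly.
  under eq_bigr do rewrite mxE mulr_sumr.
  rewrite exchange_big; apply: eq_bigr => n _; rewrite mxE mulr_suml.
  by apply: eq_bigr => j _; rewrite mulrA.
Qed.

End HardyCoefficients.

(** * The Bezout equation *)

Section Coanalytic.
Variables (R : realType) (m n : nat).
Local Notation C := R[i].
Variable P : nat -> 'M[C]_(n, m).
Implicit Types (p q : nat -> 'cV[C]_m).

Lemma coanalyticP K a p q :
  coanalytic P K (a *: p + q) = a *: coanalytic P K p + coanalytic P K q.
Proof.
apply/funext => l; rewrite !fctE /coanalytic scaler_sumr -big_split /=.
by apply: eq_bigr => N _; rewrite mulmxDr scalemxAr.
Qed.

Lemma coanalytic_widen K K' p : (K <= K')%N ->
  (forall N, (K <= N)%N -> p N = 0) -> coanalytic P K' p = coanalytic P K p.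
Proof.
move=> KK' pK; apply/funext => l; rewrite /coanalytic.
rewrite -(big_mkord (fun N => (l <= N)%N) (fun N => P (N - l)%N *m p N)).
rewrite (@big_cat_nat _ _ _ K) //= big_mkord [X in _ + X]big_nat_cond.
by rewrite [X in _ + X]big1 ?addr0 // => N /andP[/andP[KN _] _]; rewrite pK // mulmx0.
Qed.

Lemma coanalytic_bshift K p : coanalytic P K (bshift p) = bshift (coanalytic P K.+1 p).
Proof.
apply/funext => l; rewrite /bshift /coanalytic [RHS]big_mkcond big_ord_recl /= add0r.
by rewrite [LHS]big_mkcond; apply: eq_bigr => N _.
Qed.

Lemma truncv_id K p : (forall N, (K <= N)%N -> p N = 0) -> truncv K p = p.
Proof.
by move=> pK; apply/funext => N; rewrite /truncv; case: ltnP => // /pK.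
Qed.

Lemma coanalytic_monov d (u : 'cV[C]_m) l : (l <= d)%N ->
  coanalytic P d.+1 (monov d u) l = P (d - l)%N *m u.
Proof.
move=> ld; rewrite /coanalytic big_mkcond big_ord_recr /= ld.
have -> : monov d u d = u by rewrite /monov eqxx.
rewrite big1 ?add0r // => N _; case: ifP => // _.
by rewrite /monov ltn_eqF // mulmx0.
Qed.

End Coanalytic.

Lemma sum_col_mx (V : nmodType) (k m n : nat) (I : Type) (r : seq I) (P : pred I)
    (F : I -> 'M[V]_(k, n)) (G : I -> 'M[V]_(m, n)) :
  \sum_(i <- r | P i) col_mx (F i) (G i) =
  col_mx (\sum_(i <- r | P i) F i) (\sum_(i <- r | P i) G i).
Proof.
by elim/big_rec3: _ => [|i x u v _ ->]; rewrite ?col_mx0 ?add_col_mx.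
Qed.

Lemma sqv_col_mx (R : realType) (k m : nat) (u : 'cV[R[i]]_k) (v : 'cV[R[i]]_m) :
  sqv (col_mx u v) = sqv u + sqv v.
Proof.
rewrite /sqv big_split_ord /=; congr (_ + _); apply: eq_bigr => i _.
  by rewrite col_mxEu.
by rewrite col_mxEd.
Qed.

Section Bezout.
Variables (R : realType) (m k : nat).
Local Notation C := R[i].
Variables (Th : nat -> 'M[C]_m) (Q : 'M[C]_m).
Hypothesis QQ : Q *m Q = Q.
Hypothesis Qadj : adjmx Q = Q.
Hypothesis Th_iso : forall N p, l2 (mconv Th (truncv N p)) /\
  N2 (mconv Th (truncv N p)) = \sum_(n < N) sqv (Q *m p n).
Variables (y : (nat -> 'cV[C]_m) -> nat -> 'cV[C]_k) (A B : R).
(** [Ker T_Theta^*], the coefficient sequences of [K_Theta]; [y] stands for the analysis operator of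
    the frame. *)
Let K := [set f : nat -> 'cV[C]_m | l2 f /\ Tst Th f = 0].
Hypotheses (A_gt0 : 0 < A) (B_ge0 : 0 <= B).
Hypothesis yP : forall a f g, K f -> K g -> y (a *: f + g) = a *: y f + y g.
Hypothesis y_bshift : forall f, K f -> y (bshift f) = bshift (y f).
Hypothesis y_frame : forall f, K f ->
  [/\ l2 (y f), A * N2 f <= N2 (y f) & N2 (y f) <= B * N2 f].

Let KP a f g : K f -> K g -> K (a *: f + g).
Proof.
move=> [lf f0] [lg g0]; split; first by apply: l2D => //; exact: l2Z.
by rewrite (TstP QQ Qadj Th_iso) // f0 g0 scaler0 addr0.
Qed.

Let K_bshift f : K f -> K (bshift f).
Proof.
move=> [lf f0]; split; first exact: l2_bshift.
by apply: (etrans (Tst_bshift QQ Qadj Th_iso lf)); rewrite f0.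
Qed.

Lemma frame_shift_graph : shift_graph B [set x | K x.1 /\ x.2 = y x.1].
Proof.
have K0 : K 0.
  split; first exact: l20.
  by apply/funext => l; apply/colP => i; rewrite mxE ips0l mxE.
have y0 : y 0 = 0.
  by have := yP (-1) K0 K0; rewrite scaler0 addr0 scaleN1r addNr.
split=> //=.
- by move=> a x x' [Kx ->] [Kx' ->]; split; [exact: KP|rewrite yP].
- by move=> x [Kx ->]; have [l1 _ h] := y_frame Kx; case: Kx => lx _.
- by move=> x [Kx ->]; split; [exact: K_bshift|rewrite y_bshift].
Qed.

Lemma analytic_bezout : exists (P1 : nat -> 'M[C]_(k, m))
    (P2 : nat -> 'M[C]_(m, k + m)) (c : R),
  [/\ 0 <= c, forall N p, N2 (coanalytic P1 N p) <= B * N2 (truncv N p),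
   forall N p, N2 (coanalytic P2 N p) <= c * N2 (truncv N p) &
   forall d, \sum_(N < d.+1) P2 N *m
       col_mx (P1 (d - N)%N) (adjmx (Th (d - N)%N)) = ((d == 0%N)%:R)%:M].
Proof.
have [G1 [P1 [gG1 subG1 G1P]]] := shift_graph_toeplitz B_ge0 frame_shift_graph.
have [_ G1lin G1b _] := gG1.
pose Pb j : 'M[C]_(k + m, m) := col_mx (P1 j) (adjmx (Th j)).
have Pb_col N p : coanalytic Pb N p =
    fun n => col_mx (coanalytic P1 N p n) (coanalytic (fun j => adjmx (Th j)) N p n).
  apply/funext => l; rewrite /coanalytic.
  by rewrite -sum_col_mx; apply: eq_bigr => N0 _; rewrite mul_col_mx.
(* The constant of the joint lower bound: [N2 p <= 2 * N2 a + 2 * N2 X] by [h4], [h2] and [X2], with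
   [N2 a <= (2 + 2 * B) / A * N2 X] by [h6]. *)
pose c := 2 / A * (2 + 2 * B) + 2.
have c0 : 0 <= c by rewrite addr_ge0 // mulr_ge0 ?divr_ge0 ?addr_ge0 ?mulr_ge0 // ltW.
(* The inverse of the pair on polynomials, with the image first: the joint lower bound becomes the
   upper bound required of a shift graph. *)
pose G2 := [set x : (nat -> 'cV[C]_(k + m)) * (nat -> 'cV[C]_m) |
  exists N, (forall n, (N <= n)%N -> x.2 n = 0) /\ x.1 = coanalytic Pb N x.2].
have gG2 : shift_graph c G2.
  split.
  - exists 0%N; split=> //; apply/funext => l.
    by rewrite /coanalytic big_ord0.
  - move=> a [x1 x2] [x1' x2'] [N [/= xN ->]] [N' [/= xN' ->]].
    exists (maxn N N'); split=> /=.
      move=> n; rewrite geq_max => /andP[Nn N'n].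
      by rewrite !fctE xN // xN' // scaler0 addr0.
    rewrite coanalyticP; congr (_ *: _ + _); apply/esym; apply: coanalytic_widen => //.
      exact: leq_maxl.
    exact: leq_maxr.
  - move=> [x1 p] [N [/= pN ->]]; set X := coanalytic Pb N p.
    have lp : l2 p by exact: l2_fin pN.
    have lX : l2 X by exact: l2_coanalytic.
    split=> //.
    have lT := l2_Tst QQ Qadj Th_iso lp; have lTT := l2_mconv QQ Qadj Th_iso lT.
    pose a := p - mconv Th (Tst Th p).
    have Ka : K a.
      split; first exact: l2B.
      rewrite /a addrC -scaleN1r (TstP QQ Qadj Th_iso) //.
      by rewrite (Tst_mconv_Tst QQ Qadj Th_iso lp) scaleN1r addNr.
    have [lya ya _] := y_frame Ka.
    have Ga : G1 (a, y a) by apply: subG1.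
    have Gp : G1 (p, coanalytic P1 N p) by rewrite -{1}(truncv_id pN); exact: G1P.
    (* The graph bound on the difference of the two pairs compares [y a] with [coanalytic P1 N p],
       up to [B] times the norm of [p - a]. *)
    have [_ _ /=] := G1b _ (G1lin (-1) _ _ Ga Gp).
    rewrite !scaleN1r /=.
    have -> : - a + p = mconv Th (Tst Th p) by rewrite /a opprB subrK.
    move=> h1.
    have h2 : N2 (mconv Th (Tst Th p)) <= N2 (Tst Th p).
      exact: (N2_mconv_le QQ Qadj Th_iso lT).
    have Tp : Tst Th p = coanalytic (fun j => adjmx (Th j)) N p.
      by rewrite -{1}(truncv_id pN) (Tst_truncv QQ Qadj Th_iso).
    have lP1 : l2 (coanalytic P1 N p) by exact: l2_coanalytic.
    have X1 : N2 (coanalytic P1 N p) <= N2 X.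
      apply: rsum_le => // n; rewrite /X Pb_col sqv_col_mx lerDl; exact: sqv_ge0.
    have X2 : N2 (Tst Th p) <= N2 X.
      apply: rsum_le => // n; rewrite /X Pb_col sqv_col_mx Tp lerDr; exact: sqv_ge0.
    have h3 : N2 (y a) <= 2 * N2 (coanalytic P1 N p) +
        2 * N2 (- y a + coanalytic P1 N p).
      have {1}-> : y a = coanalytic P1 N p - (- y a + coanalytic P1 N p).
        by rewrite opprD opprK addrCA subrr addr0.
      have l3 : l2 (- y a + coanalytic P1 N p) by apply: l2D => //; exact: l2N.
      by have := N2D_le lP1 (l2N l3); rewrite N2N.
    have h4 : N2 p <= 2 * N2 a + 2 * N2 (mconv Th (Tst Th p)).
      rewrite -{1}(subrK (mconv Th (Tst Th p)) p); apply: N2D_le => //.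
      by case: Ka.
    have h5 : N2 (y a) <= (2 + 2 * B) * N2 X.
      apply: le_trans h3 _; rewrite [leRHS]mulrDl; apply: lerD; first by rewrite ler_pM2l.
      rewrite -mulrA ler_pM2l //; apply: le_trans h1 _.
      apply: ler_wpM2l => //; exact: le_trans X2.
    have h6 : N2 a <= A^-1 * ((2 + 2 * B) * N2 X).
      by rewrite -(ler_pM2l A_gt0) mulrA mulfV ?mul1r ?gt_eqF //; exact: le_trans h5.
    rewrite /= /c [leRHS]mulrDl; apply: le_trans h4 _; apply: lerD.
      by rewrite -!mulrA ler_pM2l // mulrA.
    by rewrite ler_pM2l //; exact: le_trans X2.
  - move=> [x1 p] [N [/= pN ->]]; exists N; split=> /=.
      by move=> n Nn; apply: pN; exact: leq_trans (leqnSn n).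
    rewrite coanalytic_bshift; congr bshift; apply/esym.
    exact: (coanalytic_widen _ (leqnSn N) pN).
have [G2' [P2 [gG2' subG2 G2P]]] := shift_graph_toeplitz c0 gG2.
have [_ _ G2b _] := gG2'.
exists P1, P2, c; split=> //.
- by move=> N p; have [_ _] := G1b _ (G1P N p).
- by move=> N p; have [_ _] := G2b _ (G2P N p).
move=> d; apply: mx_ext => w; pose p := monov d w.
have pd n : (d < n)%N -> p n = 0 by move=> dn; rewrite /p /monov gtn_eqF.
have G2p : G2' (coanalytic Pb d.+1 p, p) by apply: subG2; exists d.+1.
have q0 n : (d.+1 <= n)%N -> coanalytic Pb d.+1 p n = 0 by exact: coanalytic_ge.
have G2q := G2P d.+1 (coanalytic Pb d.+1 p).
rewrite (truncv_id q0) in G2q.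
(* The image of [z^d w] is a polynomial, so the lifted inverse acts on it through [P2] and must
   return [z^d w]. Coefficient 0 of both sides is the identity of degree [d]. *)
have /(congr1 (fun f => f 0%N)) := shift_graph_single gG2' G2q G2p.
rewrite {1}/coanalytic /p /monov mul_scalar_mx mulmx_suml => h.
transitivity (if 0%N == d then w else 0); last first.
  by rewrite eq_sym; case: eqP => _; rewrite ?scale1r ?scale0r.
rewrite -h; apply: eq_bigr => N _; rewrite subn0 -mulmxA; congr (_ *m _).
by rewrite -/(monov d w) coanalytic_monov // -ltnS.
Qed.

End Bezout.

(** * The model space *)

Section ModelSpace.
Variables (R : realType) (m : nat).
Local Notation C := R[i].
Local Notation hvec := 'cV[disk R -> C]_m.
Variable Theta : 'M[disk R -> C]_m.
Hypothesis Theta_Hinf : Hinf_mx Theta.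
Let Th := mcoef Theta.
Variable Q : 'M[C]_m.
Hypothesis QQ : Q *m Q = Q.
Hypothesis Qadj : adjmx Q = Q.
Hypothesis Th_iso : forall N p, l2 (mconv Th (truncv N p)) /\
  N2 (mconv Th (truncv N p)) = \sum_(n < N) sqv (Q *m p n).
Implicit Types (F G h : hvec).

Let lmc f (lf : l2 f) : l2 (mconv Th f) := l2_mconv QQ Qadj Th_iso lf.

Lemma mulmx_H2vec F : H2vec F ->
  H2vec (Theta *m F) /\ vcoef (Theta *m F) = mconv Th (vcoef F).
Proof.
move=> /H2vec_coef[lF hF]; have h := mulmx_power_series Theta_Hinf hF.
by split; [apply: (H2vecE h); exact: lmc|exact: vcoefE].
Qed.

Lemma K_spaceP F : K_space Theta F <-> H2vec F /\ Tst Th (vcoef F) = 0.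
Proof.
split=> [[HF FK]|[HF FK]]; split => //.
  apply/funext => l; apply/colP => i; rewrite mxE.
  have lmo := l2_monov l (delta_mx i ord0 : 'cV[C]_m).
  have Hmo := H2vec_veval lmo.
  have [HT vT] := mulmx_H2vec Hmo.
  have := FK _ Hmo; rewrite ip_H2vecE // vT vevalK // => ->.
  by rewrite [RHS]mxE.
move=> G HG; have [HT vT] := mulmx_H2vec HG.
rewrite ip_H2vecE // vT.
have [lF _] := H2vec_coef HF; have [lG _] := H2vec_coef HG.
exact: (Tst_ker_orth QQ Qadj Th_iso lF lG FK).
Qed.

(** The adjoint of [S_Theta] on [K_Theta] is the backward shift. The proof also shows that the
    projection exists, so the choice in [orth_proj] is not its default 0. *)
Lemma S_opP F : K_space Theta F -> K_space Theta (S_op Theta F) /\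
  forall h, K_space Theta h ->
    ip_H2vec h (S_op Theta F) = ips (bshift (vcoef h)) (vcoef F).
Proof.
move=> KF; have [HF _] := KF; have [lF _] := H2vec_coef HF.
have [HM vM] := vcoef_mulz HF.
have lM : l2 (consv 0 (vcoef F)) by exact: l2_consv.
have lT := l2_Tst QQ Qadj Th_iso lM.
have lTT := lmc lT.
have lg := l2B lM lTT.
have Hg := H2vec_veval lg.
(* The projection onto [Ker T_Theta^*] is [1 - T_Theta T_Theta^*], because [T_Theta] is a partial
   isometry. *)
have ex : exists g, K_space Theta g /\
    forall h, K_space Theta h -> ip_H2vec (mulz F - g) h = 0.
  exists (veval (consv 0 (vcoef F) - mconv Th (Tst Th (consv 0 (vcoef F))))).
  split.
    apply/K_spaceP; split => //; rewrite vevalK // addrC -scaleN1r.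
    rewrite (TstP QQ Qadj Th_iso) // (Tst_mconv_Tst QQ Qadj Th_iso lM).
    by rewrite scaleN1r addNr.
  move=> h Kh; have /K_spaceP[Hh h0] := Kh; have [lh _] := H2vec_coef Hh.
  have [HB vB] := vcoefB HM Hg.
  rewrite ip_H2vecE // vB vM vevalK // opprB addrC subrK.
  by rewrite -ips_conj // (Tst_ker_orth QQ Qadj Th_iso lh lT h0) cj0.
have := xgetPex 0 ex; rewrite -/(S_op Theta F) => -[KS oS].
split=> // h Kh; have [Hh _] := Kh; have [HS _] := KS.
have [lh _] := H2vec_coef Hh; have [lS _] := H2vec_coef HS.
have [HB vB] := vcoefB HM HS.
have := oS h Kh; rewrite ip_H2vecE // vB vM ipsBl // => /eqP.
rewrite subr_eq0 => /eqP e.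
rewrite (ip_H2vecE Hh HS) -(ips_conj lS lh) -e (ips_conj lM lh).
rewrite (ips_consv 0 lh lF) dotc0r add0r; exact: erefl.
Qed.

Lemma K_space_bshift h : K_space Theta h ->
  K_space Theta (veval (bshift (vcoef h))) /\
  vcoef (veval (bshift (vcoef h))) = bshift (vcoef h).
Proof.
move=> /K_spaceP[Hh h0]; have [lh _] := H2vec_coef Hh.
have lb := l2_bshift lh; split; last exact: (vevalK lb).
apply/K_spaceP; split; first exact: (H2vec_veval lb).
rewrite (vevalK lb); apply: (etrans (Tst_bshift QQ Qadj Th_iso lh)).
by rewrite h0.
Qed.

Lemma iter_S_opP l h G : K_space Theta h -> K_space Theta G ->
  K_space Theta (iter l (S_op Theta) G) /\
  ip_H2vec h (iter l (S_op Theta) G) = ips (iter l (@bshift R m) (vcoef h)) (vcoef G).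
Proof.
move=> + KG; elim: l h => [|l IH] h Kh.
  by split => //=; rewrite ip_H2vecE //; [case: Kh|case: KG].
have [KI _] := IH h Kh; have [KS hS] := S_opP KI.
split; first exact: KS.
rewrite [iter _ _ G]iterS (hS h Kh).
have [Kb vb] := K_space_bshift Kh; have [_ h1] := IH _ Kb.
rewrite vb in h1; rewrite iterSr -h1.
have [HI _] := KI; have [Hb _] := Kb.
by rewrite (ip_H2vecE Hb HI) vb; exact: erefl.
Qed.

Variables (k : nat) (g : 'I_k -> hvec).
Hypothesis Kg : forall j, K_space Theta (g j).

(** The operator [D] on coefficients. On the model space its entries are the frame coefficients, by
    [iter_S_opP]; written with backward shifts of [f], it visibly commutes with [bshift]. *)
Definition analysis (f : nat -> 'cV[C]_m) : nat -> 'cV[C]_k :=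
  fun l => \col_j ips (iter l (@bshift R m) f) (vcoef (g j)).

Lemma l2_iter_bshift l (f : nat -> 'cV[C]_m) : l2 f -> l2 (iter l (@bshift R m) f).
Proof. by move=> lf; elim: l => //= l; exact: l2_bshift. Qed.

Arguments l2_iter_bshift l {f} _.

Lemma iter_bshiftP l a (f f' : nat -> 'cV[C]_m) :
  iter l (@bshift R m) (a *: f + f') =
  a *: iter l (@bshift R m) f + iter l (@bshift R m) f'.
Proof. by elim: l => //= l ->. Qed.

Lemma analysisP a f f' : l2 f -> l2 f' ->
  analysis (a *: f + f') = a *: analysis f + analysis f'.
Proof.
move=> lf lf'; apply/funext => l; apply/colP => j; rewrite !fctE !mxE iter_bshiftP.
have [lg _] := H2vec_coef (proj1 (Kg j)).
have l1 := l2_iter_bshift l lf; have l1' := l2_iter_bshift l lf'.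
by rewrite ipsDl ?ipsZl //; exact: l2Z.
Qed.

Lemma analysis_bshift f : analysis (bshift f) = bshift (analysis f).
Proof.
by apply/funext => l; apply/colP => j; rewrite /bshift !mxE iterSr.
Qed.

Lemma analysis_frame (A B : R) :
  (forall h, K_space Theta h ->
    ((A * N2 (vcoef h))%:E <= \sum_(l <oo) (\sum_(j < k)
      normc (ip_H2vec h (iter l (S_op Theta) (g j))) ^+ 2)%:E)%E /\
    (\sum_(l <oo) (\sum_(j < k)
      normc (ip_H2vec h (iter l (S_op Theta) (g j))) ^+ 2)%:E
      <= (B * N2 (vcoef h))%:E)%E) ->
  forall f, l2 f /\ Tst Th f = 0 ->
    [/\ l2 (analysis f), A * N2 f <= N2 (analysis f) & N2 (analysis f) <= B * N2 f].
Proof.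
move=> fr f [lf f0].
have Kf : K_space Theta (veval f).
  by apply/K_spaceP; rewrite vevalK //; split => //; exact: H2vec_veval.
have := fr _ Kf; rewrite vevalK //.
have -> : (\sum_(l <oo) (\sum_(j < k) normc (ip_H2vec (veval f)
    (iter l (S_op Theta) (g j))) ^+ 2)%:E = \sum_(l <oo) (sqv (analysis f l))%:E)%E.
  apply: eq_eseriesr => l _; congr (_%:E); apply: eq_bigr => j _.
  by rewrite mxE (iter_S_opP l Kf (Kg j)).2 vevalK.
have s0 n : (0 <= (sqv (analysis f n))%:E)%E by rewrite lee_fin sqv_ge0.
move=> [h1 h2].
have [ly yB] : l2 (analysis f) /\ N2 (analysis f) <= B * N2 f.
  apply: N2_le_ub => N; rewrite -lee_fin -sumEFin; apply: le_trans h2.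
  rewrite -(big_mkord xpredT (fun i => (sqv (analysis f i))%:E)).
  exact: nneseries_lim_ge.
split=> //; rewrite -lee_fin; apply: le_trans h1 _.
apply: lime_le; first exact: is_cvg_nneseries.
apply: nearW => N; rewrite sumEFin lee_fin big_mkord.
exact: partial_le_N2.
Qed.

End ModelSpace.

(** * Characters and the rank inequality *)

Section Characters.
Variables (R : realType) (x : (disk R -> R[i]) -> R[i]).
Local Notation C := R[i].
Hypothesis xM : max_ideal_space x.

Lemma character1 : x 1 = 1.
Proof.
have [_ _ xmul [f Hf xf] _] := xM.
have := xmul 1 f (@Hinf1 R) Hf; rewrite mul1r => /eqP.
by rewrite eq_sym -subr_eq0 -{2}[x f]mul1r -mulrBl mulf_eq0 (negPf xf) orbF
  subr_eq0 => /eqP.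
Qed.

Lemma character0 : x 0 = 0.
Proof.
have [xadd _ _ _ _] := xM.
have := xadd 0 0 (@Hinf0 R) (@Hinf0 R); rewrite addr0 => /eqP.
by rewrite -subr_eq0 opprD addrA subrr add0r oppr_eq0 => /eqP.
Qed.

Lemma character_sum (I : Type) (r : seq I) (F : I -> disk R -> C) :
  (forall i, Hinf (F i)) -> x (\sum_(i <- r) F i) = \sum_(i <- r) x (F i).
Proof.
move=> HF; have [xadd _ _ _ _] := xM.
elim: r => [|i r IH]; first by rewrite !big_nil character0.
by rewrite !big_cons xadd ?IH //; exact: Hinf_sum.
Qed.

Lemma character_mulmx (m n p : nat) (X : 'M[disk R -> C]_(m, n))
    (Y : 'M[disk R -> C]_(n, p)) :
  (forall i j, Hinf (X i j)) -> (forall i j, Hinf (Y i j)) ->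
  map_mx x (X *m Y) = map_mx x X *m map_mx x Y.
Proof.
move=> HX HY; have [_ _ xmul _ _] := xM.
apply/matrixP => i j; rewrite !mxE character_sum; last by move=> s; exact: HinfM.
by apply: eq_bigr => s _; rewrite xmul // !mxE.
Qed.

End Characters.

(** A right-invertible block row has rank at least [m], and its block [U] has only [k] columns to
    contribute. *)
Lemma dim_ker_row_mx (R : realType) (m k : nat) (U : 'M[R[i]]_(m, k))
    (T : 'M[R[i]]_m) (Y : 'M[R[i]]_(k + m, m)) :
  row_mx U T *m Y = 1%:M -> (dim_ker T <= k)%N.
Proof.
move=> UTY; rewrite /dim_ker mxrank_ker mxrank_tr leq_subLR.
have h : (m <= \rank (row_mx U T))%N.
  by rewrite -{1}(mxrank1 R[i] m) -UTY mxrankM_maxl.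
apply: leq_trans h _; rewrite -mxrank_tr tr_row_mx -addsmxE.
apply: leq_trans (mxrank_adds_leqif _ _).1 _.
by rewrite addnC mxrank_tr; apply: leq_add => //; exact: rank_leq_row.
Qed.

Section CoronaIdentity.
Variables (R : realType) (m k : nat).
Local Notation C := R[i].
Variable Theta : 'M[disk R -> C]_m.
Hypothesis Theta_Hinf : Hinf_mx Theta.
Variables (P1 : nat -> 'M[C]_(k, m)) (P2 : nat -> 'M[C]_(m, k + m)) (b c : R).
Hypotheses (b_ge0 : 0 <= b) (c_ge0 : 0 <= c).
Hypothesis P1_le : forall N p, N2 (coanalytic P1 N p) <= b * N2 (truncv N p).
Hypothesis P2_le : forall N p, N2 (coanalytic P2 N p) <= c * N2 (truncv N p).
Hypothesis bezout : forall d, \sum_(N < d.+1) P2 N *m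
  col_mx (P1 (d - N)%N) (adjmx (mcoef Theta (d - N)%N)) = ((d == 0%N)%:R)%:M.

(** The hypothesis [bezout] is the conjugate transpose of the product sought, coefficient by
    coefficient: [U] and [Y] carry the conjugated transposed coefficients of [P1] and [P2], while
    those of [Theta] are recovered from their adjoints. *)
Lemma corona_identity : exists (U : 'M[disk R -> C]_(m, k)) (Y : 'M[disk R -> C]_(k + m, m)),
  [/\ forall i j, Hinf (U i j), forall i j, Hinf (Y i j) & row_mx U Theta *m Y = 1%:M].
Proof.
pose U : 'M[disk R -> C]_(m, k) := \matrix_(i, s) peval (fun j => (P1 j s i)^*).
pose Y : 'M[disk R -> C]_(k + m, m) := \matrix_(s, i) peval (fun j => (P2 j i s)^*).
pose Pb j : 'M[C]_(k + m, m) := col_mx (P1 j) (adjmx (mcoef Theta j)).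
have HU i j : Hinf (U i j) by rewrite mxE; exact: (Hinf_symbol _ _ b_ge0 P1_le).
have HY i j : Hinf (Y i j) by rewrite mxE; exact: (Hinf_symbol _ _ c_ge0 P2_le).
have psY s i : power_series_on_disk (Y s i) (fun j => (P2 j i s)^*).
  rewrite mxE; apply: peval_power_series; apply: radius_conj.
  exact: (symbol_radius P2 P2_le).
have psX i s : power_series_on_disk (row_mx U Theta i s) (fun j => (Pb j s i)^*).
  case: (split_ordP s) => s' ->.
    rewrite row_mxEl [U _ _]mxE.
    have -> : (fun j => (Pb j (lshift m s') i)^*) = fun j => (P1 j s' i)^*.
      by apply/funext => j; rewrite /Pb col_mxEu.
    apply: peval_power_series; apply: radius_conj.
    exact: (symbol_radius P1 P1_le).
  rewrite row_mxEr.
  have -> : (fun j => (Pb j (rshift k s') i)^*) = fun j => mcoef Theta j i s'.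
    apply/funext => j; rewrite /Pb col_mxEd.
    by rewrite [adjmx _ _ _]mxE cjK [LHS]mxE.
  exact: mcoef_power_series.
exists U, Y; split=> //; apply/matrixP => i i'.
rewrite [LHS]mxE.
have h1 : power_series_on_disk (\sum_s row_mx U Theta i s * Y s i')
    (fun d => if d == 0%N then (i == i')%:R else 0).
  (* Scalar factors are swapped to match [bezout], where [P2] comes first; its entry [(i', i)] then
     yields the entry [(i, i')] here. *)
  have -> : \sum_s row_mx U Theta i s * Y s i' =
      fun z => \sum_s (Y s i' * row_mx U Theta i s) z.
    apply/funext => z; rewrite fct_sumE; apply: eq_bigr => s _.
    by rewrite mulrC.
  have -> : (fun d => if d == 0%N then (i == i')%:R else 0) = fun d =>
     \sum_s cauchy_prod (fun j => (P2 j i' s)^*) (fun j => (Pb j s i)^*) d.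
    apply/funext => d; have /matrixP/(_ i' i) := bezout d.
    rewrite summxE [X in _ = X]mxE => /(congr1 Num.conj).
    rewrite cj_sum => h.
    transitivity (((d == 0%N)%:R *+ (i' == i) : C)^*).
      case: (d == 0%N); rewrite /= (eq_sym i'); case: (i == i') => /=;
        by rewrite ?mulr1n ?mulr0n ?cj0 ?cj1.
    rewrite -h /cauchy_prod exchange_big; apply: eq_bigr => N _.
    rewrite mxE cj_sum; apply: eq_bigr => s _; exact: cjM.
  by apply: power_series_sum => s; exact: power_seriesM.
have h2 : power_series_on_disk ((i == i')%:R : disk R -> C)
    (fun d => if d == 0%N then (i == i')%:R else 0).
  move=> z; have := @power_series_mono R 0 (i == i')%:R z.
  rewrite expr0 mulr1.
  by have -> : ((i == i')%:R : disk R -> C) z = (i == i')%:R by case: (i == i').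
rewrite (power_series_peval h1) -(power_series_peval h2).
by rewrite mxE; case: (i == i').
Qed.

End CoronaIdentity.

(** * The theorem *)

(** With nonnegative terms, the unordered frame sum may be grouped by powers of the operator,
    collecting the [k] orbits into one vector of [C^k] for each power. *)
Lemma esum_setX_ord (R : realType) (J : set nat) (k : nat) (e : nat -> nat)
    (b : nat -> nat -> R) : set_bij `I_k J e -> (forall l j, 0 <= b l j) ->
  (\esum_(i in [set: nat] `*` J) (b i.1 i.2)%:E =
   \sum_(l <oo) (\sum_(j < k) b l (e j))%:E)%E.
Proof.
move=> eJ b0.
have -> : [set: nat] `*` J = [set: nat] `*`` (fun=> J) by [].
rewrite -(@esum_esum _ _ _ [set: nat] (fun=> J) (fun l j => (b l j)%:E)); last first.
  by move=> l j _ _; rewrite lee_fin.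
rewrite nneseries_esumT; last by move=> l; rewrite lee_fin sumr_ge0.
apply: eq_esum => l _.
rewrite (@reindex_esum _ _ _ `I_k J e) // esum_fset //; last first.
  by move=> j _; rewrite lee_fin.
by rewrite -fsbig_ord sumEFin.
Qed.

Lemma orbit_frame_bound (R : realType) (m : nat) (Theta : 'M[disk R -> R[i]]_m)
    (J : set nat) (g : nat -> 'cV[disk R -> R[i]]_m) (k : nat) (e : nat -> nat)
    (x : (disk R -> R[i]) -> R[i]) :
  rigid Theta -> set_bij `I_k J e -> (forall j, J j -> K_space Theta (g j)) ->
  is_frame (@ip_H2vec R m) (K_space Theta) ([set: nat] `*` J)
    (fun p => iter p.1 (S_op Theta) (g p.2)) ->
  max_ideal_space x -> (dim_ker (map_mx x Theta) <= k)%N.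
Proof.
move=> rT eJ Kg [_ [A [B [A0 B0 fr]]]] xM.
have TH : Hinf_mx Theta by case: rT.
have [Q [QQ Qadj Th_iso]] := rigid_isometry TH rT.
pose gi (j : 'I_k) := g (e j).
have Kgi j : K_space Theta (gi j).
  apply: Kg; case: eJ => fe _ _; apply: fe; exact: ltn_ord.
have gframe (h : 'cV[disk R -> R[i]]_m) : K_space Theta h ->
    ((A * N2 (vcoef h))%:E <= \sum_(l <oo) (\sum_(j < k)
      normc (ip_H2vec h (iter l (S_op Theta) (gi j))) ^+ 2)%:E)%E /\
    (\sum_(l <oo) (\sum_(j < k)
      normc (ip_H2vec h (iter l (S_op Theta) (gi j))) ^+ 2)%:E
      <= (B * N2 (vcoef h))%:E)%E.
  move=> Kh; have [Hh _] := Kh; have [lh _] := H2vec_coef Hh.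
  have := fr h Kh.
  rewrite (@esum_setX_ord _ J k e
    (fun l j => normc (ip_H2vec h (iter l (S_op Theta) (g j))) ^+ 2)) //; last first.
    by move=> l j; exact: sqr_ge0.
  by rewrite /sqnorm (ip_H2vecE Hh Hh) (ips_self lh) /=.
have [P1 [P2 [c [c0 P1le P2le bez]]]] := @analytic_bezout R m k (mcoef Theta) Q QQ Qadj
  Th_iso (analysis gi) A B A0 (ltW B0)
  (fun a f f' Kf Kf' => analysisP Kgi a (proj1 Kf) (proj1 Kf'))
  (fun f _ => analysis_bshift gi f)
  (analysis_frame TH QQ Qadj Th_iso Kgi gframe).
have [U [Y [HU HY UY]]] := corona_identity TH (ltW B0) c0 P1le P2le bez.
apply: (@dim_ker_row_mx R m k (map_mx x U) (map_mx x Theta) (map_mx x Y)).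
rewrite -map_row_mx -character_mulmx //.
  rewrite UY; apply/matrixP => i j; rewrite !mxE.
  by case: (i == j); rewrite ?mulr1n ?mulr0n (character0 xM, character1 xM).
move=> i s; case: (split_ordP s) => s' ->; rewrite (row_mxEl, row_mxEr) //.
Qed.

Local Close Scope ring_scope.

Theorem proposition2p13 (R : realType) (m : nat)
    (Theta : 'M[disk R -> R[i]]_m)
    (Theta_rigid : rigid Theta)
    (K_neq0 : K_space Theta <> [set 0%R]) :
  (ereal_sup [set (dim_ker (map_mx x Theta))%:R%:E | x in @max_ideal_space R]
   <= frame_number (@ip_H2vec R m) (K_space Theta) (S_op Theta))%E.
Proof.
apply: ge_ereal_sup => _ [x xM <-].
apply: le_ereal_inf_tmp => _ [J [g [gK gfr]] <-].
(* An infinite family of orbits counts as [+oo], for which the bound is immediate. *)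
rewrite /counting; case: ifPn => [/asboolP|_]; last exact: leey.
move=> /[dup] finJ /finite_setP[k Jk]; rewrite (card_fset_set Jk).
have [e eJ] : exists e : nat -> nat, set_bij `I_k J e.
  by move/card_esym: Jk => /card_set_bijP[e eJ]; exists e.
rewrite lee_fin ler_nat.
exact: (orbit_frame_bound Theta_rigid eJ gK gfr xM).
Qed.
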